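(* Let $\psi:\mathbb{R}_{>0}\to\mathbb{R}_{>0}$ be an arbitrary function with $\psi(z)\to\infty$ as $z\to\infty$. For a real $Q>0$ and an integer $u$ with $0\le u\le 2Q$, let $\mathcal{E}_u(\psi,Q)$ be the set of primes $p\in[Q,2Q]$ with $d_u(p)>\psi(p)$. Then $\#\mathcal{E}_u(\psi,Q)=o(Q/\log Q)$ as $Q\to\infty$, uniformly in $u$; that is, for every $\kappa>0$ there is $Q_0$ such that for all $Q\ge Q_0$ and all integers $0\le u\le 2Q$ we have $\#\mathcal{E}_u(\psi,Q)\le \kappa Q/\log Q$.
   Context: For an odd prime $p$, an integer $n$ is a quadratic non-residue modulo $p$ if $p\nmid n$ and $n$ is not congruent to a square modulo $p$. For an integer $u$ and a prime $p$, $d_u(p)$ denotes the smallest positive integer $h$ such that the interval $[u+1,u+h]$ contains a quadratic non-residue modulo $p$. (Thus $d_0(p)$ is the smallest quadratic non-residue modulo $p$.) *)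

(* Defs.v *)
From mathcomp Require Import all_boot all_order all_algebra.
From mathcomp Require Import finmap.
From mathcomp Require Import all_classical all_reals all_analysis.

Set Implicit Arguments.
Unset Strict Implicit.
Unset Printing Implicit Defensive.

Import Order.TTheory GRing.Theory Num.Theory.
Import numFieldNormedType.Exports.

Local Open Scope classical_set_scope.
Local Open Scope ring_scope.

Definition quad_nonresidue (p : nat) (n : int) : Prop :=
  ~~ (p %| n)%Z /\ ~ exists x : int, (n = x ^+ 2 %[mod p])%Z.

Definition interval_has_nonresidue (u : int) (p h : nat) : Prop :=
  (0 < h)%N /\
  exists n : int, [/\ u + 1 <= n, n <= u + h%:Z & quad_nonresidue p n].

(* d_u(p). For every odd prime p the minimum exists
   (interval_has_nonresidue_ex); the default 0 is only reached for moduli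
   without non-residues, such as p = 2. *)
Definition nonresidue_dist (u : int) (p : nat) : nat :=
  if pselect (exists h, `[< interval_has_nonresidue u p h >]) is left ex_h
  then ex_minn ex_h else 0.

Definition exceptional_primes (R : realType) (psi : R -> R) (u : int) (Q : R) :
    set nat :=
  [set p : nat | [/\ prime p, Q <= p%:R, p%:R <= 2 * Q
                   & psi p%:R < (nonresidue_dist u p)%:R]].

Lemma interval_has_nonresidue_ex (u : int) (p : nat) :
  prime p -> odd p -> exists h, interval_has_nonresidue u p h.
Proof.
move=> p_pr p_odd; have pcharFp := pchar_Fp p_pr.
have [y ysq] : exists y : 'F_p, forall x : 'F_p, y != x ^+ 2.
  apply/not_existsP => surj.
  have /injectiveP sq_inj : injectiveb [ffun x : 'F_p => x ^+ 2].
    rewrite /injectiveb /dinjectiveb; apply/card_uniqP.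
    rewrite size_map -cardE; apply: eq_card => y; rewrite [RHS]inE.
    have /existsNP[x /negP/negPn/eqP ->] := surj y.
    by apply/mapP; exists x; rewrite ?mem_enum ?ffunE.
  have /sq_inj/eqP : [ffun x : 'F_p => x ^+ 2] 1 = [ffun x => x ^+ 2] (-1).
    by rewrite !ffunE sqrrN.
  rewrite -subr_eq0 opprK -(natrD _ 1 1) -(dvdn_pcharf pcharFp).
  by rewrite dvdn_prime2// => /eqP p2; rewrite p2 in p_odd.
pose n : int := (y : nat)%:Z + p%:Z * (`|u| + 1).
have nE : n%:~R = y :> 'F_p.
  rewrite /n intrD intrM -!pmulrn (pcharf0 pcharFp) mul0r addr0.
  exact: natr_Zp.
have p_gt0 : 1 <= p%:Z by rewrite lez_nat prime_gt0.
have ltun : u + 1 <= n.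
  have le1 : u + 1 <= `|u| + 1 by rewrite lerD2r ler_norm.
  apply: (le_trans le1); rewrite /n -[leLHS]add0r lerD//.
  by rewrite -[leLHS]mul1r ler_wpM2r// addr_ge0.
have ltun0 : 0 < n - u by rewrite subr_gt0 -lezD1.
exists `|n - u|%N; split; first by rewrite absz_gt0 gt_eqF.
exists n; split=> //.
  by rewrite gtz0_abs// addrCA subrr addr0.
split.
  by rewrite (dvdz_pcharf pcharFp) nE; have := ysq 0; rewrite expr0n.
move=> [x /eqP]; rewrite eqz_mod_dvd (dvdz_pcharf pcharFp) intrB subr_eq0 nE.
by rewrite rmorphXn/=; apply/negP/ysq.
Qed.

Lemma nonresidue_distP (u : int) (p : nat) : prime p -> odd p ->
  interval_has_nonresidue u p (nonresidue_dist u p) /\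
  forall h, interval_has_nonresidue u p h -> (nonresidue_dist u p <= h)%N.
Proof.
move=> p_pr p_odd; rewrite /nonresidue_dist; case: pselect => [ex_h|[]].
  case: ex_minnP => m /asboolP ? min_m; split=> // h ?.
  by apply: min_m; apply/asboolP.
have [h ?] := interval_has_nonresidue_ex u p_pr p_odd.
by exists h; apply/asboolP.
Qed.

(* fset_set of an infinite set is empty, so this is what makes
   #|` fset_set (exceptional_primes psi u Q)| the actual cardinality. *)
Lemma finite_exceptional_primes (R : realType) (psi : R -> R) (u : int)
  (Q : R) : finite_set (exceptional_primes psi u Q).
Proof.
apply: (@sub_finite_set _ _ `I_((Num.truncn (2 * Q)).+1)); last exact: finite_II.
move=> p [_ _ p2Q _] /=; rewrite -(ltr_nat R).
exact: le_lt_trans p2Q (truncnS_gt _).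
Qed.

(* Main.v *)
(* Fix H = K^2. If p in [Q, 2Q] is exceptional for u and psi(p) >= H, then no
   n_h = u + 1 + h with h < H is a non-residue modulo p. By quadratic reciprocity, once the
   class of p modulo 4 and the symbol (2/p) are fixed (four classes), (n_h/p) is a sign
   depending only on h times chi_h(p), where chi_h(m) is the product of (m/l) over the odd
   primes l of odd exponent in n_h. So the square of the sum of the H signed characters is at
   least (H - 2)^2 at every exceptional prime of the class.

   We sum this square over all integers m of size Q, weighted by the square of a Selberg weight
   V which is 1 at large primes and satisfies sum V^2 = O(Q / log Q), and expand. Pairs
   (h, h') with chi_h and chi_h' built from the same primes have n_h and n_h' proportional to
   squares up to a factor 2; there are only O(K^3) of them. For the other pairs
   chi_h chi_h' is, up to a coprimality condition, a nontrivial real character of modulus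
   q = O(Q^2), and its sums over intervals of length about Q, which is about sqrt(q), have to be
   bounded with a power saving. This is just beyond the range of the Polya-Vinogradov inequality
   and is supplied by Burgess' method with fourth moments; the complete sums it needs come from
   Stepanov's polynomial method. Altogether the exceptional primes number
   O(Q / (K log Q)), and K is arbitrary. *)

Require Import Defs.
From mathcomp Require Import all_boot all_order all_algebra.
From mathcomp Require Import all_fingroup all_solvable all_field.
From mathcomp Require Import zify ring lra.

Set Implicit Arguments.
Unset Strict Implicit.
Unset Printing Implicit Defensive.

Import Order.TTheory GRing.Theory Num.Theory.

Local Open Scope ring_scope.

(** * Quadratic characters and reciprocity *)

(** Complete sums multiply over the primes of the modulus, so a local bound with a constant above 1
    would lose that constant once per prime factor. The local estimate is therefore relaxed from
    order p^(1/2) to p^(3/4), with constant exactly 1: the constant from Stepanov's method is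
    swallowed once p is large, and the finitely many smaller primes cost one bounded factor. The
    exponent 3/4 still leaves room in the fourth moment for shifts up to q^(1/11).

    Losses are measured on two scales, z about X^(1/2200) for the sieve and t about q^(1/60) for
    Burgess. Expanding the weight costs z^6 and a power of K, so character sums must gain more than
    z^6; they gain z^9. Burgess gains a factor t in the fourth power of a sum, enough when t > z^36;
    for smaller t the modulus is so far below X that periodicity alone suffices.

    An unweighted sum over integers would miss the target Q / log Q by a logarithm. The weight
    recovers it because log z is a fixed fraction of log Q, while all sieve errors remain powers of
    z. *)

Definition qchar (F : finFieldType) (x : F) : int :=
  if x == 0 then 0 else if [exists y : F, y ^+ 2 == x] then 1 else -1.

Section QuadraticCharacter.
Variable F : finFieldType.
Hypothesis F_odd : odd #|F|.
Implicit Types x y : F.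

Lemma qchar0 : qchar (0 : F) = 0.
Proof. by rewrite /qchar eqxx. Qed.

Lemma qchar_sqr x : x != 0 -> qchar (x ^+ 2) = 1.
Proof.
move=> x0; rewrite /qchar expf_eq0 (negPf x0) /=.
have -> // : [exists y, y ^+ 2 == x ^+ 2] by apply/existsP; exists x.
Qed.

Lemma qchar1 : qchar (1 : F) = 1.
Proof. by rewrite -(expr1n F 2) qchar_sqr ?oner_eq0. Qed.

Lemma qchar_eq0 x : (qchar x == 0) = (x == 0).
Proof. by rewrite /qchar; case: (x =P 0) => // _; case: [exists y, _]. Qed.

Lemma normr_qchar_le1 x : `|qchar x| <= 1.
Proof. by rewrite /qchar; case: (x =P 0) => // _; case: [exists y, _]. Qed.

Lemma normr_qchar x : x != 0 -> `|qchar x| = 1.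
Proof. by rewrite /qchar => /negPf->; case: [exists y, _]. Qed.

Lemma card_odd_half : #|F| = (#|F|./2.*2).+1.
Proof. by rewrite -[LHS]odd_double_half F_odd. Qed.

Lemma oner_neqN1 : (1 : F) != -1.
Proof.
apply: contraTneq F_odd => e1.
have ord2 : #[1%R : F]%g = 2.
  apply: nt_prime_order => //; last exact: oner_neq0.
  by rewrite FinRing.zmodXgE mulr2n {2}e1 subrr.
have := order_dvdG (in_setT (1%R : F)); by rewrite ord2 cardsT dvdn2.
Qed.

(** Euler's criterion. The unit group is cyclic of order [#|F|./2.*2], so if [x = u ^ i] has
    [#|F|./2]-th power 1 then [i] is even and [x] is a square. *)
Lemma qchar_euler x : (qchar x)%:~R = x ^+ #|F|./2.
Proof.
have h_gt0 : (0 < #|F|./2)%N.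
  by have := finNzRing_gt1 F; rewrite {1}card_odd_half ltnS double_gt0.
have expF y : y != 0 -> (y ^+ #|F|./2) ^+ 2 = 1.
  move=> y0; rewrite -exprM muln2.
  apply: (mulfI y0); rewrite -exprS -card_odd_half mulr1.
  exact: expf_card.
rewrite /qchar; case: eqVneq => [->|x0]; first by rewrite expr0n eqn0Ngt h_gt0.
case: existsP => [[y /eqP yx]|nsq].
  have y0 : y != 0 by apply: contraNneq x0 => y0; rewrite -yx y0 expr0n.
  by rewrite -yx -exprM mulnC exprM expF.
have /eqP := expF _ x0; rewrite sqrf_eq1 => /orP[/eqP x1|/eqP-> //].
case: nsq.
have /cyclicP[u Eu] := field_unit_group_cyclic [set: {unit F}]%G.
have /cycleP[i Ei] : finField_unit x0 \in <[u]>%g by rewrite -Eu inE.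
have vx : x = val u ^+ i by rewrite -FinRing.val_unitX -Ei.
have ord_u : #[u]%g = (#|F|./2.*2)%N.
  by rewrite orderE -Eu card_finField_unit {1}card_odd_half.
have : (#[u]%g %| i * #|F|./2)%N.
  rewrite order_dvdn -val_eqE /= FinRing.val_unitX exprM -vx x1 ; exact/eqP.
rewrite ord_u -muln2 mulnC dvdn_pmul2r // => /dvdnP[j ij].
by exists (val u ^+ j); rewrite -exprM -ij vx.
Qed.

(** The integers -1, 0 and 1 stay distinct in [F], so identities between character values can be
    proved in [F], where Euler's criterion turns them into identities of powers. *)
Lemma qchar_eq_of_cast (a b : int) : `|a| <= 1 -> `|b| <= 1 ->
  a%:~R = b%:~R :> F -> a = b.
Proof.
have n11 := oner_neqN1; have n10 : (1 : F) != 0 := oner_neq0 _.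
have n01 : (-1 : F) != 0 by rewrite oppr_eq0.
have c3 (c : int) : `|c| <= 1 -> [\/ c = 0, c = 1 | c = -1].
  by case: c => [[|[|n]]|[|n]] // _; [apply: Or31|apply: Or32|apply: Or33].
move=> /c3[] -> /c3[] -> //; rewrite ?mulrNz ?mulr0z ?mulr1z => /eqP e; exfalso; move: e.
all: by apply/negP; rewrite // eq_sym.
Qed.

Lemma qcharM x y : qchar (x * y) = qchar x * qchar y.
Proof.
apply: qchar_eq_of_cast; rewrite ?normr_qchar_le1 //.
  by rewrite normrM mulr_ile1 ?normr_qchar_le1.
by rewrite intrM !qchar_euler exprMn.
Qed.

Lemma qchar_prod (I : Type) (r : seq I) (P : pred I) (f : I -> F) :
  qchar (\prod_(i <- r | P i) f i) = \prod_(i <- r | P i) qchar (f i).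
Proof. exact: (big_morph _ qcharM qchar1). Qed.

Lemma qchar_nonsquare : exists2 y : F, y != 0 & qchar y = -1.
Proof.
case: (pickP (fun y : F => (y != 0) && (qchar y == -1))) => [y /andP[y0 /eqP]|noy].
  by exists y.
have sqE y : y != 0 -> exists z : F, z ^+ 2 == y.
  move=> y0; move: (noy y); rewrite y0 /qchar (negPf y0).
  by case: existsP => [[z zy] _|//]; exists z.
have : injective (fun z : F => z ^+ 2).
  have/injectiveP : injectiveb [ffun z : F => z ^+ 2].
    rewrite /injectiveb /dinjectiveb; apply/card_uniqP.
    rewrite size_map -cardE; apply: eq_card => y; rewrite [RHS]inE.
    have [->|/sqE[z /eqP<-]] := eqVneq y 0; apply/mapP.
      by exists 0; rewrite ?mem_enum ?ffunE ?expr0n.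
    by exists z; rewrite ?mem_enum ?ffunE.
  by move=> inj a b; have := inj a b; rewrite !ffunE.
move=> /(_ 1 (-1)); rewrite sqrrN => /(_ erefl)/eqP.
by rewrite (negPf oner_neqN1).
Qed.

Lemma sum_qchar : \sum_(x : F) qchar x = 0.
Proof.
have [y y0 qy] := qchar_nonsquare.
have : \sum_(x : F) qchar x = - \sum_(x : F) qchar x.
  rewrite {1}(reindex (fun x => y * x)) /=; last first.
    by exists (fun x => y^-1 * x) => x _; rewrite ?mulKf ?mulVKf.
  by rewrite -sumrN; apply: eq_bigr => x _; rewrite qcharM qy mulN1r.
lia.
Qed.
End QuadraticCharacter.

Definition legendre (p m : nat) : int := qchar (m%:R : 'F_p).

Section GaussSum.
Variables (q : nat) (L : fieldType) (z : L).
Hypotheses (q_pr : prime q) (q_odd : odd q) (z_prim : q.-primitive_root z).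

Let e (a : 'F_q) : L := z ^+ a.
Let chi (a : 'F_q) : L := (qchar a)%:~R.

Let F_odd : odd #|'F_q|. Proof. by rewrite card_Fp. Qed.

Let eD a b : e (a + b) = e a * e b.
Proof.
rewrite /e -exprD /= [in X in (_ %% X)%N]Fp_cast //.
by rewrite prim_expr_mod.
Qed.

Let e0 : e 0 = 1. Proof. by rewrite /e expr0. Qed.

Let e_nat n : e n%:R = z ^+ n.
Proof. by rewrite /e val_Fp_nat // prim_expr_mod. Qed.

Let chiM a b : chi (a * b) = chi a * chi b.
Proof. by rewrite /chi qcharM // intrM. Qed.

Let sum_e c : \sum_(a : 'F_q) e (a * c) = if c == 0 then q%:R else 0.
Proof.
have [->|c0] := eqVneq c 0.
  under eq_bigr do rewrite mulr0 e0.
  by rewrite sumr_const card_Fp.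
have e1 : e 1 != 1.
  by rewrite [e 1](e_nat 1) -(prim_order_dvd z_prim) gtnNdvd // prime_gt1.
have -> : \sum_(a : 'F_q) e (a * c) = \sum_(a : 'F_q) e a.
  rewrite [RHS](reindex (fun x => x * c)) //=.
  by exists (fun x => x * c^-1) => x _; rewrite ?mulfK ?mulfVK.
have : \sum_(a : 'F_q) e a = e 1 * \sum_(a : 'F_q) e a.
  rewrite {1}(reindex (fun x => 1 + x)) /=; last first.
    by exists (fun x => -1 + x) => x _; rewrite ?addKr ?addNKr ?addrA ?subrr ?addNr ?add0r.
  by rewrite big_distrr /=; apply: eq_bigr => a _; rewrite eD.
move/eqP; rewrite -subr_eq0 -{1}[X in X - _]mul1r -mulrBl mulf_eq0 subr_eq0.
by rewrite eq_sym (negPf e1) => /eqP.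
Qed.

Let G := \sum_(a : 'F_q) chi a * e a.

(** Writing the second variable as [a * c] removes [a] from the characters. The sum of
    [e (a * (1 + c))] over [a != 0] is then -1, with an extra [q] at [c = -1], and the constant -1
    is killed by [sum_qchar]. *)
Lemma gauss_sum_sqr : G ^+ 2 = (qchar (-1 : 'F_q))%:~R * q%:R.
Proof.
have chi2 a : a != 0 -> chi a * chi a = 1.
  by move=> a0; rewrite -chiM -expr2 /chi qchar_sqr.
rewrite expr2 {1}/G big_distrl /=.
transitivity (\sum_(c : 'F_q) chi c * \sum_(a : 'F_q | a != 0) e (a * (1 + c))).
  under [RHS]eq_bigr do rewrite big_distrr /=.
  rewrite exchange_big /= (bigD1 0) //= {1}/chi qchar0 mulr0z !mul0r add0r.
  apply: eq_bigr => a a0; rewrite /G big_distrr /=.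
  rewrite (reindex (fun x => a * x)) /=; last first.
    by exists (fun x => a^-1 * x) => x _; rewrite ?mulKf ?mulVKf.
  apply: eq_bigr => c _; rewrite chiM mulrDr mulr1 eD.
  by rewrite mulrACA [chi a * (_ * _)]mulrA chi2 // mul1r mulrCA mulrA.
transitivity (\sum_(c : 'F_q) chi c * ((if 1 + c == 0 then q%:R else 0) - 1)).
  apply: eq_bigr => c _; congr (_ * _).
  by rewrite -sum_e [in RHS](bigD1 0) //= mul0r e0 addrAC subrr add0r.
under eq_bigr do rewrite mulrBr mulr1.
rewrite sumrB -[X in _ - X]rmorph_sum /= sum_qchar // mulr0z subr0.
rewrite (bigD1 (-1)) //= subrr eqxx big1 ?addr0 // => c c1.
by rewrite addrC addr_eq0 (negPf c1) mulr0.
Qed.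

(** Frobenius raises [z] to the power [p] and fixes the values of [chi], as [p] is odd; reindexing
    by [p] extracts the symbol of [p] modulo [q]. *)
Lemma gauss_sum_frob p : prime p -> odd p -> p != q -> p \in [pchar L] ->
  G ^+ p = (legendre q p)%:~R * G.
Proof.
move=> p_pr p_odd pq charL.
have p0 : (p%:R : 'F_q) != 0.
  by rewrite -(dvdn_pcharf (pchar_Fp q_pr)) dvdn_prime2 // eq_sym.
have odd_exp (x : 'F_q) : chi x ^+ p = chi x.
  rewrite /chi /qchar; case: eqP => _; first by rewrite expr0n; case: p p_pr {p_odd pq charL p0}.
  by case: ifP => _; rewrite ?expr1n // -signr_odd p_odd.
rewrite -[LHS]/(pFrobenius_aut charL G) rmorph_sum /= big_distrr /=.
rewrite [RHS](reindex (fun x => p%:R * x)) /=; last first.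
  by exists (fun x => p%:R^-1 * x) => x _; rewrite ?mulKf ?mulVKf.
apply: eq_bigr => a _; rewrite pFrobenius_autE exprMn odd_exp.
rewrite mulrA chiM mulrA -/(chi p%:R) -[chi p%:R * _]chiM -expr2.
rewrite [X in X * _ * _]/chi qchar_sqr // mulr1z mul1r; congr (_ * _).
rewrite -[a in RHS]natr_Zp -natrM e_nat /e -exprM mulnC; congr (z ^+ (_ * _)).
Qed.

End GaussSum.

(** [G ^+ p] is evaluated twice in characteristic [p], by Frobenius and through [G ^+ 2]. The sign
    is kept in this form because it depends on [p] only through the parity of [p./2]. *)
Lemma quadratic_reciprocity p q : prime p -> odd p -> prime q -> odd q ->
  p != q ->
  legendre p q = qchar (-1 : 'F_q) ^+ p./2 * legendre q p.
Proof.
move=> p_pr p_odd q_pr q_odd pq.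
have p_ch := pchar_Fp p_pr; have F_odd : odd #|'F_p| by rewrite card_Fp.
have F_oddq : odd #|'F_q| by rewrite card_Fp.
have q0 : (q%:R : 'F_p) != 0.
  by rewrite -(dvdn_pcharf p_ch) dvdn_prime2.
have Xn0 : ('X^q - 1 : {poly 'F_p}) != 0.
  by rewrite monic_neq0 // monicXnsubC ?prime_gt0.
have [L [rs rsE _]] := FinSplittingFieldFor Xn0.
rewrite rmorphB /= map_polyXn rmorph1 in rsE.
have L_ch : p \in [pchar L] by rewrite pchar_lalg.
have q0L : (q%:R : L) != 0 by rewrite -(dvdn_pcharf L_ch) dvdn_prime2.
have rs_uniq : uniq rs.
  by rewrite -separable_prod_XsubC -(eqp_separable rsE) separable_Xn_sub_1.
have rs_size : size rs = q.
  have := eqp_size rsE; rewrite size_prod_XsubC size_XnsubC ?prime_gt0 //.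
  by case.
have [z zrs z1] : exists2 z, z \in rs & z != 1.
  case: rs rs_uniq rs_size {rsE} => [|a [|b rs]] /=.
  - by move=> _ q0'; move: q_pr; rewrite -q0'.
  - by move=> _ q1'; move: q_pr; rewrite -q1'.
  rewrite inE => /andP[/norP[ab _] _] _.
  have [a1|a1] := eqVneq a 1; last by exists a => //; rewrite inE eqxx.
  by exists b; [rewrite !inE eqxx orbT | rewrite -a1 eq_sym].
have zq : z ^+ q = 1.
  have : root ('X^q - 1) z by rewrite (eqp_root rsE) root_prod_XsubC.
  by rewrite rootE !hornerE subr_eq0 => /eqP.
have z_prim : q.-primitive_root z.
  have [m zm mq] := prim_order_exists (prime_gt0 q_pr) zq.
  have /(_ _ mq) := (primeP q_pr).2; case/orP=> /eqP m_eq; move: zm; rewrite m_eq //.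
  by move/prim_expr_order; rewrite expr1 => /eqP; rewrite (negPf z1).
have G2 := gauss_sum_sqr q_pr q_odd z_prim.
have Gp := gauss_sum_frob q_pr q_odd z_prim p_pr p_odd pq L_ch.
set G := \sum_a _ in G2 Gp.
have G0 : G != 0.
  rewrite -sqrf_eq0 G2 mulf_eq0 negb_or q0L andbT.
  rewrite /qchar oppr_eq0 oner_eq0; case: ifP => _.
    by rewrite mulr1z oner_eq0.
  by rewrite rmorphN1 oppr_eq0 oner_eq0.
have {Gp}: (G ^+ 2) ^+ p./2 = (legendre q p)%:~R.
  apply: (mulIf G0); rewrite -Gp -exprM -exprSr.
  by congr (G ^+ _); rewrite mul2n -[in RHS](odd_double_half p) p_odd.
rewrite G2 exprMn => Ep.
have : ((qchar (-1 : 'F_q) ^+ p./2 * legendre p q)%:~R : 'F_p)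
     = (legendre q p)%:~R.
  apply: (fmorph_inj (in_alg L)).
  rewrite !rmorph_int -Ep intrM -rmorphXn /=; congr (_ * _).
  have := congr1 (in_alg L) (qchar_euler F_odd (q%:R : 'F_p)).
  by rewrite rmorph_int rmorphXn /= scaler_nat card_Fp.
have qn : `|qchar (-1 : 'F_q) ^+ p./2| = 1.
  by rewrite normrX normr_qchar ?expr1n // oppr_eq0 oner_eq0.
move/(qchar_eq_of_cast F_odd) => <-.
- by rewrite mulrA -exprMn -qcharM // mulrNN mulr1 qchar1 expr1n mul1r.
- by rewrite normrM qn mul1r normr_qchar_le1.
- exact: normr_qchar_le1.
Qed.

(** * Stepanov's method *)

Lemma size_sub_leq (R : nzRingType) (a b : {poly R}) n :
  (size a <= n)%N -> (size b <= n)%N -> (size (a - b)%R <= n)%N.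
Proof.
move=> an bn; apply: (leq_trans (size_polyD _ _)).
by rewrite size_polyN geq_max an.
Qed.

Lemma size_add_leq (R : nzRingType) (a b : {poly R}) n :
  (size a <= n)%N -> (size b <= n)%N -> (size (a + b)%R <= n)%N.
Proof. by move=> an bn; rewrite (leq_trans (size_polyD _ _)) // geq_max an. Qed.

Lemma size_mul_leqD (R : nzRingType) (a b : {poly R}) m n :
  (size a <= m.+1)%N -> (size b <= n)%N -> (size (a * b)%R <= m + n)%N.
Proof.
move=> am bn; apply: (leq_trans (size_polyMleq _ _)).
by move: am bn; lia.
Qed.

Lemma size_expD_leq (R : nzRingType) (a : {poly R}) m n :
  (size a <= m.+1)%N -> (size (a ^+ n)%R <= (m * n).+1)%N.
Proof.
move=> am; elim: n => [|n IH]; first by rewrite expr0 muln0 size_poly1.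
by rewrite exprS mulnS -addnS size_mul_leqD.
Qed.

(** Induction through the derivative: a root of order [m.+1] drops to order exactly [m] only when
    [m.+1] is nonzero in [F], whence [l <= p]. *)
Lemma root_derivn_dvdp (F : fieldType) (p : nat) (P : {poly F}) x l :
  p \in [pchar F] -> (l <= p)%N ->
  (forall k, (k < l)%N -> root P^`(k) x) -> ('X - x%:P) ^+ l %| P.
Proof.
move=> charF; elim: l P => [|l IH] P l_p rootP; first by rewrite expr0 dvd1p.
have [->|P0] := eqVneq P 0; first exact: dvdp0.
have dvd' : ('X - x%:P) ^+ l %| P^`().
  apply: IH; first exact: ltnW.
  by move=> k kl; rewrite -derivSn rootP.
have [m [Q /implyP/(_ P0) Qx PE]] := multiplicity_XsubC P x.
have [ml|lm] := leqP m l; last by rewrite PE dvdp_mull // dvdp_exp2l.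
have := rootP 0 isT; rewrite derivn0 PE rootM (negPf Qx) /=.
case: m ml PE => [|m] ml PE; first by rewrite expr0 rootC oner_eq0.
move=> _; move: dvd'.
have -> : P^`() = (Q *+ m.+1 + Q^`() * ('X - x%:P)) * ('X - x%:P) ^+ m.
  rewrite PE derivM deriv_exp derivXsubC mul1r /=.
  by rewrite [RHS]mulrDl [RHS]addrC -mulrA -exprS mulrnAl mulrnAr.
move/(dvdp_trans (dvdp_exp2l _ ml)); rewrite exprS dvdp_mul2r; last first.
  by rewrite expf_neq0 // polyXsubC_eq0.
rewrite dvdp_XsubCl rootE hornerD hornerM hornerXsubC subrr mulr0 addr0.
rewrite hornerMn -mulr_natl mulf_eq0 -[Q.[x] == 0]rootE (negPf Qx) orbF.
rewrite -(dvdn_pcharf charF) => /dvdn_leq; lia.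
Qed.

Lemma prod_XsubC_exp_dvdp (F : fieldType) (R : {poly F}) (s : seq F) l :
  uniq s -> (forall x, x \in s -> ('X - x%:P) ^+ l %| R) ->
  (\prod_(x <- s) ('X - x%:P)) ^+ l %| R.
Proof.
elim: s => [|a s IH] /=; first by rewrite big_nil expr1n dvd1p.
move=> /andP[a_s s_uniq] dvdR; rewrite big_cons exprMn Gauss_dvdp.
  by rewrite dvdR ?inE ?eqxx // IH // => x xs; rewrite dvdR // inE xs orbT.
rewrite coprimep_expl // coprimep_expr // coprimep_sym coprimep_XsubC.
by rewrite root_prod_XsubC.
Qed.

Section Stepanov.
Variables (p : nat) (f : {poly 'F_p}).
Hypotheses (p_pr : prime p) (p_odd : odd p) (f_size : (size f <= 5)%N).
Let F := 'F_p.
Let h := p./2.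
Let charF : p \in [pchar F]. Proof. exact: pchar_Fp. Qed.
Let pE : p = h.*2.+1. Proof. by rewrite -[LHS]odd_double_half p_odd. Qed.

(* The [k]-th derivative of [f ^+ n * v * w ^+ p] is
   [f ^+ (n - k) * deriv_cofactor n k v * w ^+ p]. *)
Fixpoint deriv_cofactor n k (v : {poly F}) : {poly F} :=
  if k is k'.+1 then
    let w := deriv_cofactor n k' v in f^`() * w *+ (n - k') + f * w^`()
  else v.

Lemma deriv_cofactorP n k v w : (k <= n)%N -> w^`() = 0 ->
  (f ^+ n * v * w)^`(k) = f ^+ (n - k) * deriv_cofactor n k v * w.
Proof.
move=> + w0; elim: k => [|k IH] kn; first by rewrite subn0.
rewrite derivnS IH; last exact: ltnW.
rewrite derivM w0 mulr0 addr0 derivM deriv_exp /=; congr (_ * _).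
rewrite -(subnSK kn) /= exprS; set u := deriv_cofactor _ _ _; set e := f ^+ _.
rewrite mulrDr mulrnAl mulrnAr; congr (_ *+ _ + _); ring.
Qed.

Lemma deriv_cofactorB n k v w :
  deriv_cofactor n k (v - w) = deriv_cofactor n k v - deriv_cofactor n k w.
Proof.
elim: k => //= k ->; rewrite derivB !mulrBr mulrnBl opprD !addrA; congr (_ - _).
by rewrite -!addrA; congr (_ + _); rewrite addrC.
Qed.

Lemma size_deriv_cofactor n k (v : {poly F}) m : (size v <= m)%N ->
  (size (deriv_cofactor n k v) <= 3 * k + m)%N.
Proof.
move=> vm; elim: k => [|k IH] //=.
set w := deriv_cofactor _ _ _ in IH *.
have f'_size : (size f^`() <= 4)%N.
  have [->|/lt_size_deriv] := eqVneq f 0; first by rewrite deriv0 size_poly0.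
  by move: f_size; lia.
apply: size_add_leq.
  rewrite -mulr_natl -polyC_natr mul_polyC (leq_trans (size_scale_leq _ _)) //.
  rewrite (leq_trans (size_mul_leqD f'_size IH)) //; lia.
have [->|w0] := eqVneq w 0; first by rewrite deriv0 mulr0 size_poly0.
have w'_size : (size w^`() <= (3 * k + m).-1)%N.
  by rewrite -ltnS (leq_trans (lt_size_deriv w0)) // (leq_trans IH) // leqSpred.
have w_gt0 : (0 < size w)%N by rewrite size_poly_gt0.
rewrite (leq_trans (size_mul_leqD f_size w'_size)) //; lia.
Qed.

Section Nonvanishing.
Variables (x0 : F).
Hypotheses (f0 : f`_0 != 0) (fx0 : root f x0) (f'x0 : ~~ root f^`() x0).

Lemma simple_root_neq0 : f != 0.
Proof. by apply: contraNneq f'x0 => ->; rewrite deriv0 root0. Qed.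

Lemma mup_simple_root : mup x0 f = 1%N.
Proof.
have := mup_geq x0 1 simple_root_neq0; rewrite expr1 dvdp_XsubCl fx0.
have := mup_geq x0 2 simple_root_neq0.
have -> : ('X - x0%:P) ^+ 2 %| f = false.
  apply: contraNF f'x0 => /dvdpP[g ->].
  have -> : g * ('X - x0%:P) ^+ 2 = g * ('X - x0%:P) * ('X - x0%:P).
    by rewrite expr2 mulrA.
  by rewrite derivM derivXsubC mulr1 rootE hornerD !hornerM !hornerXsubC subrr !mulr0 addr0.
by lia.
Qed.

(** If neither vanished, the multiplicity of the simple root [x0] would be odd on the left and even
    on the right. *)
Lemma sqr_mul_neq (r s : {poly F}) (c : F) : c != 0 ->
  r ^+ 2 * f = c *: s ^+ 2 -> r = 0 /\ s = 0.
Proof.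
move=> c0 E.
have [r0|r0] := eqVneq r 0.
  split=> //; apply/eqP; move/esym/eqP: E.
  by rewrite r0 expr0n mul0r scaler_eq0 (negPf c0) expf_eq0.
have s0 : s != 0.
  apply: contra_eq_neq E => ->; rewrite expr0n scaler0 mulf_neq0 ?expf_neq0 //.
  exact: simple_root_neq0.
have := congr1 (mup x0) E.
rewrite mupM ?expf_neq0 ?simple_root_neq0 // -mul_polyC (@mupMr _ _ c%:P) ?rootC //.
rewrite !expr2 !mupM // mup_simple_root; lia.
Qed.

(** Multiplying by [(r - s * f ^+ h) * f] gives [r ^+ 2 * f - s ^+ 2 * f ^+ p]. Modulo ['X^p] the
    factor [f ^+ p] is just the constant term of [f], and after this replacement the degree is below
    [p]; so the result vanishes and [sqr_mul_neq] applies. *)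
Lemma polyXn_dvd_stepanov (r s : {poly F}) n :
  (n.*2.+4 <= p)%N -> (size r <= n)%N -> (size s <= n)%N ->
  'X^p %| r + s * f ^+ h -> r = 0 /\ s = 0.
Proof.
move=> np rn sn dvdX; apply: (sqr_mul_neq f0).
have size_r2 : (size (r ^+ 2) <= n.*2.-1)%N.
  rewrite expr2 (leq_trans (size_polyMleq _ _)) // -addnn.
  by rewrite -!subn1 leq_sub2r // leq_add.
have size_s2 : (size (s ^+ 2) <= n.*2.-1)%N.
  rewrite expr2 (leq_trans (size_polyMleq _ _)) // -addnn.
  by rewrite -!subn1 leq_sub2r // leq_add.
have dvdX2 : 'X^p %| r ^+ 2 * f - s ^+ 2 * f ^+ p.
  have -> : r ^+ 2 * f - s ^+ 2 * f ^+ p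
      = (r + s * f ^+ h) * ((r - s * f ^+ h) * f).
    have -> : f ^+ p = f ^+ h * f ^+ h * f.
      by rewrite -exprD -exprSr addnn -pE.
    ring.
  exact: dvdp_mulr.
have dvdX3 : 'X^p %| f ^+ p - (f`_0)%:P.
  have charP : p \in [pchar {poly F}] by rewrite pchar_poly.
  have -> : (f`_0)%:P = (f`_0)%:P ^+ p.
    by have := expf_card (f`_0); rewrite card_Fp // -polyC_exp => ->.
  rewrite -!(pFrobenius_autE charP) -rmorphB /= pFrobenius_autE dvdp_exp2r //.
  by rewrite -['X]subr0 -polyC0 dvdp_XsubCl rootE !hornerE -horner_coef0 subrr.
have dvdX4 : 'X^p %| r ^+ 2 * f - f`_0 *: s ^+ 2.
  have -> : r ^+ 2 * f - f`_0 *: s ^+ 2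
     = (r ^+ 2 * f - s ^+ 2 * f ^+ p) + s ^+ 2 * (f ^+ p - (f`_0)%:P).
    by rewrite -mul_polyC; ring.
  by rewrite dvdp_add // dvdp_mull.
apply/eqP; rewrite -subr_eq0; apply: contraTT dvdX4 => nz.
apply/negP => /(dvdp_leq nz); rewrite size_polyXn ltnNge.
case/negP; apply: size_sub_leq.
  rewrite mulrC (leq_trans (size_mul_leqD f_size size_r2)) //; lia.
rewrite (leq_trans (size_scale_leq _ _)) // (leq_trans size_s2) //; lia.
Qed.

(** The block [j = 0] is peeled off, the others being divisible by ['X^p]. This is what makes the
    auxiliary polynomial nonzero as soon as one coefficient is. *)
Lemma stepanov_sum_neq0 n J (r s : nat -> {poly F}) : (n.*2.+4 <= p)%N ->
  (forall j, (size (r j) <= n)%N) -> (forall j, (size (s j) <= n)%N) ->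
  \sum_(j < J) (r j + s j * f ^+ h) * 'X^(p * j) = 0 ->
  forall j, (j < J)%N -> r j = 0 /\ s j = 0.
Proof.
move=> np; elim: J r s => [//|J IH] r s rn sn.
rewrite big_ord_recl muln0 expr0 mulr1.
have -> : \sum_(j < J) (r (lift ord0 j) + s (lift ord0 j) * f ^+ h) * 'X^(p * lift ord0 j)
  = (\sum_(j < J) (r j.+1 + s j.+1 * f ^+ h) * 'X^(p * j)) * 'X^p.
  rewrite big_distrl /=; apply: eq_bigr => j _.
  by rewrite /bump /= add1n mulnS exprD -mulrA [X in _ * X]mulrC.
move=> E.
have [r0 s0] : r 0 = 0 /\ s 0 = 0.
  apply: (polyXn_dvd_stepanov np) => //.
  by move/eqP: E; rewrite addr_eq0 => /eqP->; rewrite dvdpNr dvdp_mull.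
have : \sum_(j < J) (r j.+1 + s j.+1 * f ^+ h) * 'X^(p * j) = 0.
  apply: (mulIf (_ : 'X^p != 0)); first by rewrite monic_neq0 // monicXn.
  by rewrite mul0r -[RHS]E r0 s0 mul0r !add0r.
move/(IH (fun j => r j.+1) (fun j => s j.+1)) => /(_ _ _) H [//|j] jJ.
by apply: H.
Qed.

(* The auxiliary polynomial [R] below vanishes to order [l] at every counted point although its
   degree is only about [p * e]. Its coefficients come from the pigeonhole principle: there are
   more choices of them than values of the vector of vanishing conditions. *)
Lemma stepanov_count e (a : F) : (0 < e)%N -> (4 * e ^ 2 + 5 <= p)%N ->
  (2 * e * #|[set x : F | f.[x] ^+ h == a]| <= p * e + 12 * p)%N.
Proof.
(* [n] is as large as [stepanov_sum_neq0] permits. There are [2 * J * n] coefficients against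
   [l * m] conditions, a surplus of [2 * (8 * n - 7 * e ^ 2 - 8 * e)]; it is positive because
   [n >= 2 * e ^ 2], thanks to the 8 in [J]. *)
move=> e_gt0 e_p; pose n := (p - 5)./2; pose l := (2 * e)%N.
have nE : p = (n.*2 + 5)%N by rewrite /n; move: pE e_p; lia.
pose J := (e + 8)%N; pose m := (3 * l + n + J)%N.
pose r (U : 'M[F]_(J + J, n)) (j : nat) : {poly F} :=
  if insub j is Some i then rVpoly (row (lshift J i) U) else 0.
pose s (U : 'M[F]_(J + J, n)) (j : nat) : {poly F} :=
  if insub j is Some i then rVpoly (row (rshift J i) U) else 0.
have r_size U j : (size (r U j) <= n)%N.
  by rewrite /r; case: insub => [i|]; rewrite ?size_poly0 ?size_poly.
have s_size U j : (size (s U j) <= n)%N.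
  by rewrite /s; case: insub => [i|]; rewrite ?size_poly0 ?size_poly.
have rB U V j : r (U - V) j = r U j - r V j.
  by rewrite /r; case: insub => [i|]; rewrite ?subr0 // !linearB.
have sB U V j : s (U - V) j = s U j - s V j.
  by rewrite /s; case: insub => [i|]; rewrite ?subr0 // !linearB.
(* Where [f.[x] ^+ h = a], using also [x ^+ p = x], the [k]-th derivative of the auxiliary
   polynomial is [f.[x] ^+ (l - k)] times [(Phi U k).[x]]. Asking [Phi U k] to vanish identically
   gives conditions that do not mention the points. *)
pose Phi U k : {poly F} := \sum_(j < J)
  (deriv_cofactor l k (r U j) + a *: deriv_cofactor (l + h) k (s U j)) * 'X^j.
have Phi_size U k : (k < l)%N -> (size (Phi U k) <= m)%N.
  move=> kl; apply: (leq_trans (size_sum _ _ _)); apply/bigmax_leqP => j _.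
  have c_size : (size (deriv_cofactor l k (r U j) +
      a *: deriv_cofactor (l + h) k (s U j))%R <= 3 * k + n)%N.
    apply: size_add_leq; first exact: size_deriv_cofactor.
    exact: leq_trans (size_scale_leq _ _) (size_deriv_cofactor _ _ (s_size _ _)).
  rewrite mulrC (leq_trans (size_mul_leqD (m := j) _ c_size)) ?size_polyXn //.
  by have := ltn_ord j; rewrite /m; lia.
have PhiB U V k : Phi (U - V) k = Phi U k - Phi V k.
  rewrite /Phi -sumrB; apply: eq_bigr => j _.
  rewrite rB sB !deriv_cofactorB scalerBr -mulrBl; congr (_ * _); ring.
pose psi U : 'M[F]_(l, m) := \matrix_(k < l) poly_rV (Phi U k).
have [U [V UV psiUV]] : exists U, exists2 V, U != V & psi U = psi V.
  have /injectivePn[U [V UV E]] : ~~ injectiveb psi.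
    apply/negP => /injectiveP/leq_card; rewrite !card_mx card_Fp // leqNgt.
    rewrite ltn_exp2l ?prime_gt1 // /m /l /J.
    by move: e_p e_gt0; rewrite [in X in X -> _]nE; nia.
  by exists U; exists V.
pose W := U - V.
have W0 : W != 0 by rewrite subr_eq0.
have PhiW k : (k < l)%N -> Phi W k = 0.
  move=> kl; rewrite PhiB; apply/eqP; rewrite subr_eq0; apply/eqP.
  have := congr1 (fun M => rVpoly (row (Ordinal kl) M)) psiUV.
  by rewrite !rowK !poly_rV_K ?Phi_size.
pose R : {poly F} := \sum_(j < J) (f ^+ l * r W j + f ^+ (l + h) * s W j) * 'X^(p * j).
have R0 : R != 0.
  apply: contraNneq W0 => RE.
  have E : \sum_(j < J) (r W j + s W j * f ^+ h) * 'X^(p * j) = 0.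
    apply: (mulfI (_ : f ^+ l != 0)); first by rewrite expf_neq0 // simple_root_neq0.
    rewrite mulr0 -[RHS]RE big_distrr /=; apply: eq_bigr => j _.
    by rewrite exprD; ring.
  have np : (n.*2.+4 <= p)%N by move: nE; lia.
  have {}E := stepanov_sum_neq0 np (r_size W) (s_size W) E.
  apply/eqP/row_matrixP => i; rewrite row0.
  have zeroW (v : 'rV[F]_n) : rVpoly v = 0 -> v = 0.
    by move=> v0; rewrite -[v]rVpolyK v0 linear0.
  case: (splitP i) => j ij; have [rj sj] := E j (ltn_ord j); apply: zeroW.
  - move: rj; rewrite /r valK => <-; congr (rVpoly (row _ _)); exact: val_inj.
  - move: sj; rewrite /s valK => <-; congr (rVpoly (row _ _)); exact: val_inj.
pose A := [set x : F | f.[x] ^+ h == a].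
have R_size : (size R <= 4 * (l + h) + (n + p * (J - 1)))%N.
  apply: (leq_trans (size_sum _ _ _)); apply/bigmax_leqP => j _.
  have T_size : (size (f ^+ l * r W j + f ^+ (l + h) * s W j)%R
      <= 4 * (l + h) + n)%N.
    apply: size_add_leq; last by rewrite size_mul_leqD // size_expD_leq.
    rewrite (leq_trans (size_mul_leqD (size_expD_leq l f_size) (r_size W j))) //.
    by rewrite leq_add2r leq_mul2l leq_addr.
  rewrite mulrC (leq_trans (size_mul_leqD (m := p * j) _ T_size)) ?size_polyXn //.
  rewrite addnC -addnA !leq_add2l leq_mul2l; apply/orP; right.
  by have := ltn_ord j; rewrite /J; clear; lia.
have e8 : (8 * e <= p)%N by move: e_p; nia.
have R_dvd : (\prod_(x <- enum A) ('X - x%:P)) ^+ l %| R.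
  apply: prod_XsubC_exp_dvdp; first exact: enum_uniq.
  move=> x; rewrite mem_enum inE => /eqP fxa.
  apply: (root_derivn_dvdp charF); first by rewrite /l; move: e8; lia.
  move=> k kl; rewrite /R linear_sum /= rootE horner_sum.
  have -> : \sum_(j < J) ((f ^+ l * r W j + f ^+ (l + h) * s W j) * 'X^(p * j))^`(k).[x]
     = f.[x] ^+ (l - k) * (Phi W k).[x].
    rewrite /Phi horner_sum big_distrr /=; apply: eq_bigr => j _.
    have Xj : ('X^(p * j) : {poly F})^`() = 0.
      by rewrite derivXn -mulr_natl natrM pcharf0 ?mul0r // pchar_poly.
    have kl' : (k <= l)%N := ltnW kl.
    rewrite mulrDl linearD /= !deriv_cofactorP ?(leq_trans kl') ?leq_addr //.
    rewrite -addnBAC; last exact: ltnW.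
    rewrite !(hornerD, hornerM, hornerZ, horner_exp, hornerX) exprD fxa.
    have -> : x ^+ (p * j) = x ^+ j.
      by rewrite exprM; have := expf_card x; rewrite card_Fp // => ->.
    ring.
  by rewrite PhiW // horner0 mulr0.
(* Degrees: [4 * h] is about [2 * p], [n] about [p / 2], [p * (J - 1)] is [p * e + 7 * p], and
   [4 * l = 8 * e] is at most [p]; together below [p * e + 12 * p]. *)
have := dvdp_leq R0 R_dvd; have := size_exp (\prod_(x <- enum A) ('X - x%:P)) l.
rewrite size_prod_XsubC -cardE /=; move: (size _) (size R) R_size => u v.
have -> : (J - 1 = e + 7)%N by rewrite /J -addnBA.
move: e8.
rewrite -/A mulnDr /l; move: #|A| pE nE => N; clear; lia.
Qed.
End Nonvanishing.
End Stepanov.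

(** [stepanov_count] bounds both value classes from above. As these and at most four roots exhaust
    ['F_p], an upper bound for one class is a lower bound for the other. *)
Lemma sum_qchar_poly_le (p : nat) (f : {poly 'F_p}) (x0 : 'F_p) e :
  prime p -> odd p -> (size f <= 5)%N -> f`_0 != 0 ->
  root f x0 -> ~~ root f^`() x0 -> (0 < e)%N -> (4 * e ^ 2 + 5 <= p)%N ->
  e%:Z * `|\sum_(x : 'F_p) qchar f.[x]| <= 13 * p%:Z.
Proof.
move=> p_pr p_odd f_size f0 fx0 f'x0 e_gt0 e_p.
have F_odd : odd #|'F_p| by rewrite card_Fp.
have count a := stepanov_count p_pr p_odd f_size f0 fx0 f'x0 a e_gt0 e_p.
have := count 1; have {count} := count (-1).
set Am := [set x | _ == -1]; set Ap := [set x | _ == 1] => Am_le Ap_le.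
pose A0 := [set x : 'F_p | f.[x] == 0].
have n10 : (1 : 'F_p) != 0 := oner_neq0 _.
have n01 : (-1 : 'F_p) != 0 by rewrite oppr_eq0.
have n1m := oner_neqN1 F_odd.
have val x : qchar f.[x] = (x \in Ap)%:Z - (x \in Am)%:Z /\
             1 = ((x \in Ap) + (x \in Am) + (x \in A0))%N.
  have := qchar_euler F_odd f.[x]; rewrite card_Fp // !inE => <-.
  have := qchar_eq0 f.[x].
  have : [\/ qchar f.[x] = 0, qchar f.[x] = 1 | qchar f.[x] = -1].
    by rewrite /qchar; case: eqP => _; [apply: Or31|case: ifP => _; [apply: Or32|apply: Or33]].
  case=> -> <-.
  - by rewrite mulr0z eqxx ![0 == (_ : 'F_p)]eq_sym (negPf n10) (negPf n01).
  - by rewrite mulr1z eqxx (negPf n1m).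
  - by rewrite rmorphN1 eqxx eq_sym (negPf n1m).
have sumE : \sum_(x : 'F_p) qchar f.[x] = #|Ap|%:Z - #|Am|%:Z.
  have cardZ (A : {set 'F_p}) : \sum_x (x \in A)%:Z = #|A|%:Z.
    by rewrite -[RHS]natz -sumr_const [RHS]big_mkcond; apply: eq_bigr => x _; case: ifP.
  by rewrite (eq_bigr _ (fun x _ => (val x).1)) sumrB !cardZ.
have p_split : p = (#|Ap| + #|Am| + #|A0|)%N.
  have cardN (A : {set 'F_p}) : (\sum_x (x \in A) = #|A|)%N.
    by rewrite -sum1_card [RHS]big_mkcond; apply: eq_bigr => x _; case: ifP.
  transitivity (\sum_(x : 'F_p) 1)%N; first by rewrite sum1_card card_Fp.
  rewrite (eq_bigr _ (fun x _ => (val x).2)).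
  by rewrite !big_split /= !cardN.
have A0_le : (#|A0| <= 4)%N.
  have f_n0 : f != 0 by apply: contraNneq f0 => ->; rewrite coef0.
  have : (size (enum A0) < size f)%N.
    apply: max_poly_roots => //; last exact: enum_uniq.
    by apply/allP => x; rewrite mem_enum inE.
  by rewrite -cardE; lia.
rewrite sumE; move: p_split A0_le Ap_le Am_le e_p => + + + + + {val}.
move: #|Ap| #|Am| #|A0| => a b c pE c4 ap am ep.
have e4 : (4 * e <= p)%N by nia.
have : (e * a <= e * b + 13 * p)%N by nia.
have : (e * b <= e * a + 13 * p)%N by nia.
by move: (leP a b); nia.
Qed.

(** Stepanov's method gives at most [52 * p ^ (1/2)], and for large [p] the spare [p ^ (1/4)]
    absorbs 52. The shift [b i0], distinct from all others, provides the simple root. *)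
Lemma sum_qchar_quartic_le : exists p0 : nat,
  forall p, prime p -> odd p -> (p0 <= p)%N ->
  forall (b : 'I_4 -> 'F_p) i0, (forall i, i != i0 -> b i != b i0) ->
  `|\sum_(x : 'F_p) qchar (\prod_i (x + b i))| ^+ 4 <= p%:Z ^+ 3.
Proof.
(* With [e] at least [p ^ (1/2) / 4], the final inequality amounts to [e >= 4 * 13 ^ 2 = 676]. *)
have [c0 c0E] : exists c0, c0 = 700%N by exists 700%N.
exists (16 * c0 ^ 2)%N => p p_pr p_odd p_large b i0 b_i0.
(* A translation makes the constant coefficient nonzero; it has to avoid at most four values. *)
have [c cb] : exists c, forall i, b i + c != 0.
  case: (pickP (fun c => [forall i, b i + c != 0])) => [c /forallP|nc]; first by exists c.
  have : (#|'F_p| <= #|'I_4|)%N.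
    apply: leq_trans (leq_image_card (fun i => - b i) 'I_4).
    apply/subset_leq_card/subsetP => c _.
    have /negbT/forallPn[i] := nc c; rewrite negbK addr_eq0 => /eqP bi.
    by apply/imageP; exists i => //; rewrite bi opprK.
  by rewrite card_Fp // card_ord; move: p_large; rewrite c0E; nia.
have -> : \sum_x qchar (\prod_i (x + b i)) = \sum_x qchar (\prod_i (x + (b i + c))).
  rewrite (reindex (fun x => x + c)) /=; last first.
    by exists (fun x => x - c) => x _; rewrite ?addrK ?subrK.
  by apply: eq_bigr => x _; congr qchar; apply: eq_bigr => i _; rewrite addrA addrAC.
pose f : {poly 'F_p} := \prod_(i < 4) ('X - (- (b i + c))%:P).
have fE x : f.[x] = \prod_i (x + (b i + c)).
  by rewrite horner_prod; apply: eq_bigr => i _; rewrite hornerXsubC opprK.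
have [e e_lo e_hi] : exists2 e, (4 * e ^ 2 + 5 <= p)%N & (p <= 16 * e ^ 2)%N.
  have p21 : (21 <= p)%N by move: p_large; rewrite c0E; nia.
  have ex_e : exists e, (4 * e ^ 2 + 5 <= p)%N by exists 0%N; move: p21; lia.
  have bd_e e : (4 * e ^ 2 + 5 <= p)%N -> (e <= p)%N by nia.
  have [e e_lo e_max] := ex_maxnP ex_e bd_e.
  exists e => //; have := e_max e.+1; nia.
have e_700 : (700 <= e)%N by move: e_hi p_large; rewrite c0E; nia.
have : e%:Z * `|\sum_(x : 'F_p) qchar f.[x]| <= 13 * p%:Z.
  apply: (@sum_qchar_poly_le _ _ (- (b i0 + c))) => //; last by lia.
  - by rewrite size_prod_XsubC /index_enum unlock -enumT size_enum_ord.
  - rewrite -horner_coef0 fE; apply/prodf_neq0 => i _; by rewrite add0r.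
  - by rewrite rootE fE (bigD1 i0) //= addNr mul0r.
  - rewrite /f (bigD1 i0) //= derivM derivXsubC mul1r rootE hornerD hornerM.
    rewrite hornerXsubC subrr mul0r addr0 horner_prod; apply/prodf_neq0 => i ii0.
    by rewrite hornerXsubC opprK opprD addrACA addNr addr0 addrC subr_eq0 b_i0.
under eq_bigr do rewrite fE.
move: (normr_ge0 (\sum_x qchar (\prod_i (x + (b i + c))))).
move: (`|_|) => S S0 eS; have e0 : 0 < e%:Z by lia.
have e4 : 0 < e%:Z ^+ 4 by rewrite exprn_gt0.
rewrite -(ler_pM2l e4) -exprMn.
apply: (@le_trans _ _ ((13 * p%:Z) ^+ 4)).
  by rewrite lerXn2r // nnegrE mulr_ge0 // ltW.
have -> : (13 * p%:Z) ^+ 4 = 169 ^+ 2 * p%:Z * p%:Z ^+ 3 by ring.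
rewrite ler_wpM2r ?exprn_ge0 //.
apply: (@le_trans _ _ (169 ^+ 2 * (4 * e%:Z) ^+ 2)).
  by rewrite ler_wpM2l ?exprn_ge0 // -PoszM -rmorphXn /= lez_nat; move: e_hi; nia.
have -> : e%:Z ^+ 4 = (e%:Z * e%:Z) ^+ 2 by ring.
rewrite -exprMn; apply: lerXn2r; rewrite ?nnegrE ?mulr_ge0 ?ltW //.
by clear -e_700; nia.
Qed.

(** * Complete sums and fourth moments *)

Section CompleteSums.

Definition odd_primes_seq (s : seq nat) :=
  uniq s && all (fun l => prime l && odd l) s.

(** The Jacobi symbol for the squarefree odd modulus with prime list [s]. *)
Definition chi (s : seq nat) (m : nat) : int := \prod_(l <- s) legendre l m.

Lemma legendreM l m n : prime l -> odd l ->
  legendre l (m * n) = legendre l m * legendre l n.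
Proof. by move=> l_pr l_odd; rewrite /legendre natrM qcharM // card_Fp. Qed.

Lemma legendre_mod l m n : prime l -> m = n %[mod l] -> legendre l m = legendre l n.
Proof.
by move=> l_pr mn; rewrite /legendre -Fp_nat_mod // mn Fp_nat_mod.
Qed.

Lemma normr_legendre_le1 l m : `|legendre l m| <= 1.
Proof. exact: normr_qchar_le1. Qed.

Section Chi.
Variable s : seq nat.
Hypothesis s_ok : odd_primes_seq s.
Let q := (\prod_(l <- s) l)%N.

Lemma odd_primes_seqP l : l \in s -> prime l /\ odd l.
Proof. by move=> ls; have /andP[_ /allP/(_ l ls)/andP[]] := s_ok. Qed.

Lemma chiM m n : chi s (m * n) = chi s m * chi s n.
Proof.
rewrite /chi -big_split /=; apply: eq_big_seq => l /odd_primes_seqP[? ?].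
exact: legendreM.
Qed.

Lemma chi_mod m n : m = n %[mod q] -> chi s m = chi s n.
Proof.
move=> mn; apply: eq_big_seq => l ls; have [l_pr _] := odd_primes_seqP ls.
apply: legendre_mod => //.
have lq : (l %| q)%N by rewrite /q (big_rem l) //= dvdn_mulr.
by rewrite -(modn_dvdm m lq) mn modn_dvdm.
Qed.

Lemma normr_chi_le1 m : `|chi s m| <= 1.
Proof.
rewrite /chi normr_prod; apply: prodr_ile1 => l _.
by rewrite normr_ge0 normr_legendre_le1.
Qed.
End Chi.

Lemma crt_sum (a b : nat) (F G : nat -> int) : coprime a b ->
  (0 < a)%N -> (0 < b)%N ->
  (forall x, F (x %% a)%N = F x) -> (forall x, G (x %% b)%N = G x) ->
  \sum_(x < a * b) F x * G x = (\sum_(x < a) F x) * (\sum_(x < b) G x).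
Proof.
move=> co_ab a_gt0 b_gt0 Fa Gb; rewrite big_distrlr /= pair_big /=.
pose h (x : 'I_(a * b)) : 'I_a * 'I_b :=
  (Ordinal (ltn_pmod x a_gt0), Ordinal (ltn_pmod x b_gt0)).
have h_inj : injective h.
  move=> x y [/eqP xa /eqP xb]; apply/val_inj/eqP.
  rewrite -[val x](modn_small (ltn_ord x)) -[val y](modn_small (ltn_ord y)).
  by rewrite chinese_remainder // xa xb.
rewrite [RHS](reindex h) /=; last first.
  by apply/onW_bij/inj_card_bij; rewrite // card_prod !card_ord.
by apply: eq_bigr => x _; rewrite Fa Gb.
Qed.

Lemma coprime_prod_primes (s : seq nat) (P : pred nat) l : prime l ->
  l \notin s -> (forall l', l' \in s -> prime l') ->
  coprime l (\prod_(l' <- s | P l') l').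
Proof.
move=> l_pr l_s s_pr; rewrite coprime_sym big_seq_cond.
elim/big_rec: _ => [|l' m /andP[l's _] co]; first by rewrite coprime1n.
have l'_pr := s_pr _ l's.
by rewrite coprimeMl co andbT prime_coprime // dvdn_prime2 //; apply: contraNneq l_s => <-.
Qed.

Lemma crt_sum_seq (s : seq nat) (F : nat -> nat -> int) : odd_primes_seq s ->
  (forall l x, l \in s -> F l (x %% l)%N = F l x) ->
  \sum_(x < \prod_(l <- s) l) \prod_(l <- s) F l x
    = \prod_(l <- s) \sum_(x < l) F l x.
Proof.
elim: s => [|l s IH] s_ok Fper.
  by rewrite !big_nil big_ord_recl big_ord0 addr0 big_nil.
have s_ok' : odd_primes_seq s by move: s_ok => /andP[/andP[_ us] /andP[_ als]]; apply/andP.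
have Fper' l' x : l' \in s -> F l' (x %% l')%N = F l' x.
  by move=> l's; rewrite Fper // inE l's orbT.
have [l_pr _] := odd_primes_seqP s_ok (mem_head l s).
have l_s : l \notin s by move: s_ok => /andP[/andP[]].
have co_l : coprime l (\prod_(l' <- s) l').
  by apply: coprime_prod_primes => // l' /(odd_primes_seqP s_ok')[].
have prod_gt0 : (0 < \prod_(l' <- s) l')%N.
  rewrite big_seq_cond prodn_cond_gt0 // => l' /andP[l's _].
  by have [/prime_gt0] := odd_primes_seqP s_ok' l's.
rewrite [RHS]big_cons -IH // -(@crt_sum l _ (F l) (fun x => \prod_(l' <- s) F l' x)) //.
- by rewrite big_cons; apply: eq_bigr => x _; rewrite big_cons.
- exact: prime_gt0.
- by move=> x; rewrite Fper // mem_head.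
move=> x; apply: eq_big_seq => l' l's; rewrite -Fper' // modn_dvdm ?Fper' //.
by rewrite (big_rem l') //= dvdn_mulr.
Qed.

Lemma prod_primes_dvdn (s : seq nat) (P : pred nat) n : uniq s ->
  (forall l, l \in s -> prime l) ->
  (forall l, l \in s -> P l -> (l %| n)%N) -> (\prod_(l <- s | P l) l %| n)%N.
Proof.
elim: s => [|l s IH] /= => [_ _ _|/andP[l_s us] s_pr s_dvd].
  by rewrite big_nil dvd1n.
have IHs : (\prod_(l <- s | P l) l %| n)%N.
  apply: IH => // l' l's; first by rewrite s_pr // inE l's orbT.
  by apply: s_dvd; rewrite inE l's orbT.
rewrite big_cons; case: ifP => // Pl; rewrite Gauss_dvd.
  by rewrite s_dvd ?mem_head.
apply: coprime_prod_primes => //; first exact: s_pr (mem_head _ _).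
by move=> l' l's; rewrite s_pr // inE l's orbT.
Qed.

Lemma sum_ord_Fp l (F : 'F_l -> int) : prime l ->
  \sum_(x < l) F x%:R = \sum_(x : 'F_l) F x.
Proof.
move=> l_pr.
have ordE (G : nat -> int) : \sum_(x < l) G x = \sum_(x : 'F_l) G x.
  by rewrite -[in LHS](Fp_cast l_pr).
by rewrite (ordE (fun x => F x%:R)); apply: eq_bigr => x _; rewrite natr_Zp.
Qed.

Lemma chi_shift_sum (s : seq nat) (b : 'I_4 -> nat) : odd_primes_seq s ->
  \sum_(x < \prod_(l <- s) l) \prod_i chi s (x + b i)
  = \prod_(l <- s) \sum_(x : 'F_l) qchar (\prod_i (x + (b i)%:R)).
Proof.
move=> s_ok.
pose F l x : int := \prod_(i < 4) legendre l (x + b i).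
transitivity (\sum_(x < \prod_(l <- s) l) \prod_(l <- s) F l x).
  by apply: eq_bigr => x _; rewrite exchange_big.
rewrite crt_sum_seq //.
  apply: eq_big_seq => l /(odd_primes_seqP s_ok)[l_pr l_odd].
  rewrite -(sum_ord_Fp (fun x => qchar (\prod_i (x + (b i)%:R)))) //.
  apply: eq_bigr => x _; rewrite qchar_prod ?card_Fp //.
  by apply: eq_bigr => i _; rewrite /legendre natrD.
move=> l x /(odd_primes_seqP s_ok)[l_pr _]; apply: eq_bigr => i _.
by apply: legendre_mod => //; rewrite modnDml.
Qed.

(** The trivial estimate at a prime [l] loses a factor [l] against [l ^ 3]. It is used only for
    primes below [p0] or dividing some [b i - b i0], and their product divides [p0! * D] with
    [D <= B ^ 3]. *)
Lemma chi_shift_sum_le : exists C : nat, forall (s : seq nat) (b : 'I_4 -> nat)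
    (i0 : 'I_4) B,
  odd_primes_seq s -> (forall i, (b i < B)%N) ->
  (forall i, i != i0 -> b i != b i0) ->
  `|\sum_(x < \prod_(l <- s) l) \prod_i chi s (x + b i)| ^+ 4
    <= (C * B ^ 3 * (\prod_(l <- s) l) ^ 3)%:Z.
Proof.
have [p0 p0P] := sum_qchar_quartic_le.
exists (p0`!) => s b i0 B s_ok bB b_i0; rewrite chi_shift_sum // normr_prod -prodrXl.
pose D := (\prod_(i | i != i0) `|b i - b i0|)%N.
have D_gt0 : (0 < D)%N.
  by rewrite prodn_cond_gt0 // => i /b_i0; rewrite lt0n distn_eq0.
have D_le : (D <= B ^ 3)%N.
  have -> : (3 = #|[pred i | i != i0]|)%N by rewrite cardC1 card_ord.
  rewrite -prod_nat_const; apply: leq_prod => i _.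
  by have := bB i; have := bB i0; lia.
pose bad l := (l < p0)%N || (l %| D)%N.
have bad_le : (\prod_(l <- s | bad l) l <= p0`! * D)%N.
  apply: dvdn_leq; first by rewrite muln_gt0 fact_gt0.
  apply: prod_primes_dvdn; first by have /andP[] := s_ok.
    by move=> l /(odd_primes_seqP s_ok)[].
  move=> l /(odd_primes_seqP s_ok)[l_pr _] /orP[lp0|lD].
    by rewrite dvdn_mulr // dvdn_fact // prime_gt0 // ltnW.
  by rewrite dvdn_mull.
have local l : l \in s ->
    `|\sum_(x : 'F_l) qchar (\prod_i (x + (b i)%:R))| ^+ 4
    <= (l ^ 3 * (if bad l then l else 1))%:Z.
  move=> /(odd_primes_seqP s_ok)[l_pr l_odd].
  have [bad_l|] := boolP (bad l).
    have -> : (l ^ 3 * l)%:Z = l%:Z ^+ 4 by rewrite -rmorphXn /= -expnSr.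
    rewrite lerXn2r ?nnegrE //.
    apply: (le_trans (ler_norm_sum _ _ _)).
    apply: (@le_trans _ _ (\sum_(x : 'F_l) 1)).
      by apply: ler_sum => x _; exact: normr_qchar_le1.
    by rewrite sumr_const card_Fp // natz.
  rewrite negb_or -leqNgt => /andP[p0l lD]; rewrite muln1.
  have -> : (l ^ 3)%:Z = l%:Z ^+ 3 by rewrite -rmorphXn.
  apply: (p0P l l_pr l_odd p0l _ i0) => i ii0.
  apply: contraNneq lD => b_eq; rewrite /D (bigD1 i) //= dvdn_mulr //.
  rewrite (dvdn_pcharf (pchar_Fp l_pr)).
  by case: (leqP (b i) (b i0)) => [le|/ltnW le]; rewrite ?(distnEl le) ?(distnEr le) natrB // b_eq subrr.
apply: (@le_trans _ _ (\prod_(l <- s) (l ^ 3 * (if bad l then l else 1))%:Z)).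
  rewrite big_seq [leRHS]big_seq; apply: ler_prod => l ls.
  by rewrite exprn_ge0 //= local.
rewrite -(big_morph Posz PoszM (erefl _)) lez_nat big_split /= -big_mkcond /=.
rewrite -(big_morph (expn^~ 3) (fun m n => expnMn m n 3) (exp1n 3)) mulnC leq_mul2r.
by rewrite (leq_trans bad_le) ?orbT // leq_mul2l D_le orbT.
Qed.

End CompleteSums.

Lemma exprn_sum_ffun (R : comNzRingType) n B (f : 'I_B -> R) :
  (\sum_b f b) ^+ n = \sum_(t : {ffun 'I_n -> 'I_B}) \prod_i f (t i).
Proof.
by rewrite -(bigA_distr_bigA (fun=> f)) prodr_const card_ord.
Qed.

Definition has_unique_value B (t : {ffun 'I_4 -> 'I_B}) :=
  [exists i0, forall i, (i != i0) ==> (t i != t i0)].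

(** If no entry is unmatched, the four entries form two equal pairs, in one of three ways, with two
    free values each. *)
Lemma card_no_unique_value B :
  (#|[set t : {ffun 'I_4 -> 'I_B} | ~~ has_unique_value t]| <= 3 * B ^ 2)%N.
Proof.
pose o k (k4 : (k < 4)%N) : 'I_4 := Ordinal k4.
pose i0 := o 0 isT; pose i1 := o 1 isT; pose i2 := o 2 isT; pose i3 := o 3 isT.
pose pair j k l := [set t : {ffun 'I_4 -> 'I_B} | (t i0 == t j) && (t k == t l)].
have cases (P : 'I_4 -> Prop) : P i0 -> P i1 -> P i2 -> P i3 -> forall i, P i.
  move=> ? ? ? ? [[|[|[|[|//]]]] i4]; rewrite (bool_irrelevance i4 isT) //.
have card_pair j k l : (forall i, i \in [:: i0; j; k; l]) -> (#|pair j k l| <= B ^ 2)%N.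
  move=> all_i; pose g (t : {ffun 'I_4 -> 'I_B}) := (t i0, t k).
  have g_inj : {in pair j k l &, injective g}.
    move=> t t'; rewrite !inE => /andP[/eqP t0j /eqP tkl] /andP[/eqP t0j' /eqP tkl'] [e0 ek].
    apply/ffunP => i; move: (all_i i); rewrite !inE => /or4P[] /eqP->;
      rewrite -?t0j -?t0j' -?tkl -?tkl'; by [exact: e0|exact: ek].
  rewrite -(card_in_imset g_inj) (leq_trans (max_card _)) // card_prod card_ord.
  by rewrite expnS expn1.
have sub : [set t : {ffun 'I_4 -> 'I_B} | ~~ has_unique_value t] \subset
    pair i1 i2 i3 :|: (pair i2 i1 i3 :|: pair i3 i1 i2).
  apply/subsetP => t; rewrite !inE negb_exists => /forallP nu.
  have {}nu k : exists2 i, i != k & t i = t k.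
    have := nu k; rewrite negb_forall => /existsP[i]; rewrite negb_imply negbK.
    by move=> /andP[ik /eqP tik]; exists i.
  have e0 : [\/ t i1 = t i0, t i2 = t i0 | t i3 = t i0].
    have [a] := nu i0; move: a; apply: cases => // _ tk;
      by first [exact: Or31|exact: Or32|exact: Or33].
  have e1 : [\/ t i0 = t i1, t i2 = t i1 | t i3 = t i1].
    have [a] := nu i1; move: a; apply: cases => // _ tk;
      by first [exact: Or31|exact: Or32|exact: Or33].
  have e2 : [\/ t i0 = t i2, t i1 = t i2 | t i3 = t i2].
    have [a] := nu i2; move: a; apply: cases => // _ tk;
      by first [exact: Or31|exact: Or32|exact: Or33].
  have e3 : [\/ t i0 = t i3, t i1 = t i3 | t i2 = t i3].
    have [a] := nu i3; move: a; apply: cases => // _ tk;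
      by first [exact: Or31|exact: Or32|exact: Or33].
  move: (t i0) (t i1) (t i2) (t i3) e0 e1 e2 e3 => a b c d e0 e1 e2 e3.
  have pairP (x y z w : 'I_B) : x = y -> z = w -> (x == y) && (z == w).
    by move=> -> ->; rewrite !eqxx.
  case: e0 => e0; case: e1 => e1; case: e2 => e2; case: e3 => e3; apply/orP;
    first [ by left; apply: pairP; congruence
          | right; apply/orP; first [ by left; apply: pairP; congruence
                                    | by right; apply: pairP; congruence ] ].
rewrite (leq_trans (subset_leq_card sub)) // (leq_trans (leq_card_setU _ _).1) //.
rewrite mulSn leq_add ?card_pair //; first by apply: cases; rewrite !inE eqxx ?orbT.
rewrite (leq_trans (leq_card_setU _ _).1) // mul2n -addnn leq_add ?card_pair //;
  by apply: cases; rewrite !inE eqxx ?orbT.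
Qed.

(** Up to a constant, a tuple with a unique value contributes [B ^ (3/4) * q ^ (3/4)], which is at
    most [q / B ^ 2] exactly when [B ^ 11 <= q]. The other [O(B ^ 2)] tuples contribute at most [q]
    each. *)
Lemma chi_fourth_moment : exists C : nat, forall s B,
  odd_primes_seq s -> (B ^ 11 <= \prod_(l <- s) l)%N ->
  \sum_(x < \prod_(l <- s) l) (\sum_(b < B) chi s (x + b)) ^+ 4
    <= (C * (\prod_(l <- s) l) * B ^ 2)%:Z.
Proof.
have [C CP] := chi_shift_sum_le; exists (C + 4)%N => s B s_ok.
set q := (\prod_(l <- s) l)%N => Bq.
have [->|B_gt0] := posnP B.
  by rewrite big1 ?muln0 // => x _; rewrite big_ord0 expr0n.
pose W (t : {ffun 'I_4 -> 'I_B}) := \sum_(x < q) \prod_i chi s (x + t i).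
have -> : \sum_(x < q) (\sum_(b < B) chi s (x + b)) ^+ 4 = \sum_t W t.
  rewrite [RHS]exchange_big /=; apply: eq_bigr => x _.
  exact: (exprn_sum_ffun 4 (fun b : 'I_B => chi s (x + b))).
have W_triv t : W t <= q%:Z.
  apply: (@le_trans _ _ (\sum_(x < q) 1)); last by rewrite sumr_const card_ord natz.
  apply: ler_sum => x _; rewrite (le_trans (ler_norm _)) // normr_prod prodr_ile1 // => i _.
  by rewrite normr_ge0 normr_chi_le1.
have W_good t : has_unique_value t -> W t * (B ^ 2)%:Z <= ((C + 1) * q)%:Z.
  move=> /existsP[i0 /forallP t_i0].
  have := CP s (fun i => val (t i)) i0 B s_ok (fun i => ltn_ord _).
  rewrite -/(W t) -/q => /(_ _) W4.
  apply: (le_trans (ler_norm _)); rewrite normrM (ger0_norm (_ : 0 <= (B ^ 2)%:Z)) //.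
  rewrite -(@ler_pXn2r _ 4) ?nnegrE ?mulr_ge0 // exprMn.
  apply: (@le_trans _ _ ((C * B ^ 3 * q ^ 3)%:Z * (B ^ 2)%:Z ^+ 4)).
    rewrite ler_wpM2r ?exprn_ge0 // W4 // => i ii0.
    by have := t_i0 i; rewrite ii0.
  have -> : (B ^ 2)%:Z ^+ 4 = (B ^ 8)%:Z by rewrite -rmorphXn /= -[RHS]/(Posz (B ^ (2 * 4))%N) expnM.
  have -> : ((C + 1) * q)%:Z ^+ 4 = (((C + 1) * q) ^ 4)%:Z by rewrite -rmorphXn.
  rewrite -PoszM lez_nat.
  apply: (@leq_trans (C * (B ^ 11 * q ^ 3))).
    have -> : (B ^ 11 = B ^ 3 * B ^ 8)%N by rewrite -expnD.
    by move: (B ^ 3)%N (B ^ 8)%N (q ^ 3)%N => x y z; lia.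
  apply: (@leq_trans (C * q ^ 4)); first by rewrite leq_mul2l [(q ^ 4)%N]expnS leq_mul2r Bq !orbT.
  rewrite expnMn leq_mul2r; apply/orP; right.
  by rewrite (leq_trans (leq_addr 1 C)) // -{1}[(C + 1)%N]expn1 leq_pexp2l // addn1.
have B2_gt0 : 0 < (B ^ 2)%:Z by rewrite ltz_nat expn_gt0 B_gt0.
rewrite -(ler_pM2r B2_gt0) mulr_suml.
rewrite (bigID (fun t => has_unique_value t)) /=.
apply: (@le_trans _ _ (\sum_(t : {ffun 'I_4 -> 'I_B}) ((C + 1) * q)%:Z
   + \sum_(t : {ffun 'I_4 -> 'I_B} | ~~ has_unique_value t) (q * B ^ 2)%:Z)).
  apply: lerD.
    rewrite big_mkcond; apply: ler_sum => t _; case: ifP => // ut; exact: W_good.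
  by apply: ler_sum => t _; rewrite PoszM ler_pM2r.
rewrite !sumr_const card_ffun !card_ord -cardsE /=.
have := card_no_unique_value B; move: #|_| => c c_le.
rewrite -[X in X + _]mulr_natr -[X in _ + X]mulr_natr !natz -!PoszM -PoszD lez_nat.
have -> : (B ^ 4 = B ^ 2 * B ^ 2)%N by rewrite -expnD.
move: (B ^ 2)%N c_le => b c_le.
have : (q * b * c <= q * b * (3 * b))%N by rewrite leq_mul2l c_le orbT.
clear; lia.
Qed.

(** * Burgess' inequality *)

Lemma cauchy_schwarz (R : realDomainType) (I : finType) (P : pred I) (x y : I -> R) :
  (\sum_(i | P i) x i * y i) ^+ 2 <= (\sum_(i | P i) x i ^+ 2) * (\sum_(i | P i) y i ^+ 2).
Proof.
rewrite -subr_ge0 -(pmulr_rge0 _ (ltr0Sn R 1)).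
suff -> : 2 * ((\sum_(i | P i) x i ^+ 2) * (\sum_(i | P i) y i ^+ 2) - (\sum_(i | P i) x i * y i) ^+ 2)
    = \sum_(i | P i) \sum_(j | P j) (x i * y j - x j * y i) ^+ 2.
  by apply: sumr_ge0 => i _; apply: sumr_ge0 => j _; exact: sqr_ge0.
have -> : \sum_(i | P i) \sum_(j | P j) (x i * y j - x j * y i) ^+ 2
   = \sum_(i | P i) \sum_(j | P j) x i ^+ 2 * y j ^+ 2
     + \sum_(i | P i) \sum_(j | P j) y i ^+ 2 * x j ^+ 2
     - 2 * \sum_(i | P i) \sum_(j | P j) (x i * y i) * (x j * y j).
  rewrite mulr_sumr -big_split -sumrB /=; apply: eq_bigr => i _.
  rewrite mulr_sumr -big_split -sumrB /=; apply: eq_bigr => j _; ring.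
by rewrite -!big_distrlr /=; ring.
Qed.

Lemma sum_shift_le (f : nat -> int) N k : (forall m, `|f m| <= 1) ->
  `|\sum_(m < N) f (m + k)%N - \sum_(m < N) f m| <= (2 * k)%:Z.
Proof.
move=> f1; elim: k => [|k IH].
  by under eq_bigr do rewrite addn0; rewrite subrr.
have -> : \sum_(m < N) f (m + k.+1)%N = \sum_(m < N) f (m + k)%N + (f (N + k)%N - f k).
  have E1 : \sum_(m < N.+1) f (m + k)%N = f k + \sum_(m < N) f (m + k.+1)%N.
    rewrite big_ord_recl /= add0n; congr (_ + _); apply: eq_bigr => i _.
    by rewrite /bump /= add1n addnS addSn.
  have E2 : \sum_(m < N.+1) f (m + k)%N = \sum_(m < N) f (m + k)%N + f (N + k)%N.
    by rewrite big_ord_recr.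
  apply: (addrI (f k)); rewrite -E1 E2; ring.
rewrite addrAC (le_trans (ler_normD _ _)) // mulnSr PoszD lerD //.
apply: (le_trans (ler_normB _ _)); exact: (le_trans (lerD (f1 _) (f1 _))).
Qed.

(** Coprimality makes [b] divide [n2 - n1], while equal quotients put both numbers in one block of
    length [b]. *)
Lemma cross_eq a b m1 n1 m2 n2 : coprime b a -> (0 < b)%N ->
  (b * m1 + a * n2 = b * m2 + a * n1)%N -> (n1 %/ b = n2 %/ b)%N -> n1 = n2 /\ m1 = m2.
Proof.
move=> co b_gt0; wlog le12 : m1 n1 m2 n2 / (n1 <= n2)%N => [wl|].
  have [le12|/ltnW le21] := leqP n1 n2; first exact: wl.
  move=> /esym E /esym n_div; have [] := wl m2 n2 m1 n1 le21 _ n_div; last by move=> -> ->.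
  by rewrite E.
move=> E n_div.
have dvd_b : (b %| n2 - n1)%N.
  rewrite -(Gauss_dvdr _ co) mulnBr.
  have -> : (a * n2 - a * n1 = b * m2 - b * m1)%N by lia.
  by rewrite -mulnBr dvdn_mulr.
have n12 : n1 = n2.
  apply/eqP; rewrite eqn_leq le12 -subn_eq0 /=.
  have lt_b : (n2 - n1 < b)%N.
    rewrite (divn_eq n1 b) (divn_eq n2 b) n_div subnDl.
    by rewrite (leq_ltn_trans (leq_subr _ _)) // ltn_mod.
  by move: dvd_b; rewrite /dvdn modn_small.
split=> //; move: E; rewrite n12 => /addIn/eqP.
by rewrite eqn_mul2l eqn0Ngt b_gt0 => /eqP.
Qed.

Section Burgess.
Variables (s : seq nat) (M N A B : nat) (P : {set 'I_A.+1}).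
Hypothesis s_ok : odd_primes_seq s.
Let q := (\prod_(l <- s) l)%N.
Hypotheses (P_pr : forall a, a \in P -> prime a)
  (P_co : forall a : 'I_A.+1, a \in P -> coprime a q)
  (A_N : (A <= N)%N) (AN_q : (2 * (A * N) <= q)%N).

Let q_gt0 : (0 < q)%N.
Proof.
rewrite /q big_seq_cond prodn_cond_gt0 // => l /andP[ls _].
by have [/prime_gt0] := odd_primes_seqP s_ok ls.
Qed.

(** The residue of [(M + m) / a] modulo [q] for [u = (a, m)], a Bezout coefficient serving as the
    inverse of [a]. *)
Definition quotient_mod (u : 'I_A.+1 * 'I_N) : 'I_q :=
  Ordinal (ltn_pmod ((egcdn u.1 q).1 * (M + u.2)) q_gt0).

Lemma quotient_modP u : u.1 \in P -> u.1 * quotient_mod u = M + u.2 %[mod q].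
Proof.
move=> uP; rewrite /= modnMmr mulnA.
case: egcdnP => [|km kn E _ /=]; first by rewrite prime_gt0 // P_pr.
rewrite [(u.1 * km)%N]mulnC E (eqP (P_co uP)) mulnDl mul1n -mulnA [(q * _)%N]mulnC mulnA.
by rewrite -modnDm modnMl add0n modn_mod.
Qed.

Lemma card_quotient_eq_diag a : a \in P ->
  (#|[set v : 'I_N * 'I_N | quotient_mod (a, v.1) == quotient_mod (a, v.2)]| <= N)%N.
Proof.
move=> aP; set S := [set _ | _].
have lt_q (m : 'I_N) : (m < q)%N.
  have a_gt0 := prime_gt0 (P_pr aP); have a_A := ltn_ord a.
  by rewrite (leq_trans (ltn_ord m)) // (leq_trans _ AN_q) //; nia.
have inj : {in S &, injective snd}.
  move=> [m1 n1] [m2 n2]; rewrite !inE /= => /eqP E1 /eqP E2 n12; congr (_, _) => //.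
  have := quotient_modP (u := (a, m1)) aP; rewrite E1 n12 -E2 quotient_modP //=.
  move/eqP; rewrite eqn_modDl => /eqP; rewrite !modn_small; first by move/val_inj.
    exact: lt_q.
  exact: lt_q.
by rewrite -(card_in_imset inj) (leq_trans (max_card _)) // card_ord.
Qed.

(** Subtracting two solutions eliminates [M], and [2 * (A * N) <= q] lifts the congruence to an
    equality of integers. Distinct primes being coprime, [cross_eq] shows that a solution is
    determined by the block of length [a'] containing its second entry. *)
Lemma card_quotient_eq_off a a' : a \in P -> a' \in P -> a != a' ->
  (#|[set v : 'I_N * 'I_N | quotient_mod (a, v.1) == quotient_mod (a', v.2)]|
    <= N %/ a' + 1)%N.
Proof.
move=> aP a'P aa'; set S := [set _ | _].
have a'_gt0 := prime_gt0 (P_pr a'P).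
have div_lt (n : 'I_N) : (n %/ a' < N %/ a' + 1)%N.
  by rewrite addn1 ltnS leq_div2r // ltnW.
pose g (v : 'I_N * 'I_N) := Ordinal (div_lt v.2).
have cross v : v \in S -> (a' * (M + v.1) = a * (M + v.2) %[mod q])%N.
  rewrite inE => /eqP E.
  have E1 : a * quotient_mod (a, v.1) = M + v.1 %[mod q] by exact: quotient_modP.
  have E2 : a' * quotient_mod (a', v.2) = M + v.2 %[mod q] by exact: quotient_modP.
  by rewrite -modnMmr -E1 modnMmr -[in RHS]modnMmr -E2 modnMmr E mulnCA.
have inj : {in S &, injective g}.
  move=> [m1 n1] [m2 n2] /cross /= C1 /cross /= C2 /(congr1 val) /= n_div.
  have lt_N (m : 'I_N) (x : 'I_A.+1) : (x * m <= A * N.-1)%N.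
    by rewrite leq_mul // -ltnS ?ltn_ord // (leq_trans (ltn_ord m)) // leqSpred.
  have AN_lt : (2 * (A * N.-1) < q)%N.
    have N_gt0 : (0 < N)%N := leq_ltn_trans (leq0n _) (ltn_ord m1).
    have A_gt0 : (0 < A)%N by rewrite (leq_trans a'_gt0) // -ltnS ltn_ord.
    by move: AN_q; rewrite -{1}(prednK N_gt0) mulnS; move: A_gt0; clear; lia.
  have E : (a' * m1 + a * n2 = a' * m2 + a * n1)%N.
    have : (a' * m1 + a * n2 = a' * m2 + a * n1 %[mod q])%N.
      have := f_equal2 (fun x y => (x + y) %% q)%N C1 (esym C2).
      rewrite !modnDm !mulnDr addnACA [in X in _ = X -> _]addnACA.
      rewrite [(a * M + _)%N]addnC => /eqP; rewrite eqn_modDl => /eqP ->.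
      by rewrite addnC.
    rewrite !modn_small //.
      by rewrite (leq_ltn_trans _ AN_lt) // mul2n -addnn leq_add ?lt_N.
    by rewrite (leq_ltn_trans _ AN_lt) // mul2n -addnn leq_add ?lt_N.
  have co : coprime a' a.
    rewrite prime_coprime ?P_pr // dvdn_prime2 ?P_pr //.
    by apply: contraNneq aa' => /val_inj ->.
  have [] := cross_eq co a'_gt0 E n_div.
  by move=> /val_inj-> /val_inj->.
by rewrite -(card_in_imset inj) (leq_trans (max_card _)) // card_ord.
Qed.

Definition fiber_card (x : 'I_q) :=
  #|[set u : 'I_A.+1 * 'I_N | (u.1 \in P) && (quotient_mod u == x)]|.

(** For unequal [a] and [a'] the count is bounded with the larger one in the denominator: at most
    [a'] values [a] lie below [a'], and [a' * (N / a' + 1) <= 2 * N]. So no logarithm is lost; the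
    diagonal and the two orders give [1 + 2 + 2]. *)
Lemma quotient_energy :
  (\sum_x fiber_card x ^ 2 <= 5 * #|P| * N)%N.
Proof.
pose c a a' := #|[set v : 'I_N * 'I_N | quotient_mod (a, v.1) == quotient_mod (a', v.2)]|.
have cC a a' : c a a' = c a' a.
  have swap_inj : injective (fun v : 'I_N * 'I_N => (v.2, v.1)) by move=> [? ?] [? ?] [-> ->].
  rewrite [RHS]/c -(card_preimset _ swap_inj); congr #|pred_of_set _|.
  by apply/setP => v; rewrite !inE eq_sym.
have -> : (\sum_x fiber_card x ^ 2 = \sum_(a in P) \sum_(a' in P) c a a')%N.
  have fE x : (fiber_card x = \sum_(a in P) \sum_(m < N) (quotient_mod (a, m) == x))%N.
    rewrite /fiber_card -sum1dep_card pair_big_dep /= [RHS](bigID (fun u => quotient_mod u == x)) /=.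
    rewrite [X in (_ = _ + X)%N]big1 ?addn0; last by move=> [a m] /= /andP[_ /negPf->].
    by apply: eq_big => [[a m]|[a m] /= /andP[_ ->]] //=; rewrite andbT.
  under eq_bigr do rewrite fE expnS expn1 big_distrlr /=.
  rewrite exchange_big /=; apply: eq_bigr => a aP.
  rewrite exchange_big /=; apply: eq_bigr => a' a'P.
  under eq_bigr do rewrite big_distrlr /=.
  rewrite exchange_big /= /c -sum1dep_card [RHS]big_mkcond.
  rewrite -(pair_bigA _
    (fun m m' => if quotient_mod (a, m) == quotient_mod (a', m') then 1 else 0)%N) /=.
  apply: eq_bigr => m _; rewrite exchange_big /=; apply: eq_bigr => m' _.
  rewrite (bigD1 (quotient_mod (a, m))) //= eqxx mul1n big1 ?addn0.
    by rewrite eq_sym; case: eqP.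
  by move=> x /negPf; rewrite eq_sym => ->.
have c_le a a' : a \in P -> a' \in P -> (c a a' <= (a == a') * N
    + ((a < a') * (N %/ a' + 1) + (a' < a) * (N %/ a + 1)))%N.
  move=> aP a'P; have [<-|aa'] := eqVneq a a'.
    by rewrite ltnn !mul0n mul1n !addn0 card_quotient_eq_diag.
  have h1 : (c a a' <= N %/ a' + 1)%N by exact: card_quotient_eq_off.
  have h2 : (c a a' <= N %/ a + 1)%N by rewrite cC card_quotient_eq_off // eq_sym.
  rewrite mul0n add0n; case: ltngtP => [_|_|/val_inj e]; rewrite ?mul1n ?mul0n ?addn0 ?add0n //.
  by rewrite e eqxx in aa'.
have lt_sum n k : (\sum_(i < n) (i < k) <= minn n k)%N.
  elim: n => [|n IHn]; first by rewrite big_ord0.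
  rewrite big_ord_recr /=.
  by move: IHn; move: (\sum_(i < n) _)%N => x; case: (ltnP n k) => nk; lia.
have off a' : a' \in P -> (\sum_(a in P) (a < a') * (N %/ a' + 1) <= 2 * N)%N.
  move=> a'P; rewrite -big_distrl /=.
  apply: (@leq_trans (a' * (N %/ a' + 1))).
    rewrite leq_mul2r; apply/orP; right; apply: (leq_trans _ (geq_minr A.+1 a')).
    apply: leq_trans (lt_sum A.+1 a'); rewrite [leqRHS](bigID (mem P)) /= leq_addr //.
  rewrite mulnDr muln1 mulnC mul2n -addnn leq_add ?leq_trunc_div //.
  by rewrite (leq_trans _ A_N) // -ltnS ltn_ord.
apply: (@leq_trans (\sum_(a in P) \sum_(a' in P) ((a == a') * N
    + ((a < a') * (N %/ a' + 1) + (a' < a) * (N %/ a + 1))))).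
  by apply: leq_sum => a aP; apply: leq_sum => a' a'P; exact: c_le.
under eq_bigr do rewrite !big_split /=.
rewrite !big_split /=.
have -> : (5 * #|P| * N = #|P| * N + (#|P| * (2 * N) + #|P| * (2 * N)))%N by lia.
rewrite leq_add //.
  rewrite -sum_nat_const; apply: leq_sum => a aP.
  rewrite (bigD1 a) //= eqxx mul1n big1 ?addn0 // => a' /andP[_ /negPf].
  by rewrite eq_sym => ->.
rewrite -sum_nat_const leq_add //; last by apply: leq_sum => a; exact: off.
by rewrite exchange_big; apply: leq_sum => a; exact: off.
Qed.

Let S := \sum_(m < N) chi s (M + m).
Let T x := \sum_(b < B) chi s (x + b).

(** Shifting [m] by [a * b] changes the sum by at most [2 * (A * B)], and [chi s (M + m + a * b)] is
    [chi s a] times the value of [chi s] at [(M + m) / a + b]. *)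
Lemma burgess_shift :
  (#|P| * B)%:Z * (`|S| - (2 * (A * B))%:Z) <=
  \sum_(u : 'I_A.+1 * 'I_N | u.1 \in P) `|T (quotient_mod u)|.
Proof.
have shiftE : \sum_(a in P) \sum_(b < B) \sum_(m < N) chi s (M + m + a * b)
    = \sum_(u : 'I_A.+1 * 'I_N | u.1 \in P) chi s u.1 * T (quotient_mod u).
  rewrite [RHS](eq_bigl (fun u => (u.1 \in P) && true)); last by move=> u; rewrite andbT.
  rewrite -(pair_big (fun a => a \in P) xpredT
     (fun a m => chi s a * T (quotient_mod (a, m)))) /=.
  apply: eq_bigr => a aP; rewrite exchange_big /=; apply: eq_bigr => m _.
  rewrite /T big_distrr /=; apply: eq_bigr => b _.
  rewrite -chiM //; apply: (chi_mod s_ok).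
  by rewrite mulnDr -modnDml -(quotient_modP (u := (a, m)) aP) modnDml.
have close (a : 'I_A.+1) (b : 'I_B) : a \in P ->
    `|S - \sum_(m < N) chi s (M + m + a * b)| <= (2 * (A * B))%:Z.
  move=> aP; have := sum_shift_le N (a * b) (fun m => normr_chi_le1 s (M + m)).
  under eq_bigr do rewrite addnA.
  rewrite distrC => /le_trans; apply; rewrite lez_nat leq_mul2l /= leq_mul //.
    by rewrite -ltnS.
  exact: ltnW.
have sumPB (x : int) : \sum_(a in P) \sum_(b < B) x = (#|P| * B)%:Z * x.
  under eq_bigr do rewrite sumr_const card_ord.
  by rewrite sumr_const -mulrnA mulnC -mulr_natl natz.
have US : (#|P| * B)%:Z * S - \sum_(u | u.1 \in P) chi s u.1 * T (quotient_mod u)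
    = \sum_(a in P) \sum_(b < B) (S - \sum_(m < N) chi s (M + m + a * b)).
  by rewrite -shiftE -sumPB -sumrB; apply: eq_bigr => a _; rewrite -sumrB.
apply: (@le_trans _ _ `|\sum_(u | u.1 \in P) chi s u.1 * T (quotient_mod u)|); last first.
  apply: (le_trans (ler_norm_sum _ _ _)); apply: ler_sum => u _.
  by rewrite normrM ler_piMl // normr_chi_le1.
rewrite mulrBr lerBlDl -lerBlDr.
have -> : (#|P| * B)%:Z * `|S| = `|(#|P| * B)%:Z * S| by rewrite normrM.
apply: (le_trans (lerB_dist _ _)); rewrite US -sumPB.
apply: (le_trans (ler_norm_sum _ _ _)); apply: ler_sum => a aP.
apply: (le_trans (ler_norm_sum _ _ _)); apply: ler_sum => b _.
exact: close.
Qed.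

(** Cauchy-Schwarz twice: over the pairs [(a, m)], then over the residues, which separates the
    energy of [fiber_card] from the fourth moment. *)
Lemma burgess_ineq (C : nat) :
  \sum_(x < q) (\sum_(b < B) chi s (x + b)) ^+ 4 <= (C * q * B ^ 2)%:Z ->
  (0 < #|P|)%N -> (0 < B)%N -> (2 * (A * B))%:Z <= `|S| ->
  (#|P| * B ^ 2)%:Z * (`|S| - (2 * (A * B))%:Z) ^+ 4 <= (5 * C * N ^ 3 * q)%:Z.
Proof.
move=> M4 P_gt0 B_gt0 S_large; have shift := burgess_shift.
set D := `|S| - _ in shift *; have D0 : 0 <= D by rewrite subr_ge0.
set Y := \sum_(u | _) _ in shift.
have Y0 : 0 <= Y by apply: sumr_ge0.
pose Z := \sum_(x < q) (fiber_card x)%:Z * T x ^+ 2.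
have Z0 : 0 <= Z by apply: sumr_ge0 => x _; rewrite mulr_ge0 ?sqr_ge0.
have Y2 : Y ^+ 2 <= (#|P| * N)%:Z * Z.
  have -> : Y = \sum_(u | u.1 \in P) 1 * `|T (quotient_mod u)|.
    by apply: eq_bigr => u _; rewrite mul1r.
  apply: (le_trans (cauchy_schwarz _ _ _)).
  have -> : \sum_(u : 'I_A.+1 * 'I_N | u.1 \in P) 1 ^+ 2 = (#|P| * N)%:Z.
    under eq_bigr do rewrite expr1n.
    rewrite (eq_bigl (fun u => (u.1 \in P) && true)); last by move=> u; rewrite andbT.
    rewrite -(pair_big (fun a => a \in P) xpredT (fun _ _ => 1)) /=.
    under eq_bigr do rewrite sumr_const card_ord.
    by rewrite sumr_const -mulrnA mulnC natz.
  rewrite (partition_big quotient_mod xpredT) //= ler_wpM2l //; apply: ler_sum => x _.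
  rewrite (eq_bigr (fun=> T x ^+ 2)); last first.
    by move=> u /andP[_ /eqP <-]; rewrite real_normK ?num_real.
  by rewrite sumr_const -mulr_natl natz /fiber_card cardsE.
have Z2 : Z ^+ 2 <= (5 * #|P| * N)%:Z * (C * q * B ^ 2)%:Z.
  apply: (le_trans (cauchy_schwarz _ _ _)); apply: ler_pM.
  - by apply: sumr_ge0 => x _; exact: sqr_ge0.
  - by apply: sumr_ge0 => x _; exact: sqr_ge0.
  - have := quotient_energy; rewrite -lez_nat; apply: le_trans.
    rewrite (big_morph Posz PoszD (erefl _)); apply: ler_sum => x _.
    by rewrite -rmorphXn.
  - by apply: le_trans M4; apply: ler_sum => x _; rewrite -exprM.
have PB0 : 0 <= (#|P| * B)%:Z by [].
have H : ((#|P| * B)%:Z * D) ^+ 4 <= (#|P| * N)%:Z ^+ 2 * ((5 * #|P| * N)%:Z * (C * q * B ^ 2)%:Z).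
  apply: (@le_trans _ _ (Y ^+ 4)); first by rewrite lerXn2r ?nnegrE ?mulr_ge0.
  apply: (@le_trans _ _ ((#|P| * N)%:Z ^+ 2 * Z ^+ 2)); last by rewrite ler_wpM2l ?sqr_ge0.
  have -> : Y ^+ 4 = (Y ^+ 2) ^+ 2 by rewrite -exprM.
  by rewrite -exprMn lerXn2r ?nnegrE ?mulr_ge0 ?sqr_ge0.
have c0 : 0 < #|P|%:Z ^+ 3 * B%:Z ^+ 2 by rewrite mulr_gt0 ?exprn_gt0.
rewrite -(ler_pM2l c0).
have XE (n k : nat) : (n ^ k)%:Z = n%:Z ^+ k by rewrite -rmorphXn.
move: H c0; clearbody D; rewrite !(XE, PoszM); move: #|P|%:Z B%:Z N%:Z q%:Z C%:Z (Posz 5) => x b n r c f H c0.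
rewrite [leLHS](_ : _ = (x * b * D) ^+ 4); last by ring.
by rewrite [leRHS](_ : _ = (x * n) ^+ 2 * (f * x * n * (c * r * b ^+ 2))); last by ring.
Qed.
End Burgess.

(** * Many primes, after Chebyshev *)

Lemma expn2_leq_bin n : (2 ^ n <= 'C(n.*2, n))%N.
Proof.
elim: n => [|n IH] //; rewrite expnS doubleS binS mul2n -addnn.
have bin_n : ('C(n.*2, n) <= 'C(n.*2.+1, n))%N by rewrite leq_bin2l.
have := bin_sub (_ : n <= n.*2.+1)%N; rewrite -addnn -addSn addnK => /(_ (leq_addl _ _)).
rewrite addSn addnn => ->; rewrite leq_add // (leq_trans IH) //.
Qed.

(** In Legendre's formula the [k]-th term [n.*2 %/ p ^ k - 2 * (n %/ p ^ k)] is at most 1, and it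
    vanishes once [p ^ k > n.*2]. *)
Lemma logn_bin2n_pexp n p : prime p -> (0 < n)%N ->
  (p ^ logn p 'C(n.*2, n) <= n.*2)%N.
Proof.
move=> p_pr n_gt0; have n2_gt0 : (0 < n.*2)%N by rewrite double_gt0.
suff : (logn p 'C(n.*2, n) <= trunc_log p n.*2)%N.
  by move=> le; rewrite (leq_trans (leq_pexp2l (prime_gt0 p_pr) le)) // trunc_logP // prime_gt1.
have nn : (n <= n.*2)%N by rewrite -addnn leq_addl.
have := congr1 (logn p) (bin_fact nn).
rewrite !lognM ?muln_gt0 ?fact_gt0 ?bin_gt0 // !logn_fact //.
have -> : (n.*2 - n = n)%N by rewrite -addnn addnK.
have ext : (\sum_(1 <= k < n.+1) n %/ p ^ k = \sum_(1 <= k < n.*2.+1) n %/ p ^ k)%N.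
  rewrite [RHS](big_cat_nat (n := n.+1)) //=.
  rewrite [X in (_ = _ + X)%N]big_nat_cond [X in (_ = _ + X)%N]big1 ?addn0 // => k /andP[/andP[nk _] _].
  by rewrite divn_small // (leq_trans nk) // ltnW // ltn_expl // prime_gt1.
rewrite ext => E.
have bound : (\sum_(1 <= k < n.*2.+1) n.*2 %/ p ^ k <=
   \sum_(1 <= k < n.*2.+1) (n %/ p ^ k + n %/ p ^ k + (k <= trunc_log p n.*2)%N))%N.
  apply: leq_sum => k _; have pk_gt0 : (0 < p ^ k)%N by rewrite expn_gt0 prime_gt0.
  have [k_le|k_gt] := leqP k (trunc_log p n.*2).
    rewrite -ltnS -addnS ltn_divLR // {1}(divn_eq n (p ^ k)).
    by have := ltn_pmod n pk_gt0; move: (n %/ _)%N (n %% _)%N => u v; nia.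
  rewrite divn_small // ltnNge; apply: contraL k_gt; rewrite -leqNgt => le.
  exact: trunc_log_max (prime_gt1 p_pr) le.
move: E bound; rewrite !big_split /= => E.
have : (\sum_(1 <= k < n.*2.+1) (k <= trunc_log p n.*2)%N <= trunc_log p n.*2)%N.
  move: (trunc_log _ _) => L; apply: leq_trans (geq_minr n.*2 L).
  elim: (n.*2) => [|m IH]; first by rewrite big_geq.
  rewrite big_nat_recr //=.
  by move: IH; move: (\sum_(1 <= _ < _) _)%N => x; case: (leqP m.+1 L) => mL; lia.
lia.
Qed.

Lemma expn2_leq_primes n : (0 < n)%N ->
  (2 ^ n <= n.*2 ^ #|[set a : 'I_(n.*2).+1 | prime a]|)%N.
Proof.
move=> n_gt0; apply: (leq_trans (expn2_leq_bin n)).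
have bin_gt0' : (0 < 'C(n.*2, n))%N by rewrite bin_gt0 -addnn leq_addl.
rewrite {1}(prod_prime_decomp bin_gt0') prime_decompE big_map /=.
apply: (@leq_trans (\prod_(p <- primes 'C(n.*2, n)) n.*2)).
  rewrite big_seq [leqRHS]big_seq; apply: leq_prod => p; rewrite mem_primes => /and3P[p_pr _ _].
  exact: logn_bin2n_pexp.
rewrite big_const_seq count_predT iter_muln_1 leq_pexp2l ?double_gt0 //.
have sub p : p \in primes 'C(n.*2, n) -> (p < n.*2.+1)%N.
  rewrite mem_primes => /and3P[p_pr _ p_dvd]; rewrite ltnS.
  apply: leq_trans (logn_bin2n_pexp p_pr n_gt0); rewrite -{1}(expn1 p).
  by apply: leq_pexp2l; rewrite ?(prime_gt0 p_pr) // logn_gt0 mem_primes p_pr bin_gt0'.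
rewrite -(size_map (fun p => inord p : 'I_(n.*2).+1)).
have u : uniq [seq inord p : 'I_(n.*2).+1 | p <- primes 'C(n.*2, n)].
  rewrite map_inj_in_uniq ?primes_uniq // => p p' /sub lt /sub lt' /(congr1 val) /=.
  by rewrite !inordK.
rewrite -(card_uniqP u); apply/subset_leq_card/subsetP => _ /mapP[p p_in ->].
by rewrite inE inordK ?sub //; move: p_in; rewrite mem_primes => /and3P[].
Qed.

Lemma card_prime_divisors_le (n K : nat) (T : {set 'I_K}) : (0 < n)%N ->
  (forall a, a \in T -> prime a && (a %| n)%N) -> (2 ^ #|T| <= n)%N.
Proof.
move=> n_gt0 T_dvd.
have val_pr l : l \in [seq val a | a <- enum T] -> prime l && (l %| n)%N.
  by move=> /mapP[a]; rewrite mem_enum => /T_dvd + ->.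
apply: (@leq_trans (\prod_(l <- [seq val a | a <- enum T]) l)).
  rewrite big_map big_enum -prod_nat_const; apply: leq_prod => a aT.
  by have /andP[/prime_gt1] := T_dvd a aT.
apply: dvdn_leq => //; apply: prod_primes_dvdn.
- by rewrite (map_inj_uniq val_inj) enum_uniq.
- by move=> l /val_pr/andP[].
- by move=> l /val_pr/andP[].
Qed.

(** Chebyshev's bound with the logarithm of [t] crudely replaced by [t], a loss that [burgess_block]
    can afford. Since [q <= 2 ^ (120 * t)], at most [120 * t] primes divide [q], which is absorbed
    by doubling the factor [46 * t]. *)
Lemma coprime_primes_lower t q : (2 <= t)%N -> (0 < q)%N -> (q <= (2 * t) ^ 60)%N ->
  (t ^ 23 <= 92 * t * #|[set a : 'I_(t ^ 23).+1 | prime a && coprime a q]|)%N.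
Proof.
move=> t2 q_gt0 q_le; set A := (t ^ 23)%N; pose n := A./2.
have A_even : (A <= n.*2 + 1)%N by rewrite -[A in (A <= _)%N]odd_double_half addnC leq_add2l; case: odd.
have A_ge : (2 ^ 23 <= A)%N by rewrite leq_exp2r.
have n_gt0 : (0 < n)%N.
  by rewrite half_gt0 (leq_trans _ A_ge) // -{1}(expn1 2) leq_pexp2l.
pose pi_A := #|[set a : 'I_A.+1 | prime a]|.
have pi_le : (#|[set a : 'I_(n.*2).+1 | prime a]| <= pi_A)%N.
  have le : (n.*2.+1 <= A.+1)%N by rewrite ltnS -[leqRHS]odd_double_half leq_addl.
  have inj : injective (widen_ord le) by move=> a b /(congr1 val) /= /val_inj.
  rewrite -(card_imset _ inj); apply/subset_leq_card/subsetP => _ /imsetP[a + ->].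
  by rewrite !inE.
have n_le : (n <= 23 * t * pi_A)%N.
  rewrite -(leq_exp2l (m := 2)) //; apply: (leq_trans (expn2_leq_primes n_gt0)).
  apply: (@leq_trans (n.*2 ^ pi_A)); first by rewrite leq_pexp2l // double_gt0.
  have [->|pi_gt0] := posnP pi_A; first by rewrite expn0 expn_gt0.
  rewrite expnM leq_exp2r //; apply: (@leq_trans A).
    by rewrite -[leqRHS]odd_double_half leq_addl.
  by rewrite mulnC expnM /A leq_exp2r // ltnW // ltn_expl.
set P := [set a : 'I_A.+1 | prime a && coprime a q].
have pi_split : (pi_A <= #|P| + 120 * t)%N.
  pose T := [set a : 'I_A.+1 | prime a && (a %| q)%N].
  have T_le : (#|T| <= 120 * t)%N.
    rewrite -(leq_exp2l (m := 2)) //; apply: (@leq_trans q).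
      by apply: card_prime_divisors_le => // a; rewrite inE.
    apply: (leq_trans q_le).
    have -> : (120 * t = 2 * t * 60)%N by lia.
    by rewrite expnM leq_exp2r // ltnW // ltn_expl.
  apply: leq_trans (_ : #|P :|: T| <= _)%N; last first.
    by apply: (leq_trans (leq_card_setU _ _).1); rewrite leq_add2l.
  apply/subset_leq_card/subsetP => a; rewrite !inE => a_pr.
  by rewrite a_pr prime_coprime //= orNb.
have A_large : (2 * (46 * t * (120 * t) + 1) <= A)%N.
  have -> : (A = t * t * t ^ 21)%N by rewrite mulnn -expnD.
  apply: (@leq_trans (t * t * (128 * 128))); first by move: t2; clear => t2; nia.
  rewrite leq_mul2l; apply/orP; right.
  apply: (@leq_trans (t ^ 7 * t ^ 7)); last by rewrite -expnD leq_pexp2l //; lia.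
  have : (2 ^ 7 <= t ^ 7)%N by rewrite leq_exp2r.
  have -> : (2 ^ 7 = 128)%N by [].
  by move=> h; rewrite leq_mul.
have := leq_mul (leqnn (23 * t)) pi_split; move: A_even n_le A_large.
clear -t2; move: #|P| pi_A => c d; clearbody A n; lia.
Qed.

Lemma prod_odd_primes_gt0 s : odd_primes_seq s -> (0 < \prod_(l <- s) l)%N.
Proof.
move=> s_ok; rewrite big_seq_cond prodn_cond_gt0 // => l /andP[ls _].
by have [/prime_gt0] := odd_primes_seqP s_ok ls.
Qed.

(** * Short sums of real characters *)

Lemma expr4D_le (R : realDomainType) (x y : R) : (x + y) ^+ 4 <= 8 * (x ^+ 4 + y ^+ 4).
Proof.
have sq (a b : R) : (a + b) ^+ 2 <= 2 * (a ^+ 2 + b ^+ 2).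
  by rewrite -subr_ge0 (_ : _ - _ = (a - b) ^+ 2) ?sqr_ge0 //; ring.
have -> : (x + y) ^+ 4 = ((x + y) ^+ 2) ^+ 2 by rewrite -exprM.
apply: (@le_trans _ _ ((2 * (x ^+ 2 + y ^+ 2)) ^+ 2)).
  by rewrite lerXn2r ?nnegrE ?sqr_ge0 // mulr_ge0 // addr_ge0 ?sqr_ge0.
apply: (@le_trans _ _ (4 * (2 * ((x ^+ 2) ^+ 2 + (y ^+ 2) ^+ 2)))).
  rewrite exprMn (_ : 2 ^+ 2 = 4); last by ring.
  by rewrite ler_wpM2l.
by rewrite [leLHS](_ : _ = 8 * (x ^+ 4 + y ^+ 4)) //; ring.
Qed.

(* With [q] of size [t ^ 60], the sum over an interval of length [t ^ 29] is averaged over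
   the shifts [a * b], where [a <= t ^ 23] is prime and [b < t ^ 5]. *)
Lemma burgess_block : exists C : nat, forall s t M, odd_primes_seq s -> (2 <= t)%N ->
  (t ^ 60 <= \prod_(l <- s) l)%N -> (\prod_(l <- s) l <= (2 * t) ^ 60)%N ->
  `|\sum_(m < t ^ 29) chi s (M + m)| ^+ 4 <= (C * t ^ 115)%:Z.
Proof.
have [C0 M4] := chi_fourth_moment.
have [K KE] : exists K, K = (2 ^ 60)%N by eexists.
exists (8 * (460 * C0 * K) + 128)%N => s t M s_ok t2 q_ge q_le.
have q_gt0 := prod_odd_primes_gt0 s_ok.
set q := (\prod_(l <- s) l)%N in q_ge q_le q_gt0 *.
set S := \sum_(m < t ^ 29) _.
have t_gt0 : (0 < t)%N := ltnW t2.
have te_gt0 k : (0 < t ^ k)%N by rewrite expn_gt0 t_gt0.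
pose P := [set a : 'I_(t ^ 23).+1 | prime a && coprime a q].
have P_lower : (t ^ 23 <= 92 * t * #|P|)%N := coprime_primes_lower t2 q_gt0 q_le.
have XE (n k : nat) : (n ^ k)%:Z = n%:Z ^+ k by rewrite -rmorphXn.
have AB : (2 * (t ^ 23 * t ^ 5) = 2 * t ^ 28)%N by rewrite -expnD.
have [S_small|S_large] := leP `|S| (2 * (t ^ 23 * t ^ 5))%:Z.
  apply: (@le_trans _ _ ((2 * t ^ 28)%:Z ^+ 4)); first by rewrite lerXn2r ?nnegrE // -AB.
  rewrite -XE lez_nat expnMn -expnM; apply: leq_mul; last by rewrite leq_pexp2l.
  by rewrite (leq_trans _ (leq_addl _ _)).
have Burgess : (#|P| * (t ^ 5) ^ 2)%:Z * (`|S| - (2 * (t ^ 23 * t ^ 5))%:Z) ^+ 4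
    <= (5 * C0 * (t ^ 29) ^ 3 * q)%:Z.
  apply: burgess_ineq => //.
  - by move=> a; rewrite inE => /andP[].
  - by move=> a; rewrite inE => /andP[].
  - by rewrite leq_pexp2l.
  - rewrite -expnD; apply: leq_trans q_ge; rewrite (leq_trans (leq_mul t2 (leqnn _))) //.
    by rewrite -expnS leq_pexp2l.
  - by apply: M4 => //; rewrite -expnM (leq_trans _ q_ge) // leq_pexp2l.
  - by rewrite lt0n; apply: contraL (te_gt0 23%N) => /eqP P0; move: P_lower; rewrite P0 muln0 leqn0 => /eqP->.
  - exact: ltW.
move: Burgess P_lower S_large; rewrite AB; set D := `|S| - _; set p := #|P|.
move=> Burgess P_lower S_large; have D0 : 0 <= D by rewrite subr_ge0 ltW.
have T0 : 0 < t%:Z by rewrite ltz_nat.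
(* The exponent of [t] in [N ^ 3 * q / (#|P| * B ^ 2)] is [87 + 60 - 22 - 10 = 115], one less than
   the trivial [4 * 29]. *)
have D4 : D ^+ 4 <= (460 * C0 * K)%:Z * t%:Z ^+ 115.
  rewrite -(ler_pM2l (exprn_gt0 33 T0)).
  apply: (@le_trans _ _ ((92 * t)%:Z * ((p * (t ^ 5) ^ 2)%:Z * D ^+ 4))).
    have -> : t%:Z ^+ 33 * D ^+ 4 = (t ^ 23)%:Z * ((t ^ 10)%:Z * D ^+ 4).
      by rewrite mulrA !XE -exprD.
    have -> : (92 * t)%:Z * ((p * (t ^ 5) ^ 2)%:Z * D ^+ 4)
        = (92 * t * p)%:Z * ((t ^ 10)%:Z * D ^+ 4).
      by rewrite !mulrA; congr (_ * _); rewrite -!PoszM -expnM mulnA.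
    by rewrite ler_wpM2r ?mulr_ge0 ?exprn_ge0 // lez_nat.
  apply: (@le_trans _ _ ((92 * t)%:Z * (5 * C0 * (t ^ 29) ^ 3 * (K * t ^ 60))%:Z)).
    rewrite ler_wpM2l //; apply: (le_trans Burgess); rewrite lez_nat leq_mul2l.
    by rewrite KE -expnMn q_le orbT.
  rewrite -(XE t 33%N) -(XE t 115%N) -!PoszM lez_nat -expnM.
  have -> : (t ^ 115 = t ^ 54 * (t * t ^ 60))%N by rewrite -expnS -expnD.
  have -> : (t ^ (29 * 3) = t ^ 33 * t ^ 54)%N by rewrite -expnD.
  by move: (t ^ 33)%N (t ^ 54)%N (t ^ 60)%N => x y z; clear; lia.
have -> : `|S| = D + (2 * t ^ 28)%:Z by rewrite subrK.
apply: (le_trans (expr4D_le _ _)).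
have -> : ((8 * (460 * C0 * K) + 128) * t ^ 115)%:Z
    = 8 * ((460 * C0 * K)%:Z * t%:Z ^+ 115 + 16 * t%:Z ^+ 115).
  rewrite -XE PoszM PoszD PoszM; move: (460 * C0 * K)%:Z (t ^ 115)%:Z => x y.
  by rewrite (_ : Posz 128 = 128) // (_ : Posz 8 = 8) //; ring.
rewrite ler_pM2l // lerD // PoszM exprMn ler_wpM2l // -!XE lez_nat -expnM.
by rewrite leq_pexp2l.
Qed.

Lemma sum_chi_period s M : odd_primes_seq s -> s != [::] ->
  \sum_(x < \prod_(l <- s) l) chi s (M + x) = 0.
Proof.
move=> s_ok s_n0.
have [l ls] : exists l, l \in s by case: s s_n0 {s_ok} => // l s; exists l; rewrite mem_head.
have -> : \sum_(x < \prod_(l <- s) l) chi s (M + x)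
    = \prod_(l <- s) \sum_(x < l) legendre l (M + x).
  rewrite -(@crt_sum_seq s (fun l x => legendre l (M + x))) // => {ls} {}l x ls.
  have [l_pr _] := odd_primes_seqP s_ok ls.
  by apply: legendre_mod => //; rewrite modnDmr.
have [l_pr l_odd] := odd_primes_seqP s_ok ls.
rewrite (big_rem l) //= (_ : \sum_(x < l) _ = 0) ?mul0r //.
transitivity (\sum_(x : 'F_l) qchar (M%:R + x)).
  rewrite -(sum_ord_Fp (fun x => qchar (M%:R + x))) //.
  by apply: eq_bigr => x _; rewrite /legendre natrD.
rewrite -[RHS](sum_qchar (F := 'F_l)) ?card_Fp //.
rewrite [RHS](reindex (fun x => M%:R + x)) //=.
by exists (fun x => - M%:R + x) => x _; rewrite ?addKr ?addNKr.
Qed.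

Lemma sum_ord_split (f : nat -> int) L n :
  \sum_(m < L + n) f m = \sum_(m < L) f m + \sum_(m < n) f (L + m)%N.
Proof. by rewrite big_split_ord. Qed.

Lemma norm_sum_chi_le s M N : `|\sum_(m < N) chi s (M + m)| <= N%:Z.
Proof.
apply: (le_trans (ler_norm_sum _ _ _)).
apply: (@le_trans _ _ (\sum_(m < N) 1)); last by rewrite sumr_const card_ord natz.
by apply: ler_sum => m _; exact: normr_chi_le1.
Qed.

(** The remainder after cutting into blocks of length [L] is estimated trivially and gives [c * L].
    The scaling by [c] keeps everything in the integers; [c = 1], [d = 0] is the case of full
    periods. *)
Lemma sum_chi_blocks s L c d M N : (0 < L)%N ->
  (forall M, c%:Z * `|\sum_(m < L) chi s (M + m)| <= (d * L)%:Z) ->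
  c%:Z * `|\sum_(m < N) chi s (M + m)| <= (d * N + c * L)%:Z.
Proof.
move=> L_gt0 block; have [k] := ubnP N; elim: k => // k IH in M N *.
rewrite ltnS => N_k; have [N_L|L_N] := leqP N L.
  apply: (@le_trans _ _ (c%:Z * N%:Z)); first by rewrite ler_wpM2l ?norm_sum_chi_le.
  by rewrite -PoszM lez_nat (leq_trans _ (leq_addl _ _)) // leq_mul2l N_L orbT.
have -> : N = (L + (N - L))%N by rewrite subnKC // ltnW.
rewrite (sum_ord_split (fun m => chi s (M + m))).
under [X in _ + X]eq_bigr do rewrite addnA.
apply: (@le_trans _ _ (c%:Z * `|\sum_(m < L) chi s (M + m)| +
   c%:Z * `|\sum_(m < N - L) chi s (M + L + m)|)).
  by rewrite -mulrDr ler_wpM2l // ler_normD.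
rewrite mulnDr -addnA PoszD lerD // IH //.
by rewrite (leq_trans _ N_k) // ltn_subrL L_gt0 (leq_trans _ L_N).
Qed.

Lemma norm_sum_chi_le_modulus s M N : odd_primes_seq s -> s != [::] ->
  `|\sum_(m < N) chi s (M + m)| <= (\prod_(l <- s) l)%:Z.
Proof.
move=> s_ok s_n0; have := @sum_chi_blocks s (\prod_(l <- s) l) 1 0 M N.
rewrite prod_odd_primes_gt0 // mul0n mul1n add0n mul1r; apply=> //.
by move=> M'; rewrite sum_chi_period // normr0 mulr0.
Qed.

(** The exponents are linked: [(z ^ 9) ^ 4 = z ^ 36], and [36 * 60 + 9 = 2169] must not exceed 2200.
    A leftover block is harmless for moduli up to [9 * X ^ 2], since
    [z ^ 9 * t ^ 29 <= t ^ 30 <= 3 * X]. *)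
Lemma sum_chi_le : exists C : nat, forall s z X M N, odd_primes_seq s -> s != [::] ->
  (0 < z)%N -> (z ^ 2200 <= X)%N -> (\prod_(l <- s) l <= 9 * X ^ 2)%N -> (N <= 2 * X)%N ->
  (z ^ 9)%:Z * `|\sum_(m < N) chi s (M + m)| <= (C * X)%:Z.
Proof.
have [C0 block] := burgess_block.
have [K KE] : exists K, K = (2 ^ 60)%N by eexists.
exists (K + (2 * C0 + 5))%N => s z X M N s_ok s_n0 z_gt0 zX q_le N_le.
have q_gt0 := prod_odd_primes_gt0 s_ok.
have triv := norm_sum_chi_le_modulus M N s_ok s_n0.
set q := (\prod_(l <- s) l)%N in q_le q_gt0 triv.
have [t t_lo t_hi] : exists2 t, (t ^ 60 <= q)%N & (q < t.+1 ^ 60)%N.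
  have ex_t : exists t, (t ^ 60 <= q)%N by exists 0%N; rewrite exp0n.
  have bd_t t : (t ^ 60 <= q)%N -> (t <= q)%N.
    have [->//|t_gt0] := posnP t; apply: leq_trans.
    by rewrite -{1}(expn1 t) leq_pexp2l.
  have [t t_lo t_max] := ex_maxnP ex_t bd_t; exists t => //.
  by rewrite ltnNge; apply/negP => /t_max; rewrite ltnn.
have t_gt0 : (0 < t)%N by case: t t_hi {t_lo} => //; rewrite exp1n ltnS leqNgt q_gt0.
have q_hi : (q <= (2 * t) ^ 60)%N.
  by apply: (leq_trans (ltnW t_hi)); rewrite leq_exp2r // mul2n -addnn -addn1 leq_add2l.
(* For [t <= z ^ 36] the modulus is so small that it is itself a good enough bound;
   otherwise Burgess saves a factor [t] in the fourth power of a block sum. *)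
have [t_small|t_large] := leqP t (z ^ 36).
  apply: (@le_trans _ _ ((z ^ 9)%:Z * q%:Z)); first by rewrite ler_wpM2l.
  rewrite -PoszM lez_nat; apply: (@leq_trans (K * X)); last by rewrite leq_mul2r leq_addr orbT.
  apply: (@leq_trans (z ^ 9 * (K * z ^ 2160))).
    rewrite leq_mul2l; apply/orP; right; apply: (leq_trans q_hi).
    rewrite expnMn KE leq_mul2l; apply/orP; right.
    by rewrite -[2160%N]/(36 * 60)%N expnM leq_exp2r.
  rewrite mulnCA leq_mul2l; apply/orP; right; apply: leq_trans zX.
  by rewrite -expnD leq_pexp2l.
have t2 : (2 <= t)%N by apply: leq_ltn_trans t_large; rewrite expn_gt0 z_gt0.
have blockS M' : (z ^ 9)%:Z * `|\sum_(m < t ^ 29) chi s (M' + m)| <= ((C0 + 1) * t ^ 29)%:Z.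
  rewrite -(@ler_pXn2r _ 4) ?nnegrE ?mulr_ge0 // exprMn.
  have XE (n k : nat) : (n ^ k)%:Z = n%:Z ^+ k by rewrite -rmorphXn.
  apply: (@le_trans _ _ ((z ^ 36)%:Z * (C0 * t ^ 115)%:Z)).
    apply: ler_pM; rewrite ?exprn_ge0 //; first by rewrite -XE -expnM.
    exact: block.
  rewrite -(XE _ 4%N) -PoszM lez_nat expnMn -expnM.
  apply: (@leq_trans (t * (C0 * t ^ 115))); first by rewrite leq_mul2r ltnW ?orbT.
  rewrite mulnCA -expnS leq_mul //.
  by rewrite (leq_trans (leq_addr 1 C0)) // -{1}[(C0 + 1)%N]expn1 leq_pexp2l // addn1.
have t29_gt0 : (0 < t ^ 29)%N by rewrite expn_gt0 t_gt0.
apply: (le_trans (sum_chi_blocks _ _ t29_gt0 blockS)); rewrite lez_nat.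
have z9_le : (z ^ 9 <= t)%N by apply: leq_trans (ltnW t_large); rewrite leq_pexp2l.
have cL : (z ^ 9 * t ^ 29 <= 3 * X)%N.
  apply: (@leq_trans (t ^ 30)); first by rewrite [(t ^ 30)%N]expnS leq_mul2r z9_le orbT.
  rewrite -(@leq_exp2r _ _ 2) // -expnM expnMn.
  exact: leq_trans t_lo q_le.
apply: (@leq_trans ((C0 + 1) * (2 * X) + 3 * X)); first by rewrite leq_add // leq_mul2l N_le orbT.
by clear; lia.
Qed.

(** * Selberg weights *)

(** For [l > 0], the number of multiples of [l] below [x]. *)
Definition ceil_div l x := ((x + l.-1) %/ l)%N.

Lemma ceil_divS l x : (0 < l)%N ->
  ceil_div l x.+1 = ((l %| x) + ceil_div l x)%N.
Proof.
move=> l_gt0; rewrite /ceil_div addSnnS prednK // divnDr // divnn l_gt0 addn1.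
rewrite /dvdn [in X in _ = (_ + X)%N](divn_eq x l) -addnA divnMDl //.
have := ltn_pmod x l_gt0; move: (x %% l)%N (x %/ l)%N => r k r_l.
have [->|r_gt0] := posnP r.
  by rewrite add0n divn_small ?addn0 ?prednK.
have -> : (r + l.-1 = 1 * l + r.-1)%N by lia.
by rewrite divnMDl // divn_small /=; lia.
Qed.

Lemma sum_multiples (R : nmodType) (g : nat -> R) l M N : (0 < l)%N ->
  \sum_(M <= m < M + N | (l %| m)%N) g m
    = \sum_(ceil_div l M <= k < ceil_div l (M + N)) g (l * k)%N.
Proof.
move=> l_gt0; elim: N => [|N IH]; first by rewrite addn0 !big_geq.
rewrite addnS big_mkcond big_nat_recr ?leq_addr //= -big_mkcond IH ceil_divS //.
case: ifP => [|_]; last by rewrite addr0.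
case/dvdnP=> k kE.
have le : (ceil_div l M <= ceil_div l (M + N))%N by rewrite leq_div2r // leq_add2r leq_addr.
have ceilE : ceil_div l (M + N) = k.
  by rewrite kE /ceil_div divnMDl // divn_small ?addn0 // prednK.
by rewrite big_nat_recr //= ceilE mulnC -kE.
Qed.

Lemma ceil_div_sub l M N : (0 < l)%N -> exists N',
  [/\ ceil_div l (M + N) = (ceil_div l M + N')%N, (N' <= N)%N,
      (N' * l < N + l)%N & (N < N' * l + l)%N].
Proof.
move=> l_gt0; exists (ceil_div l (M + N) - ceil_div l M)%N; rewrite /ceil_div.
set a := (M + l.-1)%N; have -> : (M + N + l.-1 = a + N)%N by rewrite /a addnAC.
have := divn_eq a l; have := divn_eq (a + N) l.
have := ltn_pmod a l_gt0; have := ltn_pmod (a + N) l_gt0.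
have : (a %/ l <= (a + N) %/ l)%N by rewrite leq_div2r // leq_addr.
move: (a %/ l)%N ((a + N) %/ l)%N (a %% l)%N ((a + N) %% l)%N => u v x y uv xl yl E1 E2.
have le_l : (N <= N * l)%N by rewrite leq_pmulr.
have ul_vl : (u * l <= v * l)%N by rewrite leq_mul2r uv orbT.
have E3 : ((v - u) * l + y = N + x)%N.
  by rewrite mulnBl; clearbody a; move: (u * l)%N (v * l)%N ul_vl E1 E2 => ul vl; lia.
have uvE : (u + (v - u) = v)%N by rewrite subnKC.
move: (v - u)%N E3 uvE => w E3 uvE; split; [by rewrite uvE | | lia | lia].
have : (w * l < N * l + l)%N by lia.
by rewrite -mulSnr ltn_mul2r => /andP[_]; rewrite ltnS.
Qed.

Section SieveSum.
Variables (R : realFieldType) (f : nat -> R) (c K : R) (N0 : nat).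
Hypotheses (fM : forall m n, f (m * n)%N = f m * f n) (f_le1 : forall m, `|f m| <= 1).
Hypothesis f_sum : forall M N, (N <= N0)%N ->
  `|\sum_(M <= m < M + N) f m - c * N%:R| <= K.
Variable phi : nat -> bool -> R.

(** For [f = 1] this is the average of the factor at [l] over all residues modulo [l]. *)
Definition local_mean l := phi l false + f l * (phi l true - phi l false) / l%:R.
Definition local_weight l := `|phi l false| + `|phi l true - phi l false|.

Lemma local_weight_ge0 l : 0 <= local_weight l.
Proof. by rewrite addr_ge0. Qed.

Lemma local_mean_le l : (0 < l)%N -> `|local_mean l| <= local_weight l.
Proof.
move=> l_gt0; apply: (le_trans (ler_normD _ _)); rewrite lerD2l !normrM mulrAC.
rewrite ler_piMl // mulr_ile1 // normfV normr_nat invf_le1 ?ltr0n //.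
by rewrite ler1n.
Qed.

(** Induction on [P]: the factor at [l] is [phi l false] plus a correction supported on the
    multiples [m = l * k], where [f m = f l * f k] and [k] runs over about [N / l] integers.
    Rounding this length costs [|c|] per prime. Characters are the case [c = 0], and [f = 1],
    [c = 1] yields main terms. *)
Lemma sieve_sum (P : seq nat) M N : uniq P -> (forall l, l \in P -> prime l) ->
  (N <= N0)%N ->
  `|\sum_(M <= m < M + N) f m * \prod_(l <- P) phi l (l %| m)%N
     - c * \prod_(l <- P) local_mean l * N%:R|
  <= \prod_(l <- P) local_weight l * (K + `|c| * (size P)%:R).
Proof.
elim: P M N => [|l P IH] M N /=.
  move=> _ _ N_N0; rewrite !big_nil mulr1 mulr0 addr0 mul1r.
  by under eq_bigr do rewrite big_nil mulr1; exact: f_sum.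
move=> /andP[l_P P_uniq] P_pr N_N0.
have P_pr' l' : l' \in P -> prime l' by move=> l'P; rewrite P_pr // inE l'P orbT.
have l_pr : prime l by rewrite P_pr // mem_head.
have l_gt0 := prime_gt0 l_pr.
pose F m := f m * \prod_(l' <- P) phi l' (l' %| m)%N.
pose mu := \prod_(l' <- P) local_mean l'; pose w := \prod_(l' <- P) local_weight l'.
have w_ge0 : 0 <= w by apply: prodr_ge0 => l' _; exact: local_weight_ge0.
have mu_le : `|mu| <= w.
  rewrite /mu /w normr_prod big_seq [leRHS]big_seq; apply: ler_prod => l' /P_pr'/prime_gt0 l'_gt0.
  by rewrite normr_ge0 local_mean_le.
set E := w * (K + `|c| * (size P)%:R).
have FE m : f m * \prod_(l' <- l :: P) phi l' (l' %| m)%N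
   = phi l false * F m + (phi l true - phi l false) * (if (l %| m)%N then F m else 0).
  by rewrite big_cons /F; case: (l %| m)%N; ring.
have [N' [N'E N'_le N'_lo N'_hi]] := ceil_div_sub M N l_gt0.
have mult : \sum_(M <= m < M + N | (l %| m)%N) F m
   = f l * \sum_(ceil_div l M <= k < ceil_div l M + N') F k.
  rewrite sum_multiples // N'E big_distrr /=; apply: eq_bigr => k _.
  rewrite /F fM -mulrA; congr (_ * (_ * _)); apply: eq_big_seq => l' l'P.
  have l'_pr := P_pr' l' l'P; rewrite Gauss_dvdr // prime_coprime // dvdn_prime2 //.
  by apply: contraNneq l_P => <-.
rewrite (eq_bigr _ (fun m _ => FE m)).
rewrite big_split /= -!big_distrr /= -big_mkcond mult !big_cons -/mu -/w.
have E1 := IH M N P_uniq P_pr' N_N0.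
have E2 := IH (ceil_div l M) N' P_uniq P_pr' (leq_trans N'_le N_N0).
rewrite -/mu -/w -/E in E1 E2.
rewrite /local_mean.
set S1 := \sum_(M <= m < _) F m; set S2 := \sum_(_ <= k < _) F k.
set pf := phi l false; set d := phi l true - pf.
have -> : pf * S1 + d * (f l * S2) - c * ((pf + f l * d / l%:R) * mu) * N%:R
   = pf * (S1 - c * mu * N%:R) + d * f l * (S2 - c * mu * N'%:R)
     + d * f l * c * mu * (N'%:R - N%:R / l%:R).
  by ring.
have N'N : `|N'%:R - N%:R / l%:R| <= 1 :> R.
  have l0 : 0 < l%:R :> R by rewrite ltr0n.
  have h1 : N'%:R * l%:R <= N%:R + l%:R :> R by rewrite -natrM -natrD ler_nat ltnW.
  have h2 : N%:R <= N'%:R * l%:R + l%:R :> R by rewrite -natrM -natrD ler_nat ltnW.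
  rewrite ler_norml; apply/andP; split.
    by rewrite lerBrDr addrC lerBlDr ler_pdivrMr // mulrDl mul1r.
  by rewrite lerBlDr -lerBlDl ler_pdivlMr // mulrBl mul1r lerBlDr.
have fl := f_le1 l; have w_le : 0 <= `|c| * w by rewrite mulr_ge0.
rewrite /local_weight -/pf -/d.
apply: (@le_trans _ _ (`|pf| * E + `|d| * E + `|d| * (`|c| * w))).
  apply: (le_trans (ler_normD _ _)); apply: lerD.
    apply: (le_trans (ler_normD _ _)); rewrite !normrM; apply: lerD.
      by rewrite ler_wpM2l.
    rewrite -mulrA ler_wpM2l // -[leRHS]mul1r; exact: ler_pM.
  rewrite !normrM -!mulrA ler_wpM2l // -[leRHS]mul1r; apply: ler_pM; rewrite ?mulr_ge0 //.
  rewrite ler_wpM2l // -[leRHS]mulr1; exact: ler_pM.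
rewrite -natr1 /E -subr_ge0 (_ : _ - _ = `|pf| * (`|c| * w)); last by ring.
by rewrite mulr_ge0.
Qed.
End SieveSum.

Lemma dvdn_prod_primes (s : seq nat) p : prime p -> (forall l, l \in s -> prime l) ->
  (p %| \prod_(l <- s) l)%N = (p \in s).
Proof.
move=> p_pr; elim: s => [|l s IH] s_pr.
  by rewrite big_nil dvdn1 in_nil; apply/eqP => p1; rewrite p1 in p_pr.
have l_pr := s_pr l (mem_head l s).
rewrite big_cons Euclid_dvdM // dvdn_prime2 // inE IH // => l' l's.
by rewrite s_pr // inE l's orbT.
Qed.

Lemma ler_sum_uniq_sub (R : realFieldType) (I : eqType) (s t : seq I) (F : I -> R) :
  uniq s -> uniq t -> {subset s <= t} -> (forall i, 0 <= F i) ->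
  \sum_(i <- s) F i <= \sum_(i <- t) F i.
Proof.
move=> us ut st F0; rewrite [leRHS](bigID (mem s)) /= -[X in _ <= X + _]big_filter.
rewrite [X in _ <= X + _](perm_big s) /=.
  by rewrite lerDl sumr_ge0.
suff : perm_eq [seq i <- t | i \in s] s by [].

apply: uniq_perm; rewrite ?filter_uniq // => i; rewrite mem_filter /=.
by case: (boolP (i \in s)) => // /st.
Qed.

Section SquarefreePart.

Definition odd_exponent_primes n := [seq l <- primes n | odd (logn l n)].
Definition squarefree_part n := (\prod_(l <- odd_exponent_primes n) l)%N.
Definition square_part n := (\prod_(l <- primes n) l ^ (logn l n)./2)%N.

Lemma squarefree_partP n : (0 < n)%N -> n = (squarefree_part n * square_part n ^ 2)%N.
Proof.
move=> n_gt0; rewrite {1}(prod_prime_decomp n_gt0) prime_decompE big_map /=.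
rewrite /squarefree_part /square_part big_filter [X in (X * _)%N]big_mkcond /=.
rewrite (big_morph (expn^~ 2) (fun m n => expnMn m n 2) (exp1n 2)) -big_split /=.
apply: eq_bigr => l _; rewrite -expnM -{1}(odd_double_half (logn l n)) muln2.
by case: odd; rewrite ?add0n ?mul1n // expnD expn1.
Qed.

Lemma squarefree_part_gt0 n : (0 < squarefree_part n)%N.
Proof.
rewrite /squarefree_part big_seq_cond prodn_cond_gt0 // => l.
by rewrite mem_filter mem_primes => /andP[/and3P[_ /prime_gt0]].
Qed.

Lemma square_part_gt0 n : (0 < square_part n)%N.
Proof.
rewrite /square_part big_seq_cond prodn_cond_gt0 // => l.
by rewrite mem_primes => /andP[/and3P[/prime_gt0 l_gt0 _ _] _]; rewrite expn_gt0 l_gt0.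
Qed.
End SquarefreePart.

Section Selberg.
Variables (R : realFieldType) (z : nat).
Hypothesis z_gt0 : (0 < z)%N.

Definition sieve_primes := [seq l <- iota 1 z | prime l].
Let P := sieve_primes.
Definition squarefree k := k == (\prod_(l <- P | (l %| k)%N) l)%N.
Definition sieve_moduli := [seq k <- iota 1 z | squarefree k].
Let Q := sieve_moduli.

(* For squarefree [k], the product of these factors over the primes [l <= z] is
   [mu(k) c_k(m) / phi(k)], where [c_k] is the Ramanujan sum. *)
Definition ramanujan_factor l k (b : bool) : R :=
  if (l %| k)%N then (if b then -1 else l.-1%:R^-1) else 1.
Definition ramanujan k m : R := \prod_(l <- P) ramanujan_factor l k (l %| m)%N.
Definition inv_totient k : R := \prod_(l <- P | (l %| k)%N) l.-1%:R^-1.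
Definition selberg_mass : R := \sum_(k <- Q) inv_totient k.
(** The expansion is in Ramanujan sums rather than in divisors of [m] because these are orthogonal
    on average: the quadratic form is diagonal from the start, with entries [inv_totient k], and
    nothing has to be optimised. *)
Definition selberg_weight m : R := selberg_mass^-1 * \sum_(k <- Q) ramanujan k m.

Lemma mem_sieve_primes l : (l \in P) = prime l && (l <= z)%N.
Proof.
rewrite mem_filter mem_iota add1n ltnS; case: (boolP (prime l)) => //= /prime_gt0 l_gt0.
by rewrite l_gt0.
Qed.

Lemma sieve_primes_uniq : uniq P.
Proof. by rewrite filter_uniq // iota_uniq. Qed.

Lemma sieve_primes_prime l : l \in P -> prime l.
Proof. by rewrite mem_sieve_primes => /andP[]. Qed.

Lemma size_sieve_primes : (size P <= z)%N.
Proof. by rewrite size_filter (leq_trans (count_size _ _)) // size_iota. Qed.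

Lemma sieve_modulus_bounds k : k \in Q -> (0 < k)%N && (k <= z)%N.
Proof. by rewrite mem_filter mem_iota add1n ltnS => /andP[_]. Qed.

Lemma sieve_moduli_separated k k' : k \in Q -> k' \in Q -> k != k' ->
  exists2 l, l \in P & (l %| k)%N != (l %| k')%N.
Proof.
rewrite !mem_filter => /andP[/eqP kE _] /andP[/eqP kE' _] kk'.
apply/hasP; apply: contraNT kk' => /hasPn same; apply/eqP; rewrite kE kE'.
rewrite big_seq_cond [RHS]big_seq_cond; apply: eq_bigl => l.
by case: (boolP (l \in P)) => //= /same; rewrite negbK => /eqP->.
Qed.

Lemma inv_totient_ge0 k : 0 <= inv_totient k.
Proof. by apply: prodr_ge0 => l _; rewrite invr_ge0. Qed.

Lemma inv_totient_ge k : (0 < k)%N -> k%:R^-1 <= inv_totient k.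
Proof.
move=> k_gt0; have l_gt0 l : l \in P -> (0 < l)%N by move/sieve_primes_prime/prime_gt0.
have prod_gt0 : (0 < \prod_(l <- P | (l %| k)%N) l)%N.
  by rewrite big_seq_cond prodn_cond_gt0 // => l /andP[/l_gt0].
apply: (@le_trans _ _ ((\prod_(l <- P | (l %| k)%N) l)%:R^-1)).
  rewrite lef_pV2 ?posrE ?ltr0n // ler_nat dvdn_leq //.
  by apply: prod_primes_dvdn => //; [exact: sieve_primes_uniq | exact: sieve_primes_prime].
rewrite natr_prod -prodfV big_seq_cond [leRHS]big_seq_cond; apply: ler_prod => l /andP[lP _].
have l1 := prime_gt1 (sieve_primes_prime lP).
have l1' : (0 < l.-1)%N by rewrite -subn1 subn_gt0.
have l0 := l_gt0 l lP; rewrite invr_ge0 ler0n /=.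
by rewrite lef_pV2 ?posrE ?ltr0n // ler_nat leq_pred.
Qed.

Lemma ramanujan_prime k p : prime p -> (z < p)%N -> ramanujan k p = inv_totient k.
Proof.
move=> p_pr z_p; rewrite /inv_totient big_mkcond; apply: eq_big_seq => l.
rewrite mem_sieve_primes /ramanujan_factor => /andP[l_pr l_z].
have -> : (l %| p)%N = false; last by [].
by rewrite dvdn_prime2 //; apply/negbTE; rewrite neq_ltn (leq_ltn_trans l_z).
Qed.

Lemma selberg_mass_ge1 : 1 <= selberg_mass.
Proof.
have one_Q : 1%N \in Q.
  have one_z : 1%N \in iota 1 z by rewrite mem_iota leqnn add1n ltnS.
  rewrite mem_filter one_z andbT /squarefree big_seq_cond big_pred0 //.
  by move=> l; apply/andP => -[/sieve_primes_prime l_pr]; rewrite dvdn1 => /eqP l1; rewrite l1 in l_pr.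
rewrite /selberg_mass (big_rem _ one_Q) /=; rewrite -[leLHS]addr0 lerD //.
  by rewrite -[leLHS]invr1 (inv_totient_ge (k := 1)).
by apply: sumr_ge0 => k _; exact: inv_totient_ge0.
Qed.

Lemma selberg_weight_prime p : prime p -> (z < p)%N -> selberg_weight p = 1.
Proof.
move=> p_pr z_p; rewrite /selberg_weight.
under eq_bigr do rewrite (ramanujan_prime _ p_pr z_p).
by rewrite mulVf // gt_eqF // (lt_le_trans ltr01) // selberg_mass_ge1.
Qed.

(** Accounts for the primes shared by two characters, whose squared symbols only detect coprimality.
    As a product of local factors it goes through [sieve_sum] together with the weight. *)
Definition coprime_indicator (T : seq nat) m : R :=
  \prod_(l <- P) (if (l \in T) && (l %| m)%N then 0 else 1).
Definition pair_factor k k' (T : seq nat) l (b : bool) : R :=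
  ramanujan_factor l k b * ramanujan_factor l k' b *
  (if (l \in T) && b then 0 else 1).

Lemma prod_pair_factor k k' T m :
  \prod_(l <- P) pair_factor k k' T l (l %| m)%N
    = ramanujan k m * ramanujan k' m * coprime_indicator T m.
Proof. by rewrite -!big_split. Qed.

Lemma normr_ramanujan_factor_le1 l k b : prime l -> `|ramanujan_factor l k b| <= 1.
Proof.
move=> /prime_gt1 l1; rewrite /ramanujan_factor; case: ifP => _; last by rewrite normr1.
case: b; first by rewrite normrN1.
have l1' : (0 < l.-1)%N by rewrite -subn1 subn_gt0.
by rewrite normfV normr_nat invf_le1 ?ltr0n // ler1n.
Qed.

(** The factor never exceeds 1 in absolute value, and it is identically 1 unless [l] divides [k] or
    [k'] or lies in [T]. The total weight is thus a power of 3 counted by such primes, hence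
    polynomial in [z] and [D]. *)
Lemma local_weight_pair_factor k k' T l : prime l ->
  local_weight (pair_factor k k' T) l <=
  ((if (l %| k)%N then 3 else 1) * (if (l %| k')%N then 3 else 1)
    * (if l \in T then 3 else 1))%:R.
Proof.
move=> l_pr; have le1 b : `|pair_factor k k' T l b| <= 1.
  rewrite /pair_factor !normrM !mulr_ile1 ?mulr_ge0 ?normr_ramanujan_factor_le1 //.
  by case: ifP; rewrite ?normr0 ?normr1.
have le3 : local_weight (pair_factor k k' T) l <= 3.
  apply: (@le_trans _ _ (1 + (1 + 1))); last by rewrite (_ : 3 = 1 + (1 + 1)) //; ring.
  apply: lerD; first exact: le1.
  by apply: (le_trans (ler_normB _ _)); apply: lerD; exact: le1.
case: (boolP (l %| k)%N) => lk; [|case: (boolP (l %| k')%N) => lk'; [|case: (boolP (l \in T)) => lT]].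
- apply: (le_trans le3); rewrite ler_nat -mulnA leq_pmulr // muln_gt0.
  by case: ifP; case: ifP.
- apply: (le_trans le3); rewrite ler_nat mul1n leq_pmulr //.
  by case: ifP.
- exact: (le_trans le3).
rewrite /local_weight /pair_factor /ramanujan_factor (negPf lk) (negPf lk') (negPf lT) /=.
by rewrite !mulr1 subrr normr0 addr0 normr1.
Qed.

Lemma prod_pow3_le k : (0 < k)%N ->
  (\prod_(l <- P) (if (l %| k)%N then 3 else 1) <= k ^ 2)%N.
Proof.
move=> k_gt0; rewrite -big_mkcond /=.
apply: (@leq_trans (\prod_(l <- P | (l %| k)%N) l ^ 2)).
  rewrite big_seq_cond [leqRHS]big_seq_cond; apply: leq_prod => l /andP[/sieve_primes_prime/prime_gt1 l1 _].
  by rewrite (leq_trans (_ : 3 <= 2 ^ 2)%N) // leq_exp2r.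
rewrite -(big_morph (expn^~ 2) (fun m n => expnMn m n 2) (exp1n 2)) leq_exp2r //.
apply: dvdn_leq => //.
by apply: prod_primes_dvdn => //; [exact: sieve_primes_uniq | exact: sieve_primes_prime].
Qed.

Lemma prod_local_weight_pair k k' T D : k \in Q -> k' \in Q -> (0 < D)%N ->
  (forall l, l \in T -> (l %| D)%N) ->
  \prod_(l <- P) local_weight (pair_factor k k' T) l <= (z ^ 4 * D ^ 2)%:R.
Proof.
move=> /sieve_modulus_bounds/andP[k0 kz] /sieve_modulus_bounds/andP[k'0 k'z] D0 TD.
apply: (@le_trans _ _ (\prod_(l <- P) ((if (l %| k)%N then 3 else 1)
   * (if (l %| k')%N then 3 else 1) * (if (l %| D)%N then 3 else 1))%:R)).
  rewrite big_seq [leRHS]big_seq; apply: ler_prod => l /sieve_primes_prime l_pr.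
  rewrite local_weight_ge0 (le_trans (local_weight_pair_factor _ _ _ l_pr)) //.
  rewrite ler_nat leq_mul //; case: (boolP (l \in T)) => [/TD->//|_].
  by case: ifP.
rewrite -natr_prod ler_nat !big_split /=.
rewrite (_ : z ^ 4 = z ^ 2 * z ^ 2)%N; last by rewrite -expnD.
by rewrite !leq_mul // (leq_trans (prod_pow3_le _)) // leq_exp2r.
Qed.

Lemma sum_selberg_weight_sqr (F : nat -> R) M N :
  \sum_(M <= m < M + N) selberg_weight m ^+ 2 * F m
  = selberg_mass ^- 2 * \sum_(k <- Q) \sum_(k' <- Q)
      \sum_(M <= m < M + N) F m * (ramanujan k m * ramanujan k' m).
Proof.
have -> : \sum_(k <- Q) \sum_(k' <- Q)
      \sum_(M <= m < M + N) F m * (ramanujan k m * ramanujan k' m)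
   = \sum_(M <= m < M + N) F m * (\sum_(k <- Q) ramanujan k m) ^+ 2.
  under eq_bigr do rewrite exchange_big /=.
  rewrite exchange_big /=; apply: eq_bigr => m _.
  by rewrite expr2 big_distrlr /= mulr_sumr; apply: eq_bigr => k _; rewrite mulr_sumr.
rewrite mulr_sumr; apply: eq_bigr => m _.
by rewrite /selberg_weight exprMn exprVn -mulrA [F m * _]mulrC.
Qed.

Lemma size_sieve_moduli : (size Q <= z)%N.
Proof. by rewrite size_filter (leq_trans (count_size _ _)) // size_iota. Qed.

Lemma sum2_moduli_le (c : nat -> nat -> R) (B : R) : 0 <= B ->
  (forall k k', k \in Q -> k' \in Q -> `|c k k'| <= B) ->
  `|\sum_(k <- Q) \sum_(k' <- Q) c k k'| <= (z ^ 2)%:R * B.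
Proof.
move=> B0 cB; have sumle (x : nat -> R) (b : R) : 0 <= b ->
    (forall k, k \in Q -> `|x k| <= b) -> `|\sum_(k <- Q) x k| <= z%:R * b.
  move=> b0 xb; apply: (le_trans (ler_norm_sum _ _ _)).
  apply: (@le_trans _ _ (\sum_(k <- Q) b)).
    by rewrite big_seq [leRHS]big_seq; apply: ler_sum => k; exact: xb.
  by rewrite big_const_seq count_predT iter_addr_0 -[leLHS]mulr_natl ler_wpM2r // ler_nat size_sieve_moduli.
rewrite natrX expr2 -mulrA; apply: (sumle) => [|k kQ]; first by rewrite mulr_ge0.
by apply: sumle => // k' k'Q; exact: cB.
Qed.

Lemma invr_mass_sqr_le1 : 0 <= selberg_mass ^- 2 <= 1.
Proof.
have m1 := selberg_mass_ge1; have m0 := lt_le_trans ltr01 m1.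
by rewrite invr_ge0 (exprn_ge0 _ (ltW m0)) /= invf_le1 ?exprn_gt0 // exprn_ege1.
Qed.

(** No main term occurs, as [c = 0] in [sieve_sum]. At most [z ^ 2] pairs of moduli each cost
    [z ^ 4 * D ^ 2], and dividing by the squared mass does not increase the bound. *)
Lemma sum_selberg_char_le (f : nat -> R) (K : R) N0 T D M N :
  (forall m n, f (m * n)%N = f m * f n) -> (forall m, `|f m| <= 1) ->
  (forall M N, (N <= N0)%N -> `|\sum_(M <= m < M + N) f m| <= K) ->
  (0 < D)%N -> (forall l, l \in T -> (l %| D)%N) -> (N <= N0)%N ->
  `|\sum_(M <= m < M + N) selberg_weight m ^+ 2 * (f m * coprime_indicator T m)|
    <= (z ^ 6 * D ^ 2)%:R * K.
Proof.
move=> fM f1 fK D0 TD N_N0; rewrite sum_selberg_weight_sqr normrM.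
have K0 : 0 <= K by apply: le_trans (fK M N N_N0).
have /andP[m0 m1] := invr_mass_sqr_le1; rewrite (ger0_norm m0).
rewrite -[leRHS]mul1r; apply: ler_pM => //.
rewrite (_ : z ^ 6 * D ^ 2 = z ^ 2 * (z ^ 4 * D ^ 2))%N; last by rewrite mulnA -expnD.
rewrite natrM -mulrA; apply: sum2_moduli_le => [|k k' kQ k'Q]; first by rewrite mulr_ge0.
have fK' M' N' : (N' <= N0)%N -> `|\sum_(M' <= m < M' + N') f m - 0 * N'%:R| <= K.
  by rewrite mul0r subr0; exact: fK.
have := sieve_sum fM f1 fK' (pair_factor k k' T) M sieve_primes_uniq
  sieve_primes_prime N_N0.
rewrite !mul0r subr0 normr0 mul0r addr0 => H.
rewrite (eq_bigr (fun m => f m * \prod_(l <- P) pair_factor k k' T l (l %| m)%N)); last first.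
  by move=> m _; rewrite prod_pair_factor; ring.
apply: (le_trans H); rewrite ler_wpM2r //; exact: prod_local_weight_pair.
Qed.

(** Orthogonality at one prime: a factor dividing only one modulus has mean
    [(1 - 1/l) / (l - 1) - 1/l = 0]. *)
Lemma local_mean_pair_factor k k' l : prime l ->
  local_mean (fun=> 1) (pair_factor k k' [::]) l
  = if (l %| k)%N then (if (l %| k')%N then l.-1%:R^-1 else 0)
    else (if (l %| k')%N then 0 else 1).
Proof.
move=> /prime_gt1 l1; have l_gt0 : (0 < l)%N := ltnW l1.
have l1' : (0 < l.-1)%N by rewrite -subn1 subn_gt0.
have lE : l%:R = l.-1%:R + 1 :> R by rewrite natr1 prednK.
have n0 : l.-1%:R != 0 :> R by rewrite pnatr_eq0 -lt0n.
have n1 : l.-1%:R + 1 != 0 :> R by rewrite -lE pnatr_eq0 -lt0n.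
rewrite /local_mean /pair_factor /ramanujan_factor in_nil /= lE.
by case: ifP => _; case: ifP => _; field; rewrite ?n0 ?n1.
Qed.

(** Only the diagonal has a main term; it sums to [N] times the mass, divided by the squared mass.
    The error collects [z ^ 2] pairs, [z ^ 4] for local weights and [z] for one rounding per sieve
    prime. *)
Lemma sum_selberg_weight_le M N :
  \sum_(M <= m < M + N) selberg_weight m ^+ 2 <= N%:R / selberg_mass + (z ^ 7)%:R.
Proof.
have m1 := selberg_mass_ge1; have m0 := lt_le_trans ltr01 m1.
have mass_n0 : selberg_mass != 0 by rewrite gt_eqF.
under eq_bigr do rewrite -[_ ^+ 2]mulr1.
rewrite (sum_selberg_weight_sqr (fun=> 1)).
pose mean k k' : R := \prod_(l <- P) local_mean (fun=> 1) (pair_factor k k' [::]) l.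
have mean_diag k : mean k k = inv_totient k.
  rewrite /inv_totient big_mkcond; apply: eq_big_seq => l /sieve_primes_prime l_pr.
  by rewrite local_mean_pair_factor //; case: (l %| k)%N.
have mean_off k k' : k \in Q -> k' \in Q -> k != k' -> mean k k' = 0.
  move=> kQ k'Q kk'; have [l lP lkk'] := sieve_moduli_separated kQ k'Q kk'.
  rewrite /mean (big_rem l) //= local_mean_pair_factor ?(sieve_primes_prime lP) //.
  by move: lkk'; case: (l %| k)%N; case: (l %| k')%N => //; rewrite mul0r.
have one_le : `|1 : R| <= 1 by rewrite normr1.
have close k k' : k \in Q -> k' \in Q ->
    `|\sum_(M <= m < M + N) 1 * (ramanujan k m * ramanujan k' m) - mean k k' * N%:R|
      <= (z ^ 5)%:R.
  move=> kQ k'Q.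
  have triv M' N' : (N' <= N)%N -> `|\sum_(M' <= m < M' + N') (1 : R) - 1 * N'%:R| <= 0.
    by rewrite sumr_const_nat addKn mul1r subrr normr0.
  have H := sieve_sum (f := fun=> 1) (fun _ _ => esym (mulr1 1)) (fun=> one_le) triv
    (pair_factor k k' [::]) M sieve_primes_uniq sieve_primes_prime (leqnn N).
  rewrite mul1r add0r normr1 mul1r in H.
  rewrite (eq_bigr (fun m => 1 * \prod_(l <- P) pair_factor k k' [::] l (l %| m)%N)); last first.
    move=> m _; rewrite prod_pair_factor.
    have -> : coprime_indicator [::] m = 1 by apply: big1.
    by rewrite mulr1.
  apply: (le_trans H); rewrite (_ : z ^ 5 = z ^ 4 * 1 ^ 2 * z)%N; last by rewrite muln1 -expnSr.
  rewrite natrM; apply: ler_pM; rewrite ?ler0n //.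
  - by apply: prodr_ge0 => l _; exact: local_weight_ge0.
  - exact: prod_local_weight_pair.
  - by rewrite ler_nat size_sieve_primes.
pose err k k' := \sum_(M <= m < M + N) 1 * (ramanujan k m * ramanujan k' m) - mean k k' * N%:R.
have err_le : `|\sum_(k <- Q) \sum_(k' <- Q) err k k'| <= (z ^ 2)%:R * (z ^ 5)%:R.
  by apply: sum2_moduli_le => //; rewrite ler0n.
have -> : \sum_(k <- Q) \sum_(k' <- Q)
      \sum_(M <= m < M + N) 1 * (ramanujan k m * ramanujan k' m)
    = selberg_mass * N%:R + \sum_(k <- Q) \sum_(k' <- Q) err k k'.
  rewrite /selberg_mass mulr_suml -big_split /=; apply: eq_big_seq => k kQ.
  have -> : inv_totient k * N%:R = \sum_(k' <- Q) mean k k' * N%:R.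
    rewrite (big_rem k) //= mean_diag big_seq big1 ?addr0 // => k' k'_in.
    rewrite mean_off ?mul0r //; first exact: mem_rem k'_in.
    apply: contraTneq k'_in => <-; rewrite mem_rem_uniq ?inE ?eqxx //.
    by rewrite filter_uniq // iota_uniq.
  by rewrite -big_split /=; apply: eq_bigr => k' _; rewrite /err addrC subrK.
rewrite mulrDr; apply: lerD.
  by rewrite expr2 invfM -mulrA mulKf // mulrC.
have /andP[i0 i1] := invr_mass_sqr_le1.
rewrite (_ : z ^ 7 = z ^ 2 * z ^ 5)%N; last by rewrite -expnD.
rewrite natrM.
rewrite -[leRHS]mul1r; apply: (le_trans (ler_norm _)); rewrite normrM (ger0_norm i0).
exact: ler_pM.
Qed.

Lemma sum_inv_sqr_le n : \sum_(1 <= s < n.+2) s%:R ^- 2 <= 2 - n.+1%:R^-1 :> R.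
Proof.
elim: n => [|n IH]; first by rewrite big_nat1 expr1n invr1; lra.
rewrite big_nat_recr //=; apply: (le_trans (lerD IH (lexx _))).
have n0 : 0 < n.+1%:R :> R by rewrite ltr0n.
rewrite -[n.+2%:R]natr1; move: (n.+1%:R : R) n0 => x x0.
have x1 : x + 1 != 0 by rewrite gt_eqF // addr_gt0.
rewrite -subr_ge0 (_ : _ - _ = (x * (x + 1) ^+ 2)^-1).
  by rewrite invr_ge0 mulr_ge0 ?sqr_ge0 // ltW.
by field; rewrite x1 gt_eqF.
Qed.

Lemma squarefree_part_in_moduli n : (0 < n)%N -> (n <= z)%N -> squarefree_part n \in Q.
Proof.
move=> n_gt0 n_z; have le_n : (squarefree_part n <= n)%N.
  by rewrite {2}(squarefree_partP n_gt0) leq_pmulr // expn_gt0 square_part_gt0.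
rewrite mem_filter mem_iota add1n ltnS squarefree_part_gt0 (leq_trans le_n n_z) !andbT.
have pr l : l \in odd_exponent_primes n -> prime l.
  by rewrite mem_filter mem_primes => /andP[_ /and3P[]].
rewrite /squarefree -[X in _ == X]big_filter; apply/eqP; rewrite {1}/squarefree_part.
apply: perm_big; apply: uniq_perm.
- by rewrite filter_uniq // primes_uniq.
- by rewrite filter_uniq // sieve_primes_uniq.
move=> l; rewrite [RHS]mem_filter mem_sieve_primes.
have [l_pr|l_npr] := boolP (prime l); last by rewrite andbF; apply: contraNF l_npr => /pr.
rewrite dvdn_prod_primes //=; case: (boolP (l \in _)) => //= l_in.
rewrite (leq_trans _ n_z) //; move: l_in; rewrite mem_filter mem_primes => /andP[_ /and3P[_ _]].
exact: dvdn_leq.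
Qed.

(** Each [n <= z] is a squarefree [k] times a square, and the inverse squares sum to at most 2. This
    makes the mass at least of order [log z]. *)
Lemma harmonic_le_selberg_mass :
  \sum_(1 <= n < z.+1) n%:R^-1 <= 2 * selberg_mass.
Proof.
apply: (@le_trans _ _ (\sum_(k <- Q) \sum_(1 <= s < z.+1) k%:R^-1 * s%:R ^- 2)).
  rewrite (eq_big_nat _ _ (F2 := fun n => (squarefree_part n)%:R^-1 * (square_part n)%:R ^- 2));
    last first.
    by move=> n /andP[n_gt0 _]; rewrite {1}(squarefree_partP n_gt0) natrM natrX invfM.
  pose h n := (squarefree_part n, square_part n).
  pose s := [seq h n | n <- index_iota 1 z.+1].
  pose t := [seq (k, m) | k <- Q, m <- index_iota 1 z.+1].
  have -> : \sum_(1 <= n < z.+1) (squarefree_part n)%:R^-1 * (square_part n)%:R ^- 2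
     = \sum_(p <- s) p.1%:R^-1 * p.2%:R ^- 2 :> R by rewrite big_map.
  have -> : \sum_(k <- Q) \sum_(1 <= m < z.+1) k%:R^-1 * m%:R ^- 2
     = \sum_(p <- t) p.1%:R^-1 * p.2%:R ^- 2 :> R by rewrite big_allpairs.
  apply: ler_sum_uniq_sub.
  - rewrite map_inj_in_uniq ?iota_uniq // => a b; rewrite !mem_index_iota.
    move=> /andP[a_gt0 _] /andP[b_gt0 _] [e1 e2].
    by rewrite (squarefree_partP a_gt0) (squarefree_partP b_gt0) e1 e2.
  - rewrite allpairs_uniq ?iota_uniq ?filter_uniq // ?iota_uniq //.
    by move=> [k m] [k' m'] _ _ /= [-> ->].
  - move=> p /mapP[n]; rewrite mem_index_iota ltnS => /andP[n_gt0 n_z] ->.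
    apply/allpairsP; exists (h n); split=> //=; first exact: squarefree_part_in_moduli.
    rewrite mem_index_iota square_part_gt0 ltnS (leq_trans _ n_z) //.
    rewrite {2}(squarefree_partP n_gt0) (leq_trans _ (leq_pmull _ (squarefree_part_gt0 n))) //.
    by rewrite expnS expn1 leq_pmulr // square_part_gt0.
  - by move=> p; rewrite mulr_ge0 // invr_ge0 ?exprn_ge0 // ler0n.
under eq_bigr do rewrite -mulr_sumr.
rewrite -mulr_suml mulrC; apply: ler_pM.
- by apply: sumr_ge0 => s _; rewrite invr_ge0 exprn_ge0 // ler0n.
- by apply: sumr_ge0 => k _; rewrite invr_ge0 ler0n.
- rewrite -(prednK z_gt0); apply: (le_trans (sum_inv_sqr_le _)); rewrite lerBlDr lerDl invr_ge0 ler0n //.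
- rewrite /selberg_mass big_seq [leRHS]big_seq; apply: ler_sum => k /sieve_modulus_bounds/andP[k_gt0 _].
  exact: inv_totient_ge.
Qed.
End Selberg.

(** * Counting exceptional primes *)

Section OddPart.
Implicit Types n l p : nat.

Definition odd_part_primes n := [seq l <- odd_exponent_primes n | odd l].

Lemma odd_exponent_primesP n l : l \in odd_exponent_primes n -> prime l /\ (l %| n)%N.
Proof. by rewrite mem_filter mem_primes => /andP[_ /and3P[]]. Qed.

Lemma mem_odd_part_primes n l : l \in odd_part_primes n -> [/\ prime l, odd l & (l %| n)%N].
Proof. by rewrite mem_filter => /andP[l_odd /odd_exponent_primesP[]]. Qed.

Lemma odd_part_primes_seq n : odd_primes_seq (odd_part_primes n).
Proof.
apply/andP; split; first by rewrite !filter_uniq // primes_uniq.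
by apply/allP => l /mem_odd_part_primes[-> ->].
Qed.

Lemma prod_odd_part_primes_le n : (0 < n)%N -> (\prod_(l <- odd_part_primes n) l <= n)%N.
Proof.
move=> n_gt0; apply: dvdn_leq => //; apply: prod_primes_dvdn.
- by have /andP[] := odd_part_primes_seq n.
- by move=> l /mem_odd_part_primes[].
- by move=> l /mem_odd_part_primes[].
Qed.

(* [b] records whether 2 is a square modulo [p], and [c] the parity of [p./2]. *)
Definition reciprocity_sign (b c : bool) n : int :=
  (if 2%N \in odd_exponent_primes n then (-1) ^+ ~~ b else 1) *
  (if c then \prod_(l <- odd_part_primes n) qchar (-1 : 'F_l) else 1).

Lemma normr_reciprocity_sign b c n : `|reciprocity_sign b c n| <= 1.
Proof.
rewrite normrM mulr_ile1 //.
  by case: ifP => _; rewrite ?normrX ?normrN1 ?expr1n ?normr1.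
case: c; last by rewrite normr1.
rewrite normr_prod; apply: prodr_ile1 => l _.
by rewrite normr_ge0 normr_qchar_le1.
Qed.

(** As [p] does not divide [n], only the squarefree part of [n] matters, and its odd primes are
    flipped one by one. The sign then sees [p] through two bits only, so primes of one class share
    it for every [n]. *)
Lemma legendre_reciprocity_sign p n : prime p -> odd p -> (0 < n)%N -> ~~ (p %| n)%N ->
  legendre p n = reciprocity_sign (legendre p 2 == 1) (odd p./2) n * chi (odd_part_primes n) p.
Proof.
move=> p_pr p_odd n_gt0 p_n; have F_odd : odd #|'F_p| by rewrite card_Fp.
have co m : (m %| n)%N -> (m%:R : 'F_p) != 0.
  by move=> m_n; rewrite -(dvdn_pcharf (pchar_Fp p_pr)); apply: contra p_n => /dvdn_trans; apply.
have nE := squarefree_partP n_gt0.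
have sq_n : (square_part n %| n)%N by rewrite {2}nE expnS expn1 !dvdn_mull.
have -> : legendre p n = \prod_(l <- odd_exponent_primes n) legendre p l.
  rewrite {1}nE legendreM // {2}/legendre natrX qchar_sqr ?co // mulr1.
  by rewrite /legendre natr_prod qchar_prod.
rewrite (bigID odd) /= -[X in X * _]big_filter mulrC /reciprocity_sign -mulrA; congr (_ * _).
  have not_odd l : l \in odd_exponent_primes n -> ~~ odd l = (l == 2%N).
    by move=> /odd_exponent_primesP[/even_prime[->|l_odd] _] //; rewrite l_odd; case: eqP l_odd => // ->.
  rewrite big_seq_cond (eq_bigl (fun l => (l \in odd_exponent_primes n) && (l == 2%N))); last first.
    by move=> l; case: (boolP (l \in _)) => //= /not_odd.
  rewrite -big_seq_cond big_mkcond /=.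
  have odd_uniq : uniq (odd_exponent_primes n) by rewrite filter_uniq // primes_uniq.
  case: ifPn => [in2|nin2]; last first.
    by rewrite big_seq big1 // => l l_in; case: eqP => // l2; rewrite -l2 l_in in nin2.
  rewrite (bigD1_seq 2%N) //= big1 ?mulr1; last by move=> l /negPf->.
  have := odd_exponent_primesP in2 => -[_ dvd2].
  have := qchar_eq0 (2%:R : 'F_p); rewrite (negPf (co _ dvd2)) -/(legendre p 2).
  by case: (legendre p 2) (normr_legendre_le1 p 2) => [[|[|k]]|[|k]].
transitivity (\prod_(l <- odd_part_primes n) (qchar (-1 : 'F_l) ^+ p./2 * legendre l p)).
  apply: eq_big_seq => l /mem_odd_part_primes[l_pr l_odd l_n].
  by apply: quadratic_reciprocity => //; apply: contraNneq p_n => ->.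
rewrite big_split /=; congr (_ * _).
have sq1 (l : nat) : qchar (-1 : 'F_l) ^+ 2 = 1.
  rewrite /qchar oppr_eq0 oner_eq0; case: ifP => _; rewrite ?sqrrN expr1n //.
case: (boolP (odd p./2)) => odd_h; last first.
  by apply: big1 => l _; rewrite -(odd_double_half p./2) (negPf odd_h) add0n -mul2n exprM sq1 expr1n.
by apply: eq_bigr => l _; rewrite -(odd_double_half p./2) odd_h exprD -mul2n exprM sq1 expr1n mulr1.
Qed.
End OddPart.

Lemma legendre_sqr l m : legendre l m ^+ 2 = if m%:R == 0 :> 'F_l then 0 else 1.
Proof.
rewrite /legendre /qchar; case: eqP => _; first by rewrite expr0n.
by case: ifP => _; rewrite ?sqrrN expr1n.
Qed.

Definition sym_diff (s t : seq nat) := [seq l <- s | l \notin t] ++ [seq l <- t | l \notin s].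

Lemma sym_diff_odd_primes s t : odd_primes_seq s -> odd_primes_seq t ->
  odd_primes_seq (sym_diff s t).
Proof.
move=> s_ok t_ok; have /andP[us _] := s_ok; have /andP[ut _] := t_ok.
apply/andP; split.
  rewrite cat_uniq !filter_uniq //= andbT; apply/hasPn => l.
  by rewrite !mem_filter => /andP[_ lt]; rewrite lt.
apply/allP => l; rewrite mem_cat !mem_filter => /orP[/andP[_ l_in]|/andP[_ l_in]].
  by have [-> ->] := odd_primes_seqP s_ok l_in.
by have [-> ->] := odd_primes_seqP t_ok l_in.
Qed.

Lemma prod_sym_diff_le s t : odd_primes_seq s -> odd_primes_seq t ->
  (\prod_(l <- sym_diff s t) l <= (\prod_(l <- s) l) * \prod_(l <- t) l)%N.
Proof.
move=> s_ok t_ok; rewrite big_cat /= !big_filter; apply: leq_mul.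
  apply: dvdn_leq; first exact: prod_odd_primes_gt0.
  by rewrite [X in (_ %| X)%N](bigID (fun l => l \notin t)) /= dvdn_mulr.
apply: dvdn_leq; first exact: prod_odd_primes_gt0.
by rewrite [X in (_ %| X)%N](bigID (fun l => l \notin s)) /= dvdn_mulr.
Qed.

(** Primes in both lists contribute squares of symbols, which are 0 or 1. *)
Lemma chi_mul_chi s t m : odd_primes_seq s -> odd_primes_seq t ->
  chi s m * chi t m
    = chi (sym_diff s t) m * \prod_(l <- s | l \in t) (if (l %| m)%N then 0 else 1).
Proof.
move=> s_ok t_ok; have /andP[us _] := s_ok; have /andP[ut _] := t_ok.
rewrite /chi /sym_diff big_cat /= !big_filter.
rewrite (bigID (fun l => l \in t)) /= [X in _ * X = _](bigID (fun l => l \in s)) /=.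
have -> : \prod_(l <- t | l \in s) legendre l m = \prod_(l <- s | l \in t) legendre l m.
  rewrite -[LHS]big_filter -[RHS]big_filter; apply: perm_big; apply: uniq_perm; rewrite ?filter_uniq //.
  by move=> l; rewrite !mem_filter andbC.
have -> : \prod_(l <- s | l \in t) (if (l %| m)%N then 0 else 1)
     = \prod_(l <- s | l \in t) legendre l m ^+ 2 :> int.
  rewrite big_seq_cond [RHS]big_seq_cond; apply: eq_bigr => l /andP[ls _].
  have [l_pr _] := odd_primes_seqP s_ok ls.
  by rewrite legendre_sqr -(dvdn_pcharf (pchar_Fp l_pr)).
by rewrite prodrXl; ring.
Qed.

Lemma coprime_indicatorE (R : realFieldType) z (T : seq nat) m : uniq T ->
  {subset T <= sieve_primes z} ->
  coprime_indicator R z T m = \prod_(l <- T) (if (l %| m)%N then 0 else 1).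
Proof.
move=> uT T_P; rewrite /coprime_indicator (bigID (fun l => l \in T)) /=.
rewrite [X in _ * X]big1 ?mulr1; last by move=> l /negPf->.
rewrite -[LHS]big_filter (perm_big T); last first.
  apply: uniq_perm => // [|l]; first by rewrite filter_uniq // sieve_primes_uniq.
  by rewrite mem_filter; case: (boolP (l \in T)) => // /T_P.
by apply: eq_big_seq => l ->.
Qed.

Lemma sym_diff_nil s t : sym_diff s t = [::] -> s =i t.
Proof.
move=> st l; have : l \notin sym_diff s t by rewrite st.
rewrite mem_cat !mem_filter; by case: (l \in s); case: (l \in t).
Qed.

Lemma squarefree_part_eq m n : odd_part_primes m =i odd_part_primes n ->
  (2%N \in odd_exponent_primes m) = (2%N \in odd_exponent_primes n) ->
  squarefree_part m = squarefree_part n.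
Proof.
move=> mn mn2; apply: perm_big; apply: uniq_perm; rewrite ?filter_uniq ?primes_uniq // => l.
have [l_odd|l_even] := boolP (odd l).
  by have := mn l; rewrite !(mem_filter odd) l_odd.
have [->//|l2] := eqVneq l 2%N.
have no k : l \notin odd_exponent_primes k.
  apply/negP => /odd_exponent_primesP[/even_prime[l2'|l_odd] _].
    by rewrite l2' eqxx in l2.
  by rewrite l_odd in l_even.
by rewrite (negPf (no m)) (negPf (no n)).
Qed.

(* Integers with the same squarefree part [d] are [d] times squares, and
   squares [b ^ 2] in an interval of length [K ^ 2] have their roots in an interval of length [K]. *)
Lemma card_same_odd_part K u (s : seq nat) : (0 < K)%N ->
  (#|[set h : 'I_(K ^ 2) | sym_diff s (odd_part_primes (u + h).+1) == [::]]| <= 2 * K)%N.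
Proof.
move=> K_gt0; set A := [set h | _].
(* The odd primes of the squarefree part are prescribed by [s], so the boolean determines that part;
   the root modulo [K] then determines [h]. *)
pose g (h : 'I_(K ^ 2)) : bool * 'I_K :=
  (2%N \in odd_exponent_primes (u + h).+1, Ordinal (ltn_pmod (square_part (u + h).+1) K_gt0)).
have g_inj : {in A &, injective g}.
  have wl (i j : 'I_(K ^ 2)) : (squarefree_part (u + i).+1 = squarefree_part (u + j).+1) ->
      square_part (u + i).+1 = square_part (u + j).+1 %[mod K] ->
      (square_part (u + i).+1 <= square_part (u + j).+1)%N -> i = j.
    move=> core_eq sq_mod sq_le; apply: val_inj.
    have ni := squarefree_partP (ltn0Sn (u + i)).
    have nj := squarefree_partP (ltn0Sn (u + j)); rewrite -core_eq in nj.
    have core_gt0 := squarefree_part_gt0 (u + i).+1.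
    move: (ltn_ord i) (ltn_ord j) ni nj core_gt0 sq_mod sq_le.
    move: (squarefree_part _) (square_part _) (square_part _) => d b a iK jK ni nj d_gt0 ab_mod ab.
    have ab_eq : a = b.
      apply/eqP; rewrite eqn_leq ab -subn_eq0 andTb.
      have : (K %| b - a)%N by rewrite -eqn_mod_dvd //; apply/eqP/esym.
      case/dvdnP => -[->//|k kE].
      have bE : b = (a + k.+1 * K)%N by rewrite -kE subnKC.
      have aK_b : (a + K <= b)%N by rewrite bE leq_add2l leq_pmull.
      have sq_le : (a ^ 2 + K ^ 2 <= b ^ 2)%N.
        by rewrite -(leq_exp2r _ _ (isT : 0 < 2)%N) in aK_b; rewrite (leq_trans _ aK_b) // sqrnD leq_addr.
      have : (d * a ^ 2 + K ^ 2 <= d * b ^ 2)%N.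
        by apply: leq_trans (leq_mul (leqnn d) sq_le); rewrite mulnDr leq_add2l leq_pmull.
      by rewrite -ni -nj; move: iK jK; clear; lia.
    by move/esym: nj; rewrite -ab_eq -ni => /eqP; rewrite eqSS eqn_add2l eq_sym => /eqP.
  move=> i j; rewrite !inE => /eqP/sym_diff_nil si /eqP/sym_diff_nil sj [two_eq sq_eq].
  have core_eq : squarefree_part (u + i).+1 = squarefree_part (u + j).+1.
    by apply: squarefree_part_eq => // l; rewrite -si sj.
  by case/orP: (leq_total (square_part (u + i).+1) (square_part (u + j).+1)) => [|le];
    [exact: wl | apply/esym; exact: (wl j i)].
by rewrite -(card_in_imset g_inj) (leq_trans (max_card _)) // card_prod card_bool card_ord.
Qed.

Section PairSums.
Variables (R : realFieldType) (z X N K0 u : nat) (K : R).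
Let H := (K0 ^ 2)%N.
Hypotheses (z_gt0 : (0 < z)%N) (K0_gt0 : (0 < K0)%N) (H_z : (H <= z)%N) (z_X : (z < X)%N).
Hypotheses (u_X : (u + H <= 3 * X)%N) (K_ge0 : 0 <= K).
Hypothesis chi_K : forall s M N', odd_primes_seq s -> s != [::] ->
  (\prod_(l <- s) l <= 9 * X ^ 2)%N -> (N' <= N)%N ->
  `|\sum_(M <= m < M + N') (chi s m)%:~R| <= K.

Let V := selberg_weight R z.
Let s (h : 'I_H) := odd_part_primes (u + h).+1.
Let bad_bound : R := N%:R / selberg_mass R z + (z ^ 7)%:R.
Let good_bound : R := (z ^ 6 * H ^ 2)%:R * K.
Let pair_sum h h' : R := \sum_(X <= m < X + N) V m ^+ 2 * (chi (s h) m * chi (s h') m)%:~R.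

Lemma pair_sum_bad h h' : `|pair_sum h h'| <= bad_bound.
Proof.
apply: le_trans (sum_selberg_weight_le R z_gt0 X N).
apply: (le_trans (ler_norm_sum _ _ _)); apply: ler_sum => m _.
rewrite normrM (ger0_norm (sqr_ge0 _)) ler_piMr ?sqr_ge0 //.
rewrite -intr_norm -[leRHS](mulr1z 1) ler_int normrM mulr_ile1 ?normr_chi_le1 //.
Qed.

(** A prime in both lists divides the nonzero difference of [h] and [h'], so it is at most [H <= z]:
    shared primes are sieve primes, and their coprimality condition costs only [H ^ 2]. Each list
    has product at most [3 * X], whence the modulus bound [9 * X ^ 2]. *)
Lemma pair_sum_good h h' : sym_diff (s h) (s h') != [::] -> `|pair_sum h h'| <= good_bound.
Proof.
move=> d_n0; pose D := `|h - h'|%N; pose T := [seq l <- s h | l \in s h'].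
have s_ok k : odd_primes_seq (s k) := odd_part_primes_seq _.
have hh' : h != h'.
  apply: contraNneq d_n0 => ->; rewrite /sym_diff.
  have -> : [seq l <- s h' | l \notin s h'] = [::]; last by [].
  by apply/eqP; rewrite -(negbK (_ == _)) -has_filter; apply/hasPn => l ->.
have D_gt0 : (0 < D)%N by rewrite lt0n distn_eq0.
have D_le : (D <= H)%N by have := ltn_ord h; have := ltn_ord h'; rewrite /D; lia.
have T_D l : l \in T -> (l %| D)%N.
  rewrite mem_filter => /andP[/mem_odd_part_primes[_ _ l1] /mem_odd_part_primes[_ _ l2]].
  rewrite /D -(distnDl u.+1) !addSn.
  by case: (leqP (u + h).+1 (u + h').+1) => [le|/ltnW le]; rewrite ?(distnEl le) ?(distnEr le) dvdn_sub.
have bound := sum_selberg_char_le (R := R) z_gt0 (f := fun m => (chi (sym_diff (s h) (s h')) m)%:~R)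
  (K := K) (N0 := N) (T := T) (D := D) X.
apply: le_trans (_ : (z ^ 6 * D ^ 2)%:R * K <= _); last first.
  by rewrite ler_wpM2r // ler_nat leq_mul2l leq_exp2r // D_le orbT.
apply: le_trans (bound _ _ _ _ D_gt0 T_D (leqnn N)).
- rewrite le_eqVlt; apply/orP; left; apply/eqP; congr `|_|; apply: eq_bigr => m _.
  rewrite chi_mul_chi // intrM; congr (_ * (_ * _)).
  rewrite coprime_indicatorE ?filter_uniq ?primes_uniq //; last first.
    move=> l lT; rewrite mem_sieve_primes (leq_trans _ H_z) ?andbT.
      by move: lT; rewrite mem_filter => /andP[/mem_odd_part_primes[]].
    by rewrite (leq_trans (dvdn_leq D_gt0 (T_D l lT))).
  rewrite rmorph_prod /= big_filter; apply: eq_bigr => l _; by case: ifP.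
- by move=> m n; rewrite chiM ?intrM // sym_diff_odd_primes.
- by move=> m; rewrite -intr_norm -[leRHS](mulr1z 1) ler_int normr_chi_le1.
move=> M N' N'_N; apply: chi_K => //; first exact: sym_diff_odd_primes.
apply: (leq_trans (prod_sym_diff_le (s_ok h) (s_ok h'))).
have le3X (k : 'I_H) : (\prod_(l <- s k) l <= 3 * X)%N.
  rewrite (leq_trans (prod_odd_part_primes_le _)) // (leq_trans _ u_X) //.
  by rewrite -addnS leq_add2l.
by rewrite (leq_trans (leq_mul (le3X h) (le3X h'))) // mulnn expnMn.
Qed.

Lemma bad_bound_ge0 : 0 <= bad_bound.
Proof.
rewrite addr_ge0 ?ler0n // divr_ge0 ?ler0n //.
by rewrite (le_trans ler01) // selberg_mass_ge1.
Qed.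

Lemma good_bound_ge0 : 0 <= good_bound.
Proof. by rewrite mulr_ge0 ?ler0n. Qed.

Let class_bound : R := H%:R * ((2 * K0)%:R * bad_bound + H%:R * good_bound).

Lemma class_sum_le (e : 'I_H -> int) : (forall h, `|e h| <= 1) ->
  \sum_(X <= m < X + N) V m ^+ 2 * (\sum_h e h * chi (s h) m)%:~R ^+ 2 <= class_bound.
Proof.
move=> e_le1.
have -> : \sum_(X <= m < X + N) V m ^+ 2 * (\sum_h e h * chi (s h) m)%:~R ^+ 2
    = \sum_h \sum_h' (e h * e h')%:~R * pair_sum h h'.
  transitivity (\sum_(X <= m < X + N) \sum_h \sum_h'
      (e h * e h')%:~R * (V m ^+ 2 * (chi (s h) m * chi (s h') m)%:~R)).
    apply: eq_bigr => m _; rewrite -rmorphXn /= [(\sum_h _) ^+ 2]expr2 big_distrlr rmorph_sum /= mulr_sumr.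
    apply: eq_bigr => h _; rewrite rmorph_sum /= mulr_sumr; apply: eq_bigr => h' _.
    by rewrite mulrACA [in LHS]intrM; ring.
  rewrite exchange_big /=; apply: eq_bigr => h _; rewrite exchange_big /=.
  by apply: eq_bigr => h' _; rewrite -mulr_sumr.
have row h : \sum_h' (e h * e h')%:~R * pair_sum h h'
    <= (2 * K0)%:R * bad_bound + H%:R * good_bound.
  have term h' : (e h * e h')%:~R * pair_sum h h'
      <= (if sym_diff (s h) (s h') == [::] then bad_bound else 0) + good_bound.
    apply: (le_trans (ler_norm _)); rewrite normrM.
    apply: (@le_trans _ _ `|pair_sum h h'|).
      rewrite ler_piMl // -intr_norm -[leRHS](mulr1z 1) ler_int normrM mulr_ile1 //.
    case: eqP => [_|/eqP d_n0].
      by rewrite (le_trans (pair_sum_bad h h')) // lerDl good_bound_ge0.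
    by rewrite add0r pair_sum_good.
  apply: (le_trans (ler_sum _ (fun h' _ => term h'))).
  rewrite big_split /= -big_mkcond !sumr_const card_ord -[X in _ + X <= _]mulr_natl.
  rewrite lerD2r -[leLHS]mulr_natl ler_wpM2r ?bad_bound_ge0 // ler_nat.
  by have := card_same_odd_part u (s h) K0_gt0; rewrite cardsE.
apply: (le_trans (ler_sum _ (fun h _ => row h))).
by rewrite sumr_const card_ord -[leLHS]mulr_natl.
Qed.

Let G b c m : int :=
  \sum_(h < H) reciprocity_sign b c (u + h).+1 * chi (s h) m.

(** Since [p >= H], at most one of the [H] consecutive integers is divisible by [p]; that term can
    fall from 1 to no less than -1. *)
Lemma sign_sum_prime p : prime p -> odd p -> (H <= p)%N ->
  (forall h : 'I_H, ~~ (p %| (u + h).+1)%N -> legendre p (u + h).+1 = 1) ->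
  H%:Z - 2 <= G (legendre p 2 == 1) (odd p./2) p.
Proof.
move=> p_pr p_odd H_p res.
have term (h : 'I_H) : 1 - (if (p %| (u + h).+1)%N then 2 else 0) <=
    reciprocity_sign (legendre p 2 == 1) (odd p./2) (u + h).+1 * chi (s h) p.
  case: ifPn => [_|p_h]; last by rewrite -legendre_reciprocity_sign // res ?subr0.
  have : `|reciprocity_sign (legendre p 2 == 1) (odd p./2) (u + h).+1 * chi (s h) p| <= 1.
    by rewrite normrM mulr_ile1 ?normr_reciprocity_sign ?normr_chi_le1.
  by rewrite ler_norml => /andP[].
apply: le_trans (ler_sum _ (fun h _ => term h)).
have sum1 : \sum_(i < H) (1 : int) = H%:Z by rewrite sumr_const card_ord natz.
rewrite sumrB sum1 lerD2l lerN2 -big_mkcond /=.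
have [h0 ph0|none] := pickP (fun h : 'I_H => (p %| (u + h).+1)%N); last by rewrite big_pred0.
rewrite (bigD1 h0) //= big_pred0 // => h; apply/negbTE; apply/negP => /andP[ph hh0].
have : (p %| `|h - h0|)%N.
  rewrite -(distnDl u.+1) !addSn.
  by case: (leqP (u + h).+1 (u + h0).+1) => [le|/ltnW le]; rewrite ?(distnEl le) ?(distnEr le) dvdn_sub.
move/dvdn_leq; rewrite lt0n distn_eq0 => /(_ hh0).
by have := ltn_ord h; have := ltn_ord h0; lia.
Qed.

(** [E] need not be split by class: the squares for all four [(b, c)] are added, and by positivity
    each prime keeps the one of its own class. *)
Lemma exceptional_count (E : seq nat) : uniq E -> (2 < H)%N ->
  (forall p, p \in E -> [/\ prime p, (X <= p)%N, (p < X + N)%N &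
     forall h : 'I_H, ~~ (p %| (u + h).+1)%N -> legendre p (u + h).+1 = 1]) ->
  (size E)%:R * (H - 2)%:R ^+ 2 <= 4 * class_bound.
Proof.
move=> E_uniq H_gt2 E_P.
pose F m : R := V m ^+ 2 * \sum_(b : bool) \sum_(c : bool) (G b c m)%:~R ^+ 2.
have F_ge0 m : 0 <= F m.
  by rewrite mulr_ge0 ?sqr_ge0 //; apply: sumr_ge0 => b _; apply: sumr_ge0 => c _; exact: sqr_ge0.
apply: (@le_trans _ _ (\sum_(p <- E) F p)).
  have -> : (size E)%:R * (H - 2)%:R ^+ 2 = \sum_(p <- E) (H - 2)%:R ^+ 2 :> R.
    by rewrite big_const_seq count_predT iter_addr_0 mulr_natl.
  rewrite big_seq [leRHS]big_seq; apply: ler_sum => p /E_P[p_pr X_p _ res].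
  have z_p : (z < p)%N := leq_trans z_X X_p.
  have H_p : (H <= p)%N := leq_trans H_z (ltnW z_p).
  have p_odd : odd p by case: (even_prime p_pr) => // p2; move: H_gt2 H_p; rewrite p2; clear; lia.
  have := sign_sum_prime p_pr p_odd H_p res.
  set b0 := (_ == 1); set c0 := odd _ => G_ge.
  rewrite /F /V selberg_weight_prime // expr1n mul1r.
  apply: (@le_trans _ _ ((G b0 c0 p)%:~R ^+ 2)).
    have GR : (H - 2)%:R <= (G b0 c0 p)%:~R :> R.
      by rewrite -[(H - 2)%:R]/((H - 2)%:Z%:~R) ler_int -subzn // ltnW.
    by rewrite lerXn2r // nnegrE ?ler0n // (le_trans _ GR) ?ler0n.
  rewrite (bigD1 b0) //= (bigD1 c0) //= -addrA lerDl addr_ge0 //.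
    by apply: sumr_ge0 => c _; exact: sqr_ge0.
  by apply: sumr_ge0 => b _; apply: sumr_ge0 => c _; exact: sqr_ge0.
apply: (@le_trans _ _ (\sum_(m <- index_iota X (X + N)) F m)).
  apply: ler_sum_uniq_sub => //; first exact: iota_uniq.
  by move=> p /E_P[_ X_p p_X _]; rewrite mem_index_iota X_p.
have -> : \sum_(m <- index_iota X (X + N)) F m = \sum_(b : bool) \sum_(c : bool)
    \sum_(X <= m < X + N) V m ^+ 2 * (G b c m)%:~R ^+ 2.
  under eq_bigr do rewrite /F mulr_sumr.
  rewrite exchange_big /=; apply: eq_bigr => b _.
  by under eq_bigr do rewrite mulr_sumr; rewrite exchange_big.
apply: (@le_trans _ _ (\sum_(b : bool) \sum_(c : bool) class_bound)).
  apply: ler_sum => b _; apply: ler_sum => c _; apply: class_sum_le => h.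
  exact: normr_reciprocity_sign.
by rewrite !sumr_const card_bool -mulrnA mulr_natl.
Qed.
End PairSums.

(* Choice of parameters and passage to the limit *)
From mathcomp Require Import finmap.
From mathcomp Require Import all_classical all_reals all_analysis.

Import numFieldNormedType.Exports.

Local Open Scope classical_set_scope.
Local Open Scope ring_scope.

Lemma not_nonresidue_legendre (p n : nat) : prime p -> odd p -> ~~ (p %| n)%N ->
  ~ quad_nonresidue p n%:Z -> legendre p n = 1.
Proof.
move=> p_pr p_odd p_n not_nr; have p_ch := pchar_Fp p_pr.
have [x nx] : exists x : int, (n%:Z = x ^+ 2 %[mod p])%Z.
  by apply: contrapT => no_x; apply: not_nr; split.
have nE : (n%:R : 'F_p) = x%:~R ^+ 2.
  move/eqP: nx; rewrite eqz_mod_dvd (dvdz_pcharf p_ch) intrB subr_eq0 => /eqP.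
  by rewrite rmorphXn.
have n0 : (n%:R : 'F_p) != 0 by rewrite -(dvdn_pcharf p_ch).
rewrite /legendre nE qchar_sqr //; apply: contraNneq n0; rewrite nE => ->.
by rewrite expr0n.
Qed.

Lemma exceptional_prime_residues (R : realType) (psi : R -> R) (u H : nat) (Q : R) p :
  odd p -> H%:R <= psi p%:R -> exceptional_primes psi u%:Z Q p ->
  forall h : 'I_H, ~~ (p %| (u + h).+1)%N -> legendre p (u + h).+1 = 1.
Proof.
move=> p_odd H_psi [p_pr _ _ psi_d] h p_n; apply: not_nonresidue_legendre => // nr.
have [_ d_min] := nonresidue_distP u%:Z p_pr p_odd.
have : (nonresidue_dist u p <= H)%N.
  apply: d_min; split; first exact: leq_ltn_trans (ltn_ord h).
  exists (u + h).+1%:Z; split=> //.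
    by rewrite -addn1 PoszD lerD2r lez_nat leq_addr.
  by rewrite -PoszD lez_nat -addnS leq_add2l.
by rewrite -(ler_nat R) leNgt (le_lt_trans H_psi).
Qed.

Lemma ln_le_harmonic (R : realType) n :
  ln (n.+1%:R : R) <= \sum_(1 <= k < n.+1) k%:R^-1.
Proof.
elim: n => [|n IH]; first by rewrite ln1 big_geq.
rewrite big_nat_recr //=; have n0 : 0 < n.+1%:R :> R by rewrite ltr0n.
have -> : n.+2%:R = n.+1%:R * (1 + n.+1%:R^-1) :> R.
  by rewrite mulrDr mulr1 mulfV ?gt_eqF // natr1.
rewrite lnM ?posrE ?addr_gt0 ?invr_gt0 // lerD // le_ln1Dx //.
by rewrite (lt_trans _ (_ : 0 < n.+1%:R^-1)) ?invr_gt0 // ltrN10.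
Qed.

Lemma root_floor k X : (0 < k)%N -> exists2 z, (z ^ k <= X)%N & (X < z.+1 ^ k)%N.
Proof.
move=> k_gt0.
have ex_z : exists z, (z ^ k <= X)%N by exists 0%N; rewrite exp0n.
have bd_z z : (z ^ k <= X)%N -> (z <= X)%N.
  have [->//|z_gt0] := posnP z; apply: leq_trans.
  by rewrite -{1}(expn1 z) leq_pexp2l.
have [z z_lo z_max] := ex_maxnP ex_z bd_z; exists z => //.
by rewrite ltnNge; apply/negP => /z_max; rewrite ltnn.
Qed.

(** The length [X + 2] covers all [p <= 2 * Q] when [X] is the floor of [Q]. Bad pairs have
    proportion [2 / K], and 64 is 16, from four classes and [H <= 2 * (H - 2)], times this 2 and the
    2 in [X + 2 <= 2 * X]. For good pairs the loss [z ^ 6] against the gain [z ^ 9] leaves more than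
    the claimed [z ^ 2]. *)
Lemma exceptional_bound (R : realType) : exists C : nat,
  forall (K z X u : nat) (E : seq nat),
    (2 <= K)%N -> (K ^ 2 <= z)%N -> (z ^ 2200 <= X)%N -> (u <= 2 * X + 1)%N -> uniq E ->
    (forall p, p \in E -> [/\ prime p, (X <= p)%N, (p < X + (X + 2))%N &
       forall h : 'I_(K ^ 2), ~~ (p %| (u + h).+1)%N -> legendre p (u + h).+1 = 1]) ->
  (size E)%:R <= 64 * X%:R / (K%:R * selberg_mass R z)
    + (32 + 16 * ((K ^ 2) ^ 2)%:R * C%:R) * X%:R / z%:R ^+ 2.
Proof.
have [C chi_le] := sum_chi_le; exists C => K z X u E K2 K_z z_X u_X E_uniq E_P.
set H := (K ^ 2)%N in K_z E_P *.
have H4 : (4 <= H)%N by rewrite (leq_exp2r 2 K (isT : 0 < 2)%N).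
have z_gt0 : (0 < z)%N by rewrite (leq_trans _ K_z) // (leq_trans _ H4).
have z2 : (2 <= z)%N by rewrite (leq_trans _ K_z) // (leq_trans _ H4).
have z9_X : (z ^ 9 <= X)%N by apply: leq_trans z_X; rewrite leq_pexp2l.
have zX : (z < X)%N.
  apply: leq_trans z9_X; rewrite (@leq_trans (z ^ 2)) //; last by rewrite leq_pexp2l.
  by rewrite -[ltnLHS]muln1 -mulnn ltn_pmul2l.
have K_gt0 : (0 < K)%N by exact: ltnW.
have z9_gt0 : 0 < (z ^ 9)%:R :> R by rewrite ltr0n expn_gt0 z_gt0.
pose B : R := C%:R * X%:R / (z ^ 9)%:R.
have B_ge0 : 0 <= B by rewrite divr_ge0 ?mulr_ge0 ?ler0n.
have chi_B s M N' : odd_primes_seq s -> s != [::] ->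
    (\prod_(l <- s) l <= 9 * X ^ 2)%N -> (N' <= X + 2)%N ->
    `|\sum_(M <= m < M + N') (chi s m)%:~R| <= B.
  move=> s_ok s_n0 s_X N'_X.
  have N'_2X : (N' <= 2 * X)%N.
    by rewrite (leq_trans N'_X) // mul2n -addnn leq_add2l (leq_trans z2) // ltnW.
  have chi_z := chi_le s z X M N' s_ok s_n0 z_gt0 z_X s_X N'_2X.
  have -> : \sum_(M <= m < M + N') (chi s m)%:~R = (\sum_(m < N') chi s (M + m))%:~R :> R.
    rewrite rmorph_sum /= -{1}[M]add0n big_addn addKn big_mkord.
    by apply: eq_bigr => m _; rewrite addnC.
  rewrite -intr_norm /B ler_pdivlMr // mulrC -natrM.
  by move: chi_z; rewrite -(ler_int R) intrM.
have u_3X : (u + H <= 3 * X)%N.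
  by move: u_X K_z zX; clear; lia.
have := exceptional_count z_gt0 K_gt0 K_z zX u_3X B_ge0 chi_B E_uniq _ E_P.
rewrite -/H (leq_trans _ H4) // => /(_ isT).
have m1 := @selberg_mass_ge1 R z z_gt0; have m0 := lt_le_trans ltr01 m1.
set S := selberg_mass R z in m1 m0 *; set e := (size E)%:R => count.
have H_half : H%:R <= 2 * (H - 2)%:R :> R by rewrite -natrM ler_nat; move: H4; clear; lia.
have e0 : 0 <= e by rewrite ler0n.
have H0 : 0 < H%:R :> R by rewrite ltr0n (leq_trans _ H4).
have X0 : 0 <= X%:R :> R by rewrite ler0n.
have k0 : 0 < K%:R :> R by rewrite ltr0n.
have x0 : 0 < z%:R :> R by rewrite ltr0n.
have HE : H%:R = K%:R ^+ 2 :> R by rewrite natrX.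
have eH : e * H%:R ^+ 2 <= 16 * (H%:R * ((2 * K)%:R * ((X + 2)%:R / S + (z ^ 7)%:R)
    + H%:R * ((z ^ 6 * H ^ 2)%:R * B))).
  apply: (@le_trans _ _ (4 * (e * (H - 2)%:R ^+ 2))).
    rewrite [leRHS]mulrCA ler_wpM2l // (_ : 4 = 2 ^+ 2 :> R) -?exprMn; last by ring.
    by rewrite lerXn2r ?nnegrE ?mulr_ge0 ?ler0n // ltW.
  apply: (le_trans (ler_wpM2l _ count)) => //.
  by rewrite le_eqVlt; apply/orP; left; apply/eqP; rewrite -/H -/S; ring.
have e_le : e <= 32 * ((X + 2)%:R / S + (z ^ 7)%:R) / K%:R + 16 * H%:R ^+ 2 * (z%:R ^+ 6 * B).
  have H2 : 0 < H%:R ^+ 2 :> R by rewrite exprn_gt0.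
  rewrite -(ler_pM2r H2); apply: (le_trans eH).
  rewrite le_eqVlt; apply/orP; left; apply/eqP.
  rewrite [(2 * K)%:R]natrM [(_ * H ^ 2)%:R]natrM !natrX.
  by field; rewrite !gt_eqF.
have z7_X : (z ^ 7)%:R <= X%:R / z%:R ^+ 2 :> R.
  by rewrite ler_pdivlMr ?exprn_gt0 // -natrX -natrM ler_nat -expnD.
have X2 : (X + 2)%:R <= 2 * X%:R :> R.
  by rewrite -natrM ler_nat mul2n -addnn leq_add2l (leq_trans z2) // ltnW.
have K1 : K%:R^-1 <= 1 :> R by rewrite invf_le1 // ler1n.
have Ki0 : 0 <= K%:R^-1 :> R by rewrite invr_ge0 ltW.
apply: (le_trans e_le).
have -> : 64 * X%:R / (K%:R * S) = 32 * (2 * X%:R / S) / K%:R by field; rewrite !gt_eqF.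
have z6B : z%:R ^+ 6 * B <= C%:R * (X%:R / z%:R ^+ 2).
  rewrite /B natrX.
  have -> : z%:R ^+ 6 * (C%:R * X%:R / z%:R ^+ 9) = C%:R * (X%:R / z%:R ^+ 2) / z%:R :> R.
    by field; rewrite gt_eqF.
  by rewrite ler_pdivrMr // ler_peMr ?ler1n.
rewrite mulrDr mulrDl -addrA; apply: lerD.
  by rewrite ler_wpM2r // ler_wpM2l // ler_wpM2r // invr_ge0 ltW.
rewrite [in leRHS]mulrDl [in leRHS]mulrDl; apply: lerD.
  apply: (@le_trans _ _ (32 * (z ^ 7)%:R)); last by rewrite -mulrA ler_wpM2l.
  by rewrite ler_piMr // mulr_ge0 // ler0n.
rewrite natrX; set c := 16 * _.
have c0 : 0 <= c by rewrite mulr_ge0 // exprn_ge0.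
by rewrite -[leRHS]mulrA -[leRHS]mulrA ler_wpM2l.
Qed.

Theorem theorem1p1 (R : realType) (psi : R -> R)
    (psi_gt0 : forall z : R, 0 < z -> 0 < psi z)
    (psi_pinfty : psi z @[z --> +oo] --> +oo) :
  forall kappa : R, 0 < kappa ->
  exists Q0 : R, forall Q : R, 0 < Q -> Q0 <= Q ->
  forall u : int, 0 <= u -> u%:~R <= 2 * Q ->
    (#|` fset_set (exceptional_primes psi u Q)|)%:R <= kappa * (Q / ln Q).
Proof.
move=> kappa kappa_gt0; have [C bound] := exceptional_bound R.
(* [w] is the real number 2200: from [Q <= z.+1 ^ 2200], [ln Q] is at most [w * ln z.+1], hence at
   most [2 * w] times the Selberg mass. *)
have [w w_gt0 wE] : exists2 w : R, 0 < w & forall y, y *+ 2200 = w * y.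
  by exists 2200%:R; [rewrite ltr0n | move=> y; rewrite mulr_natl].
pose a : R := 64 * (2 * w).
(* [K] depends on [kappa] alone and brings the main term below [kappa / 2]. As [c] grows with [K],
   [z0] is chosen afterwards: [ln Q <= w * z] against the denominator [z ^ 2] leaves a factor
   [1 / z] to absorb [c]. *)
pose K := (Num.truncn (2 * a / kappa)).+2.
pose c : R := 32 + 16 * ((K ^ 2) ^ 2)%:R * C%:R.
pose z0 := (maxn (K ^ 2) (Num.truncn (2 * w * c / kappa)).+1).
move/cvgryPge: psi_pinfty => /(_ (K ^ 2)%:R)[A [_ psi_A]].
(* One added 1 gives the strict inequality [A < p]; the other pays for replacing [Q] by its floor
   [X] when comparing with [z0 ^ 2200]. *)
exists (Num.max (A + 1) ((z0 ^ 2200)%:R + 1)) => Q Q_gt0; rewrite ge_max => /andP[A_Q z0_Q].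
move=> [u|//] _ u_Q.
pose X := Num.truncn Q.
have X_Q : X%:R <= Q by rewrite truncn_le // ltW.
have Q_X : Q < X.+1%:R by rewrite truncnS_gt.
have [z z_lo z_hi] := @root_floor 2200 X isT.
have z0_z : (z0 <= z)%N.
  rewrite leqNgt; apply/negP => z_z0.
  have : (X < z0 ^ 2200)%N by apply: leq_trans z_hi _; rewrite leq_exp2r.
  by rewrite ltnNge -ltnS -(ltr_nat R) (le_lt_trans _ Q_X) // (le_trans _ z0_Q) // lerDl.
have E_P p : p \in fset_set (exceptional_primes psi u Q) -> exceptional_primes psi u Q p.
  by rewrite in_fset_set ?inE //; exact: finite_exceptional_primes.
have K_z : (K ^ 2 <= z)%N := leq_trans (leq_maxl _ _) z0_z.
have z4 : (4 <= z)%N by apply: leq_trans K_z; rewrite (leq_exp2r 2 K (isT : 0 < 2)%N).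
have z_X : (z <= X)%N by apply: leq_trans z_lo; rewrite -{1}(expn1 z) leq_pexp2l // (leq_trans _ z4).
have Q2_X : 2 * Q < (2 * X).+2%:R.
  have -> : (2 * X).+2 = (2 * X.+1)%N by rewrite mulnS.
  by rewrite natrM ltr_pM2l.
have u_X : (u <= 2 * X + 1)%N by rewrite addn1 -ltnS -(ltr_nat R) (le_lt_trans u_Q).
have z0R : 0 < z%:R :> R by rewrite ltr0n (leq_trans _ z4).
have Q_gt1 : 1 < Q by apply: lt_le_trans X_Q; rewrite ltr1n (leq_trans _ z_X) // (leq_trans _ z4).
have L_gt0 : 0 < ln Q by rewrite ln_gt0.
have S_gt0 : 0 < selberg_mass R z.
  by apply: lt_le_trans ltr01 (selberg_mass_ge1 _ _); rewrite (leq_trans _ z4).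
have ln_Q : ln Q <= w * ln (z.+1%:R : R).
  have Q_z : Q <= z.+1%:R ^+ 2200.
    by rewrite (le_trans (ltW Q_X)) // -natrX ler_nat.
  have z1_gt0 : 0 < z.+1%:R :> R by rewrite ltr0n.
  rewrite -wE -lnXn //; by rewrite ler_ln ?posrE ?exprn_gt0.
have ln_S : ln Q <= 2 * w * selberg_mass R z.
  have z_gt0 : (0 < z)%N by rewrite (leq_trans _ z4).
  have h := le_trans (ln_le_harmonic R z) (harmonic_le_selberg_mass R z_gt0).
  by apply: (le_trans ln_Q); rewrite -mulrA mulrCA ler_wpM2l // ltW.
have ln_z : ln Q <= w * z%:R.
  apply: (le_trans ln_Q); rewrite ler_wpM2l ?(ltW w_gt0) // -natr1 addrC le_ln1Dx //.
  by rewrite (lt_trans _ z0R) // ltrN10.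
apply: (le_trans (bound K z X u _ _ K_z z_lo u_X (fset_uniq _) _)) => //.
  move=> p /E_P E_p; have [p_pr Q_p p_Q _] := E_p; split => //.
  - rewrite -(ler_nat R); exact: le_trans X_Q Q_p.
  - by rewrite addnA addnn -mul2n addn2 -(ltr_nat R) (le_lt_trans p_Q).
  - apply: (exceptional_prime_residues _ _ E_p); last first.
      by apply: psi_A; rewrite (lt_le_trans _ Q_p) // (lt_le_trans _ A_Q) // ltrDl.
    have [p2|//] := even_prime p_pr; move: (le_trans X_Q Q_p); rewrite p2 ler_nat.
    by move: z4 z_X; clear; lia.
have a_K : a <= kappa / 2 * K%:R.
  have : 2 * a / kappa <= K%:R.
    by rewrite (le_trans (ltW (truncnS_gt _))) // ler_nat.
  by rewrite ler_pdivrMr // => h; move: h; move: K%:R => k; clear; lra.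
have c_z : w * c <= kappa / 2 * z%:R.
  have : 2 * w * c / kappa <= z%:R.
    rewrite (le_trans (ltW (truncnS_gt _))) // ler_nat.
    by apply: leq_trans z0_z; exact: leq_maxr.
  by rewrite ler_pdivrMr // => h; move: h; rewrite -mulrA; move: z%:R (w * c) => k d; clear; lra.
have T1 : 64 * X%:R / (K%:R * selberg_mass R z) <= kappa / 2 * (Q / ln Q).
  have K_gt0 : 0 < K%:R :> R by rewrite ltr0n.
  rewrite ler_pdivrMr ?mulr_gt0 //.
  have -> : kappa / 2 * (Q / ln Q) * (K%:R * selberg_mass R z)
     = (kappa / 2 * K%:R) * (Q * (selberg_mass R z / ln Q)) by ring.
  have SL : (2 * w)^-1 <= selberg_mass R z / ln Q.
    by rewrite ler_pdivlMr // mulrC ler_pdivrMr ?mulr_gt0 // mulrC.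
  apply: (@le_trans _ _ (a * (Q * (2 * w)^-1))).
    rewrite /a (_ : 64 * (2 * w) * (Q / (2 * w)) = 64 * Q); last by field; rewrite gt_eqF.
    by rewrite ler_wpM2l.
  apply: ler_pM => //.
  - by rewrite /a mulr_ge0 // mulr_ge0 // ltW.
  - by rewrite divr_ge0 ?(ltW Q_gt0) // mulr_ge0 // ltW.
  - by rewrite ler_wpM2l // ltW.
have T2 : c * X%:R / z%:R ^+ 2 <= kappa / 2 * (Q / ln Q).
  have c_ge0 : 0 <= c by rewrite addr_ge0 // mulr_ge0 ?ler0n // mulr_ge0 ?ler0n.
  rewrite ler_pdivrMr ?exprn_gt0 // mulrA mulrAC ler_pdivlMr //.
  apply: (@le_trans _ _ (c * X%:R * (w * z%:R))).
    by rewrite ler_wpM2l // mulr_ge0 ?ler0n.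
  have -> : c * X%:R * (w * z%:R) = (w * c) * (X%:R * z%:R) by ring.
  have -> : kappa / 2 * Q * z%:R ^+ 2 = (kappa / 2 * z%:R) * (Q * z%:R) by ring.
  apply: ler_pM => //; first by rewrite mulr_ge0 // ltW.
  by rewrite ler_wpM2r // ltW.
rewrite (splitr kappa) [leRHS]mulrDl; exact: lerD.
Qed.
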